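(* There exists a universal constant $D$ (one can take $D=6720\sqrt{2}e^2<70223$) such that for every $n\ge 1$, every symmetric random vector $X$ with values in $\mathbb{R}^n$ and with independent coordinates which have log-concave tails, every norm $\|\cdot\|$ on $\mathbb{R}^n$ and every $p\ge 2$, $$\bigl(\mathbb{E}\|X\|^p\bigr)^{1/p}\le \mathbb{E}\|X\|+D\,\sigma_{\|\cdot\|,X}(p).$$
   Context: A random vector $X$ is symmetric if $X$ and $-X$ have the same distribution. A real random variable $Y$ has log-concave tails if $t\mapsto -\ln\mathbb{P}(|Y|\ge t)\in[0,\infty]$ is convex on $[0,\infty)$ (with $-\ln 0=+\infty$). For a real random variable $Y$ and $p\ge1$, $\|Y\|_p:=(\mathbb{E}|Y|^p)^{1/p}$. The $p$-th weak moment of $X$ associated with a norm $\|\cdot\|$ on $\mathbb{R}^n$ is $\sigma_{\|\cdot\|,X}(p):=\sup_{\|t\|_*\le 1}\|\langle t,X\rangle\|_p$, where $\|\cdot\|_*$ is the dual norm of $\|\cdot\|$. *)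

(* Defs.v *)
From HB Require Import structures.
From mathcomp Require Import all_boot all_order all_algebra.
From mathcomp Require Import all_classical all_reals all_analysis.

Set Implicit Arguments.
Unset Strict Implicit.
Unset Printing Implicit Defensive.

Import Order.TTheory GRing.Theory Num.Theory.
Import numFieldNormedType.Exports.

Local Open Scope classical_set_scope.
Local Open Scope ring_scope.

(* Random vectors take values in [n.-tuple R], which carries the product (hence
   Borel) sigma-algebra of R^n; norms live on the vector space ['rV[R]_n].
   [vec] identifies the two models of R^n. *)
Definition vec {R : realType} {n : nat} (x : n.-tuple R) : 'rV[R]_n :=
  \row_(i < n) tnth x i.

Definition oppt {R : realType} {n : nat} (x : n.-tuple R) : n.-tuple R :=
  [tuple - tnth x i | i < n].

Definition dotv {R : realType} {n : nat} (t x : 'rV[R]_n) : R :=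
  \sum_(i < n) t 0 i * x 0 i.

(* Nonnegativity and [N 0 = 0] follow from the three fields. *)
Record is_norm {R : realType} {n : nat} (N : 'rV[R]_n -> R) : Prop := IsNorm {
  norm_triangle : forall x y, N (x + y) <= N x + N y;
  norm_homogeneous : forall (a : R) x, N (a *: x) = `|a| * N x;
  norm_separated : forall x, N x = 0 -> x = 0 }.

Definition dual_norm {R : realType} {n : nat} (N : 'rV[R]_n -> R)
    (t : 'rV[R]_n) : \bar R :=
  ereal_sup [set (`|dotv t x|)%:E | x in [set x | N x <= 1]].

Section probability_notions.
Context {d : measure_display} {T : measurableType d} {R : realType}.
Variable P : probability T R.

Definition symmetric_vector {n : nat} (X : {RV P >-> n.-tuple R}) : Prop :=
  forall A : set (n.-tuple R), measurable A ->
    distribution P X A = pushforward P (oppt \o X) A.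

Definition coordinate {n : nat} (X : {RV P >-> n.-tuple R}) (i : 'I_n) : T -> R :=
  fun w => tnth (X w) i.

Definition mutually_independent {n : nat} (Y : 'I_n -> T -> R) : Prop :=
  forall (J : {set 'I_n}) (A : 'I_n -> set R),
    (forall i, measurable (A i)) ->
    P (\bigcap_(i in [set` J]) (Y i @^-1` A i)) =
    (\prod_(i in J) P (Y i @^-1` A i))%E.

(* [lne 0 = -oo], so this is [+oo] where the tail vanishes. *)
Definition neg_log_tail (Y : T -> R) (t : R) : \bar R :=
  (- lne (P [set w | (t <= `|Y w|)%R]))%E.

(* Convexity on [0, +oo[ of a function with values in [0, +oo]; in [\bar R],
   [0 * +oo = 0], so the endpoints [a = 0] and [a = 1] impose nothing. *)
Definition log_concave_tails (Y : T -> R) : Prop :=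
  forall s t a : R, 0 <= s -> 0 <= t -> 0 <= a <= 1 ->
    (neg_log_tail Y (a * s + (1 - a) * t)%R <=
     a%:E * neg_log_tail Y s + (1 - a)%:E * neg_log_tail Y t)%E.

Definition Lp_norm (p : R) (Y : T -> R) : \bar R := 'N[P]_(p%:E)[EFin \o Y].

Definition weak_moment {n : nat} (N : 'rV[R]_n -> R)
    (X : {RV P >-> n.-tuple R}) (p : R) : \bar R :=
  ereal_sup [set Lp_norm p (fun w => dotv t (vec (X w)))
            | t in [set t | (dual_norm N t <= 1)%E]].

End probability_notions.

(* Main.v *)
(** To each coordinate [X_i] is attached a cost [phi_i], quadratic near [0] and
comparable with [- ln P(|X_i| >= |z| / 4)] far away, such that [E G(X_i) <= exp (E f(X_i))]
whenever [f] is convex and Lipschitz and [G x <= exp (f (x - z) + phi_i z)] for all [z].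
Because only the mean of [f] occurs on the right, this infimum-convolution inequality
tensorises. Suppose that the norm is at most [s] on the set [B] of the [z] with
[\sum_i phi_i (z_i) <= p]. As [phi_i] is star-shaped, [f = (p / s) N] and
[G = exp (f - p)] are then admissible, so [E exp ((p / s) (N X - E (N X))) <= exp p],
whence [|| (N X - E (N X))_+ ||_p <= s].

To bound the norm on [B] by the weak moment, note that every [z_i] is dominated by [25000]
times the mean of [X_i] under a density whose second moment is at most [exp (phi_i z_i)].
For [z] in [B] the product density thus has second moment at most [exp p], hence
norm at most [e] in the exponent conjugate to [p], and Hoelder's inequality gives
[<t, z> <= 25000 e ||<t, X>||_p]; take for [t] a norming functional of [z]. *)

Require Import Defs.
From HB Require Import structures.
From mathcomp Require Import all_boot all_order all_algebra.
From mathcomp Require Import all_classical all_reals all_analysis.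
From mathcomp Require Import measurable_realfun.
From mathcomp Require Import ring lra.

Set Implicit Arguments.
Unset Strict Implicit.
Unset Printing Implicit Defensive.

Import Order.TTheory GRing.Theory Num.Theory.
Import numFieldNormedType.Exports.

Local Open Scope classical_set_scope.
Local Open Scope ring_scope.

(** The delicate step is the one-dimensional inequality. Each coordinate is first rescaled so that
    [nlt] passes the value 1 between 1 and 10/9. As [1 + x <= expR x], it is enough to prove
    [E G <= 1 + E f] unless [f] is steep at 0. On a half-line where [f = w >= 0], [x] is moved back
    towards the origin: by at most 4 while [w] is small there, and otherwise to the point where
    [w = 1/100]. This leaves a surplus of 19 times the mean of the truncated [w ^+ 2]. The surplus
    is essential: on the opposite half-line [f] may be negative, [expR f <= 1 + f + f ^+ 2] loses
    [s ^+ 2 * E (Y ^+ 2)], with [s] the slope at 0, and the surplus on the positive side repays it.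
    If [s >= 1/100] the expansion is useless, but [f (- |Y|)] and [f |Y|] then have a sum whose mean
    can be compared directly with [ln (E G)]. The target constant fixes the scale of everything:
    25000 must not exceed [6720 * sqrt 2 * e], about 25833, so the cost coefficients are of order
    1/10000. *)

Section expectation_toolkit.
Context {d : measure_display} {T : measurableType d} {R : realType}.
Context (P : probability T R).
Implicit Types u v : T -> R.

(** * Means of real functions and probabilities of half-lines *)

Lemma measurable_ge_set u c : measurable_fun setT u -> measurable [set w | c <= u w].
Proof.
move=> mu; rewrite (_ : [set w | c <= u w] = u @^-1` `[c, +oo[).
  by rewrite -[X in measurable X]setTI; exact: mu.
by apply/seteqP; split => w /=; rewrite in_itv /= andbT.
Qed.

Lemma measurable_gt_set u c : measurable_fun setT u -> measurable [set w | c < u w].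
Proof.
move=> mu; rewrite (_ : [set w | c < u w] = u @^-1` `]c, +oo[).
  by rewrite -[X in measurable X]setTI; exact: mu.
by apply/seteqP; split => w /=; rewrite in_itv /= andbT.
Qed.

Lemma prob_fin (A : set T) : measurable A -> (fine (P A))%:E = P A.
Proof. by move=> mA; rewrite fineK// fin_num_measure. Qed.

Lemma mean_ge0 u : (forall w, 0 <= u w) -> (0 <= \int[P]_w (u w)%:E)%E.
Proof. by move=> u0; apply: integral_ge0 => w _; rewrite lee_fin. Qed.

Lemma mean_le u v : (forall w, 0 <= u w) -> measurable_fun setT u ->
  measurable_fun setT v -> (forall w, u w <= v w) ->
  (\int[P]_w (u w)%:E <= \int[P]_w (v w)%:E)%E.
Proof.
move=> u0 mu mv uv; apply: ge0_le_integral => //.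
- by move=> w _; rewrite lee_fin.
- exact/measurable_EFinP.
- exact/measurable_EFinP.
- by move=> w _; rewrite lee_fin.
Qed.

Lemma mean_add u v : (forall w, 0 <= u w) -> measurable_fun setT u ->
  (forall w, 0 <= v w) -> measurable_fun setT v ->
  (\int[P]_w (u w + v w)%:E = \int[P]_w (u w)%:E + \int[P]_w (v w)%:E)%E.
Proof.
move=> u0 mu v0 mv; under eq_integral do rewrite EFinD.
rewrite ge0_integralD//.
- by move=> w _; rewrite lee_fin.
- exact/measurable_EFinP.
- by move=> w _; rewrite lee_fin.
- exact/measurable_EFinP.
Qed.

Lemma mean_scale u c : 0 <= c -> (forall w, 0 <= u w) -> measurable_fun setT u ->
  (\int[P]_w (c * u w)%:E = c%:E * \int[P]_w (u w)%:E)%E.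
Proof.
move=> c0 u0 mu; under eq_integral do rewrite EFinM.
rewrite ge0_integralZl_EFin//.
- by move=> w _; rewrite lee_fin.
- exact/measurable_EFinP.
Qed.

Lemma mean_cst (c : R) : (\int[P]_w c%:E = c%:E)%E.
Proof.
rewrite (integral_cst P measurableT) -[RHS]mule1; congr (_ * _)%E.
exact: probability_setT.
Qed.

Lemma mean_indic (A : set T) : measurable A -> (\int[P]_w (\1_A w)%:E = P A)%E.
Proof. by move=> mA; rewrite integral_indic// setIT. Qed.

Lemma integrable_real u : measurable_fun setT u ->
  (\int[P]_w `|u w|%:E < +oo)%E -> P.-integrable setT (EFin \o u).
Proof. by move=> mu ui; apply/integrableP; split; first exact/measurable_EFinP. Qed.

Lemma integrable_dominated u v : measurable_fun setT u ->
  P.-integrable setT (EFin \o v) -> (forall w, `|u w| <= v w) ->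
  P.-integrable setT (EFin \o u).
Proof.
move=> mu iv uv; apply: (le_integrable _ _ _ iv) => //; first exact/measurable_EFinP.
by move=> w _ /=; rewrite lee_fin (le_trans (uv w))// ler_norm.
Qed.

Lemma integrable_cst c : P.-integrable setT (EFin \o cst c : T -> \bar R).
Proof. exact: finite_measure_integrable_cst. Qed.

Lemma integrable_add u v : P.-integrable setT (EFin \o u) ->
  P.-integrable setT (EFin \o v) -> P.-integrable setT (EFin \o (fun w => u w + v w)).
Proof. by move=> iu iv; have H := integrableD measurableT iu iv; exact: H. Qed.

Lemma integrable_scale c u : P.-integrable setT (EFin \o u) ->
  P.-integrable setT (EFin \o (fun w => c * u w)).
Proof. by move=> iu; have H := integrableZl measurableT c iu; exact: H. Qed.

Lemma Rintegral_EFin u : P.-integrable setT (EFin \o u) ->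
  (\int[P]_w u w)%:E = (\int[P]_w (u w)%:E)%E.
Proof. by move=> iu; rewrite fineK//; exact: integrable_fin_num. Qed.

(** An up-closed set bounded below is a half-line. If it contains its infimum it is one of the
    tested events; otherwise it is an increasing union of closed half-lines, and continuity from
    below applies. Laws with atoms are thereby covered. *)
Lemma upper_set_prob_le (Z : T -> R) (U : set R) (M : \bar R) :
  measurable_fun setT Z -> (forall x y, U x -> x <= y -> U y) -> has_lbound U ->
  (0 <= M)%E -> (forall b, U b -> (P [set w | (b <= Z w)%R] <= M)%E) ->
  (P (Z @^-1` U) <= M)%E.
Proof.
move=> mZ upU lbU M0 PM.
have [->|/set0P U0] := eqVneq U set0; first by rewrite preimage_set0 measure0.
have [Ub|Ub] := pselect (U (inf U)).
  rewrite (_ : Z @^-1` U = [set w | inf U <= Z w]) ?PM//.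
  apply/seteqP; split => w /= H; first exact: ge_inf.
  exact: upU H.
pose F (n : nat) : set T := [set w | inf U + n.+1%:R^-1 <= Z w].
have FU : Z @^-1` U = \bigcup_n F n.
  apply/seteqP; split => w /=; last first.
    move=> [n _]; rewrite /F /= => nZ; have [|x Ux xb] := inf_lt U0 (x := Z w).
      by apply: lt_le_trans nZ; rewrite ltrDl invr_gt0.
    exact: upU Ux (ltW xb).
  move=> UZ; have e0 : 0 < Z w - inf U.
    rewrite subr_gt0 lt_neqAle ge_inf// andbT.
    by apply: contra_notN Ub => /eqP ->.
  exists (Num.bound (Z w - inf U)^-1) => //; rewrite /F /=.
  rewrite -lerBrDl -[leRHS]invrK lef_pV2 ?posrE ?invr_gt0//.
  have i0 : 0 < (Z w - inf U)^-1 by rewrite invr_gt0.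
  by apply: le_trans (ltW (archi_boundP (ltW i0))) _; rewrite ler_nat.
have mF n : measurable (F n) by exact: measurable_ge_set.
have ndF : {homo F : n m / (n <= m)%N >-> (n <= m)%O}.
  move=> n m nm; apply/subsetPset => w; apply: le_trans; rewrite lerD2l.
  by rewrite lef_pV2 ?posrE// ler_nat.
have cvF := nondecreasing_cvg_mu (mu := P) mF (bigcup_measurable (fun n _ => mF n)) ndF.
rewrite FU -(cvg_lim _ cvF)//; apply: lime_le; first by apply/cvg_ex; eexists; exact: cvF.
apply: nearW => n /=; apply: PM.
have [|x Ux xb] := inf_lt U0 (x := inf U + n.+1%:R^-1).
  by rewrite ltrDl invr_gt0.
exact: upU Ux (ltW xb).
Qed.

(* Only powers of [6/5] are tested: a telescoping sum replaces the layer-cake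
   integral, at the price of the constant [1 + 6/5] instead of [2]. *)
Lemma mean_le_of_tail u (g : R) : measurable_fun setT u -> 0 <= g ->
  (forall w, u w = 0 \/ 1 <= u w) ->
  (forall k : nat, (P [set w | ((6 / 5) ^+ k <= u w)%R] <= (g * (6 / 5) ^- (2 * k))%:E)%E) ->
  (\int[P]_w (u w)%:E <= (11 / 5 * g)%:E)%E.
Proof.
move=> mu g0 u01 tailu; set r : R := 6 / 5; have r1 : 1 <= r by rewrite /r; lra.
have r0 : 0 < r by rewrite /r; lra.
have u0 w : 0 <= u w by case: (u01 w) => [->|]//; exact: le_trans.
pose v n w := Num.min (u w) (r ^+ n).
have mv n : measurable_fun setT (v n) by exact: measurable_minr.
have v0 n w : 0 <= v n w by rewrite le_min u0 exprn_ge0// ltW.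
have mA n : measurable [set w | r ^+ n <= u w] by exact: measurable_ge_set.
have bound n : (\int[P]_w (v n w)%:E <= (g * (1 + r - r * r ^- n))%:E)%E.
  elim: n => [|n IH].
    have -> : g * (1 + r - r * r ^- 0) = g * r ^- (2 * 0) by rewrite muln0 expr0 invr1; ring.
    apply: le_trans (tailu 0%N); rewrite -(mean_indic (mA 0%N)); apply: mean_le => //.
    move=> w; rewrite /v expr0 indicE.
    have [uw|uw] := u01 w; first by rewrite uw min_l//; case: (_ \in _).
    by rewrite mem_set//= ge_min lexx orbT.
  have -> : (g * (1 + r - r * r ^- n.+1))%:E =
     ((g * (1 + r - r * r ^- n))%:E + (r ^+ n.+1 - r ^+ n)%:E * (g * r ^- (2 * n))%:E)%E.
    rewrite -EFinM -EFinD; congr EFin.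
    have e : r ^- n = r ^+ n * r ^- (2 * n).
      by rewrite mul2n -addnn exprD invfM mulrA divff ?mul1r// expf_neq0// gt_eqF.
    rewrite exprS invfM mulrA divff ?gt_eqF// mul1r.
    rewrite [X in _ = _ + X](_ : _ = g * ((r - 1) * r ^- n)); first by ring.
    by rewrite e; ring.
  have rn : 0 <= r ^+ n.+1 - r ^+ n by rewrite subr_ge0 exprS ler_peMl// exprn_ge0// ltW.
  apply: (@le_trans _ _ (\int[P]_w (v n w)%:E +
     (r ^+ n.+1 - r ^+ n)%:E * \int[P]_w (\1_[set w | r ^+ n <= u w] w)%:E)%E); last first.
    apply: leeD => //; apply: lee_pmul => //; first by rewrite mean_indic.
    by rewrite mean_indic.
  rewrite -mean_scale// -?mean_add//.
  - apply: mean_le => //.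
      apply: measurable_funD => //; apply: measurable_funM => //.
    move=> w; rewrite /v indicE; have [rw|rw] := leP (r ^+ n) (u w).
      rewrite mem_set//= mulr1 ge_min addrC subrK lexx orbT//.
    rewrite memNset ?mulr0 ?addr0 /= ?ge_min ?lexx//.
    by apply/negP; rewrite -ltNge.
  - by move=> w; rewrite mulr_ge0.
  - by apply: measurable_funM.
have cv : (fun n => \int[P]_w (v n w)%:E)%E @ \oo --> (\int[P]_w (u w)%:E)%E.
  rewrite [X in _ --> X](_ : _ = \int[P]_w (limn (fun n => (v n w)%:E)))%E.
    apply: (@cvg_monotone_convergence _ _ _ P setT measurableT (fun n w => (v n w)%:E)).
    - by move=> n; exact/measurable_EFinP.
    - by move=> n w _; rewrite lee_fin.
    - move=> w _ n m nm; rewrite lee_fin /v le_min !ge_min lexx /=.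
      by rewrite ler_weXn2l ?orbT.
  apply: eq_integral => w _; apply/esym/cvg_lim => //.
  have [k uk] : exists k, u w <= r ^+ k.
    (* Bernoulli: [(6/5) ^+ m >= 1 + m/5]. *)
    exists (Num.bound (5 * u w)); apply: (@le_trans _ _ (1 + (Num.bound (5 * u w))%:R * (1/5))).
      by have := archi_boundP (_ : 0 <= 5 * u w); rewrite mulr_ge0// => /(_ erefl); lra.
    elim: (Num.bound _) => [|m IH]; first by rewrite expr0 mul0r addr0.
    rewrite exprS /r -natr1; have : 1 <= (6/5 : R) ^+ m by rewrite exprn_ege1.
    by rewrite /r in IH; lra.
  apply/fine_cvgP; split; first by near=> n.
  apply: cvg_near_cst; near=> n => /=; rewrite /v min_l// (le_trans uk)//.
  by rewrite ler_weXn2l//; near: n; exact: nbhs_infty_ge.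
rewrite -(cvg_lim _ cv)//; apply: lime_le; first by apply/cvg_ex; eexists; exact: cv.
apply: nearW => n; apply: le_trans (bound n) _; rewrite lee_fin mulrC ler_wpM2r//.
have : 0 <= r * r ^- n by rewrite mulr_ge0 ?invr_ge0 ?exprn_ge0// ltW.
by rewrite /r; lra.
Unshelve. all: by end_near.
Qed.
End expectation_toolkit.

(** * Numerical bounds for e *)

Section exp_one.
Context {R : realType}.

(** The digits serve the bound on [D], which holds with a relative margin of about 1.4e-5 only. *)
Lemma expR1_bounds : (2718 + 281 / 1000) / 1000 <= expR 1 :> R /\
  expR 1 <= (2718 + 283 / 1000) / 1000 :> R.
Proof.
have [f fE [f0 fS]] : exists2 f : nat -> R, forall k, f k = k`!%:R^-1 &
    f 0%N = 1 /\ forall k, f k.+1 = f k / k.+1%:R.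
  exists (fun k => k`!%:R^-1) => //; split; first by rewrite fact0 invr1.
  by move=> k; rewrite factS natrM invfM mulrC.
pose S n : R := series (exp_coeff 1) n.
have SE n : S n.+1 = S n + f n.
  by rewrite /S seriesSr /exp_coeff /= expr1n mul1r fE.
have fge0 n : 0 <= f n by rewrite fE invr_ge0.
have cS : S @ \oo --> expR 1.
  have := is_cvg_series_exp_coeff (1 : R) _; rewrite /S; exact.
have ndS : nondecreasing_seq S by apply/nondecreasing_seqP => n; rewrite SE lerDl.
(* Each term past the first two is at most half of its predecessor, so partial sum plus twice the
   next term is nonincreasing and bounds e from above. *)
have upS n m : S (n + m.+1)%N + f (n + m.+1)%N * 2 <= S n.+1 + f n.+1 * 2.
  elim: m => [|m IH]; first by rewrite addn1.
  apply: le_trans IH; rewrite [in leLHS]addnS SE -addrA lerD2l fS.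
  have : (n + m.+1).+1%:R^-1 <= 2^-1 :> R.
    by rewrite lef_pV2 ?posrE// ler_nat addnS.
  move: (fge0 (n + m.+1)%N); set a := f _; set b := (_.+1)%:R^-1 => a0 b2.
  have := ler_wpM2l a0 b2; lra.
have S0 : S 0%N = 0 by rewrite /S /series /= big_geq.
have f10 : f 10%N = 1 / 64 / 567 / 100 by rewrite !fS f0; lra.
have S10 : S 10%N = (9864 * 10 + 1) / 64 / 567.
  by rewrite !SE !fS f0 S0; lra.
clear fE fS SE f0.
split.
  apply: (@le_trans _ _ (S 10%N)); first by rewrite S10; lra.
  rewrite -(cvg_lim _ cS)//; apply: nondecreasing_cvgn_le => //.
have -> : expR 1 = limn S by apply/esym/cvg_lim.
apply: limr_le; first by apply/cvg_ex; eexists; exact: cS.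
near=> n; have [k ->] : exists k, n = (9 + k.+1)%N.
  by exists (n - 10)%N; rewrite addnS -addSn subnKC//; near: n; exact: nbhs_infty_ge.
have := upS 9%N k; rewrite S10 f10; have := fge0 (9 + k.+1)%N.
by set a := S _; set b := f _; lra.
Unshelve. all: by end_near.
Qed.

Lemma expR1_rough : 27 / 10 <= expR 1 :> R /\ expR 1 <= 28 / 10 :> R.
Proof. by have [e1 e2] := expR1_bounds; split; lra. Qed.
End exp_one.

(** * The tail of [|Y|] and its negative logarithm *)

Section tail.
Context {d : measure_display} {T : measurableType d} {R : realType}.
Context (P : probability T R) (Y : T -> R).
Context (mY : measurable_fun setT Y).

Definition tail (t : R) : R := fine (P [set w | (t <= `|Y w|)%R]).

Definition nlt (t : R) : R := - ln (tail t).

Lemma measurable_tail_set t : measurable [set w | t <= `|Y w|].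
Proof. by apply: measurable_ge_set; exact: measurableT_comp. Qed.

Lemma tailE t : (tail t)%:E = P [set w | (t <= `|Y w|)%R].
Proof. by rewrite prob_fin//; exact: measurable_tail_set. Qed.

Lemma tail_ge0 t : 0 <= tail t.
Proof. by rewrite fine_ge0. Qed.

Lemma tail_le1 t : tail t <= 1.
Proof. by rewrite -lee_fin tailE probability_le1//; exact: measurable_tail_set. Qed.

Lemma tail_le s t : s <= t -> tail t <= tail s.
Proof.
move=> st; rewrite -lee_fin !tailE le_measure ?inE//; try exact: measurable_tail_set.
by move=> w /=; exact: le_trans.
Qed.

Lemma tail_eq1 t : t <= 0 -> tail t = 1.
Proof.
move=> t0; apply: EFin_inj; rewrite tailE -(@probability_setT _ _ _ P).
by congr (P _); apply/seteqP; split => w //= _; exact: le_trans (normr_ge0 _).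
Qed.

Lemma measurable_tail (f : T -> R) : measurable_fun setT f ->
  measurable_fun setT (fun w => tail (f w)).
Proof.
move=> mf; apply: (measurableT_comp (f := tail)) => //.
by apply: nonincreasing_measurable => // s t *; exact: tail_le.
Qed.

Lemma measurable_nlt (f : T -> R) : measurable_fun setT f ->
  measurable_fun setT (fun w => nlt (f w)).
Proof.
move=> mf; apply: measurable_funN; apply: measurableT_comp; first exact: measurable_ln.
exact: measurable_tail.
Qed.

Lemma nlt_ge0 t : 0 <= nlt t.
Proof. by rewrite oppr_ge0 ln_le0// tail_le1. Qed.

Lemma nlt0 : nlt 0 = 0.
Proof. by rewrite /nlt tail_eq1// ln1 oppr0. Qed.

Lemma expR_nlt t : 0 < tail t -> expR (- nlt t) = tail t.
Proof. by move=> t0; rewrite opprK lnK. Qed.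

Lemma nlt_le s t : 0 < tail t -> s <= t -> nlt s <= nlt t.
Proof.
move=> t0 st; rewrite lerN2 ler_ln ?posrE ?tail_le//.
exact: lt_le_trans t0 (tail_le st).
Qed.

Lemma tail_gt0_le s t : s <= t -> 0 < tail t -> 0 < tail s.
Proof. by move=> st t0; exact: lt_le_trans (tail_le st). Qed.

(** The variable [tail |Y|] is stochastically at least uniform: the event is an up-closed condition
    on [|Y|], and every closed half-line inside it has probability at most [r]. *)
Lemma tail_upper_prob (c r : R) : 0 <= r ->
  (P [set w | (c <= `|Y w| /\ tail `|Y w| <= r)%R] <= r%:E)%E.
Proof.
move=> r0; pose U := [set x : R | Num.max c 0 <= x /\ tail x <= r].
rewrite (_ : [set w | _] = (fun w => `|Y w|) @^-1` U); last first.
  by apply/seteqP; split => w /= [H ?]; split => //; move: H; rewrite ge_max normr_ge0 ?andbT.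
apply: upper_set_prob_le.
- exact: measurableT_comp.
- by move=> x y [cx tx] xy; split; [exact: le_trans xy|exact: le_trans (tail_le xy) tx].
- by exists 0 => x [+ _]; rewrite ge_max => /andP[].
- by rewrite lee_fin.
- by move=> b [_ tb]; rewrite -tailE lee_fin.
Qed.

(** The case [r = 0] of the preceding bound. It lets later comparisons ignore the points where [nlt]
    has a junk value. *)
Lemma tail_gt0_ae : P [set w | (tail `|Y w| <= 0)%R] = 0%E.
Proof.
apply/eqP; rewrite eq_le measure_ge0 andbT.
apply: le_trans (tail_upper_prob 0 (lexx 0)).
have mt : measurable_fun setT (fun w => tail `|Y w|).
  by apply: measurable_tail; exact: measurableT_comp.
have mtS : measurable [set w | tail `|Y w| <= 0].
  rewrite (_ : [set w | _] = [set w | 0 <= - tail `|Y w|]); last first.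
    by apply/seteqP; split => w /=; rewrite oppr_ge0.
  by apply: measurable_ge_set; exact: measurable_funN.
rewrite le_measure ?inE//.
  rewrite (_ : [set w | _] = [set w | tail `|Y w| <= 0])//.
  by apply/seteqP; split => w /= => [[]|].
Qed.

(* [nlt] has the junk value [0] where [tail] vanishes, hence the second test. *)
Definition half_exp (c : R) (w : T) : R :=
  if (c <= `|Y w|) && (0 < tail `|Y w|) then expR ((nlt `|Y w| - nlt c) / 2) else 0.

Lemma half_exp_ge0 c w : 0 <= half_exp c w.
Proof. by rewrite /half_exp; case: ifP => _//; exact: expR_ge0. Qed.

Lemma measurable_half_exp c : measurable_fun setT (half_exp c).
Proof.
have mZ : measurable_fun setT (fun w => `|Y w|) by exact: measurableT_comp.
apply: measurable_fun_ifT => //.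
  apply: measurable_and; first exact: measurable_fun_ler.
  by apply: measurable_fun_ltr => //; exact: measurable_tail.
apply: measurableT_comp => //; apply: measurable_funM => //.
by apply: measurable_funB => //; exact: measurable_nlt.
Qed.

(** On [c <= |Y|], [half_exp] is the power -1/2 of [tail |Y| / tail c], a variable stochastically at
    least uniform. The power -1/2 of a uniform variable has mean 2; testing only powers of 6/5 turns
    2 into 11/5. *)
Lemma mean_half_exp c : (\int[P]_w (half_exp c w)%:E <= (11 / 5 * tail c)%:E)%E.
Proof.
have mh := measurable_half_exp c.
apply: mean_le_of_tail => //; first exact: tail_ge0.
  move=> w; rewrite /half_exp; case: ifP => [/andP[cZ tZ]|]; [right|by left].
  by rewrite -expR0 ler_expR divr_ge0// subr_ge0 nlt_le.
move=> k; set r : R := (6 / 5) ^+ k; have r0 : 0 < r by rewrite exprn_gt0//; lra.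
have -> : (6 / 5) ^- (2 * k) = r^-1 ^+ 2 :> R by rewrite mulnC exprM -exprVn.
apply: le_trans (tail_upper_prob c (r := tail c * r^-1 ^+ 2) _); last first.
  by rewrite mulr_ge0 ?tail_ge0// sqr_ge0.
rewrite le_measure ?inE//; first exact: measurable_ge_set.
  rewrite (_ : [set w | _] = [set w | c <= `|Y w|] `&`
      [set w | - (tail c * r^-1 ^+ 2) <= - tail `|Y w|]); last first.
    by apply/seteqP; split => w /=; rewrite lerN2.
  apply: measurableI; first exact: measurable_tail_set.
  apply: measurable_ge_set; apply: measurable_funN; apply: measurable_tail.
  exact: measurableT_comp.
move=> w /=; rewrite /half_exp; case: ifP => [/andP[cZ tZ]|_]; last by rewrite leNgt r0.
have tc := tail_gt0_le cZ tZ.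
move=> rE; split => //; rewrite exprVn ler_pdivlMr ?exprn_gt0//.
have : r ^+ 2 <= expR (nlt `|Y w| - nlt c).
  rewrite [X in expR X](_ : _ = (nlt `|Y w| - nlt c) / 2 + (nlt `|Y w| - nlt c) / 2); last by field.
  by rewrite expRD expr2 ler_pM// ltW.
rewrite -(ler_pM2l tZ) => /le_trans; apply.
rewrite -{1}(expR_nlt tZ) -expRD -(expR_nlt tc) ler_expR; lra.
Qed.
End tail.

(** * Consequences of log-concavity of the tail *)

Section log_concave_tail.
Context {d : measure_display} {T : measurableType d} {R : realType}.
Context (P : probability T R) (Y : T -> R) (mY : measurable_fun setT Y).
Context (lcY : log_concave_tails P Y).

Local Notation tail := (tail P Y).
Local Notation nlt := (nlt P Y).

Lemma mean_le_tail_gt0 (u v : T -> R) : (forall w, 0 <= u w) -> (forall w, 0 <= v w) ->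
  measurable_fun setT u -> measurable_fun setT v ->
  (forall w, 0 < tail `|Y w| -> u w <= v w) ->
  (\int[P]_w (u w)%:E <= \int[P]_w (v w)%:E)%E.
Proof.
move=> u0 v0 mu mv uv; apply: ae_ge0_le_integral => //.
- by move=> w _; rewrite lee_fin.
- exact/measurable_EFinP.
- by move=> w _; rewrite lee_fin.
- exact/measurable_EFinP.
exists [set w | tail `|Y w| <= 0]; split.
- rewrite (_ : [set w | _] = [set w | 0 <= - tail `|Y w|]); last first.
    by apply/seteqP; split => w /=; rewrite oppr_ge0.
  apply: measurable_ge_set; apply: measurable_funN; apply: measurable_tail => //.
  exact: measurableT_comp.
- exact: tail_gt0_ae.
- move=> w /= H; rewrite leNgt; apply/negP => tZ; apply: H => _.
  by rewrite lee_fin uv.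
Qed.

Lemma tail_log_concave (s t a : R) : 0 <= s -> 0 <= t -> 0 <= a <= 1 ->
  0 < tail s -> 0 < tail t ->
  0 < tail (a * s + (1 - a) * t) /\
  nlt (a * s + (1 - a) * t) <= a * nlt s + (1 - a) * nlt t.
Proof.
move=> s0 t0 a01 ts tt; have := lcY s0 t0 a01; rewrite /neg_log_tail -!tailE//.
rewrite (lne_EFin ts) (lne_EFin tt); set x := a * s + _.
have [tx|tx] := leP (tail x) 0.
  by rewrite le0_lneNy ?lee_fin//= leye_eq.
by rewrite (lne_EFin tx) -!EFinN -!EFinM -EFinD lee_fin.
Qed.

Lemma nlt_star (r t : R) : 0 <= r <= 1 -> 0 <= t -> 0 < tail t -> nlt (r * t) <= r * nlt t.
Proof.
move=> r01 t0 tt; have := tail_log_concave t0 (lexx 0) r01 tt.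
by rewrite tail_eq1// => /(_ ltr01) [_]; rewrite nlt0// !mulr0 !addr0.
Qed.

(** Increments of a convex function grow: [s + x] and [c] are convex combinations of [s] and [c + x]
    with complementary weights, and the two convexity inequalities add up. *)
Lemma nlt_increment (s c x : R) : 0 <= s -> s <= c -> 0 <= x -> 0 < tail (c + x) ->
  nlt (s + x) - nlt s <= nlt (c + x) - nlt c.
Proof.
move=> s0 sc x0 tcx.
have [x00|xn0] := eqVneq x 0; first by rewrite x00 !addr0 !subrr.
have xp : 0 < x by rewrite lt_neqAle eq_sym xn0.
have D0 : 0 < c + x - s by lra.
have ts : 0 < tail s by apply: tail_gt0_le tcx => //; lra.
have cx0 : 0 <= c + x by lra.
pose b := x / (c + x - s).
have b01 : 0 <= b <= 1.
  apply/andP; split; first by apply: divr_ge0; lra.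
  by rewrite /b ler_pdivrMr ?mul1r//; lra.
have b01' : 0 <= 1 - b <= 1 by move/andP: b01 => [] *; apply/andP; lra.
have [_] := tail_log_concave cx0 s0 b01 tcx ts.
have [_] := tail_log_concave cx0 s0 b01' tcx ts.
have -> : b * (c + x) + (1 - b) * s = s + x by rewrite /b; field; rewrite gt_eqF.
have -> : (1 - b) * (c + x) + (1 - (1 - b)) * s = c by rewrite /b; field; rewrite gt_eqF.
lra.
Qed.

(** * Variables on unit scale: exponential decay and moments *)

Section normalized.
Context (tail1 : expR (- 1) <= tail 1) (tailq : tail (10 / 9) < expR (- 1)).

Lemma nlt1_le1 : nlt 1 <= 1.
Proof.
rewrite /nlt lerNl -(@expRK R (- 1)) ler_ln ?posrE ?expR_gt0//.
exact: lt_le_trans (expR_gt0 _) tail1.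
Qed.

(** Since [nlt] is star-shaped, its value at [t] is at least [t / (10/9)] times its value at 10/9,
    which already exceeds 1. *)
Lemma le_nlt (t : R) : 10 / 9 <= t -> 0 < tail t -> t <= 10 / 9 * nlt t.
Proof.
move=> qt tt; have t0 : 0 < t by apply: lt_le_trans qt; lra.
have r01 : 0 <= 10 / 9 / t <= 1.
  by apply/andP; split; [apply: divr_ge0; lra|rewrite ler_pdivrMr ?mul1r].
have := nlt_star r01 (ltW t0) tt; rewrite divfK ?gt_eqF// => H.
have tq : 0 < tail (10 / 9) := tail_gt0_le mY qt tt.
have : 1 < nlt (10 / 9).
  by rewrite /nlt ltrNr -(@expRK R (- 1)) ltr_ln ?posrE ?expR_gt0.
move=> /lt_le_trans /(_ H); rewrite mulrAC ltr_pdivlMr// mul1r; exact: ltW.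
Qed.

Lemma le_nlt1 (t : R) : 0 < tail t -> t <= 10 / 9 * (1 + nlt t).
Proof.
move=> tt; have N0 := nlt_ge0 P mY t; have [qt|tq] := leP (10 / 9) t; last by lra.
by have := le_nlt qt tt; lra.
Qed.

Lemma tail4_le : tail 4 <= 32^-1.
Proof.
have [|t4] := leP (tail 4) 0; first by move/le_trans; apply; rewrite invr_ge0.
have N4 : 36 / 10 <= nlt 4.
  by have := le_nlt _ t4; (have -> : 10 / 9 <= (4 : R) by lra) => /(_ erefl); lra.
rewrite -(expR_nlt t4) -[leRHS]invrK expRN lef_pV2 ?posrE ?expR_gt0 ?invr_gt0// invrK.
(* [nlt 4 >= 3.6], and [expR 3.5 >= 2.7 ^ 3 * 1.64 > 32]. *)
have [e1 _] := @expR1_rough R.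
have : expR (1 + 1 + 1 + 2^-1) <= expR (nlt 4) by rewrite ler_expR; lra.
apply: le_trans; rewrite !expRD.
have x1 : 164 / 100 <= expR 2^-1 :> R.
  rewrite leNgt; apply/negP => H.
  have : expR 2^-1 * expR 2^-1 = expR 1 :> R by rewrite -expRD; congr expR; field.
  have h0 := expR_gt0 (2^-1 : R).
  have := ltr_pM (ltW h0) (ltW h0) H H; lra.
have y2 : 27 / 10 * (27 / 10) * (27 / 10) <= expR 1 * expR 1 * expR 1 :> R.
  by rewrite !ler_pM// ?mulr_ge0//; lra.
by apply: le_trans (ler_pM _ _ y2 x1); [lra| |]; rewrite ?mulr_ge0//; lra.
Qed.

(** From [x <= expR (x - 1)] at [x = N / 4] comes [N ^+ 2 <= 16 * e ^- 2 * expR (N / 2)]. The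
    exponent is halved so that the right-hand side is a multiple of [half_exp] at 0. *)
Lemma sq_le_half_exp (t : R) : 0 <= t -> 0 < tail t ->
  t ^+ 2 <= 100 / 81 * (16 * expR 1 ^- 2) * expR (nlt t / 2).
Proof.
move=> t0 tt; have [e1 e2] := @expR1_rough R; set e := expR 1 in e1 e2 *.
have e0 : 0 < e by apply: lt_le_trans e1; lra.
have N0 := nlt_ge0 P mY t; set N := nlt t in N0 *.
have : t <= 10 / 9 * Num.max 1 N.
  have [qt|tq] := leP (10 / 9) t.
    have := le_nlt qt tt; rewrite -/N => /le_trans; apply.
    by apply: ler_wpM2l; [lra|rewrite le_max lexx orbT].
  have : 1 <= Num.max 1 N by rewrite le_max lexx.
  by lra.
move=> tM; have M1 : 1 <= Num.max 1 N by rewrite le_max lexx.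
have : t ^+ 2 <= 100 / 81 * Num.max 1 N ^+ 2.
  have -> : 100 / 81 = (10 / 9) ^+ 2 :> R by lra.
  by rewrite -exprMn ler_pXn2r// nnegrE; lra.
move=> /le_trans; apply; rewrite -[leRHS]mulrA; apply: ler_wpM2l; first by lra.
have E : expR (N / 2) = (e * expR (N / 4 - 1)) ^+ 2.
  by rewrite /e -expRD expr2 -expRD; congr expR; field.
rewrite E exprMn mulrA divfK; last by rewrite expf_neq0// gt_eqF.
have : N / 4 <= expR (N / 4 - 1) by have := expR_ge1Dx (N / 4 - 1); lra.
have : 1 / 4 <= expR (N / 4 - 1).
  have : expR (- 1) <= expR (N / 4 - 1) by rewrite ler_expR; lra.
  by apply: le_trans; rewrite expRN -/e -[leRHS]mul1r ler_pdivlMr//; lra.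
set x := expR _ => x1 x2; have : Num.max 1 N <= 4 * x by rewrite ge_max; apply/andP; lra.
move=> Mx; have : Num.max 1 N ^+ 2 <= (4 * x) ^+ 2 by rewrite ler_pXn2r// nnegrE; lra.
by rewrite exprMn; lra.
Qed.

(** The value 6 matters: in [infconv_small_slope] it has to stay below [19 * (10 / 28)], about
    6.79. *)
Lemma mean_sq_le : (\int[P]_w (Y w ^+ 2)%:E <= (6)%:E)%E.
Proof.
set K := 100 / 81 * (16 * expR 1 ^- 2) : R.
have [e1 e2] := @expR1_rough R.
have e0 : 0 < expR 1 ^+ 2 :> R by rewrite exprn_gt0// expR_gt0.
have K0 : 0 <= K by rewrite mulr_ge0 ?mulr_ge0 ?invr_ge0 ?(ltW e0)//; lra.
have := mean_half_exp P mY 0; rewrite tail_eq1// mulr1 => H.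
apply: (@le_trans _ _ (\int[P]_w (K * half_exp P Y 0 w)%:E)%E).
  apply: mean_le_tail_gt0.
  - by move=> w; exact: sqr_ge0.
  - by move=> w; rewrite mulr_ge0// half_exp_ge0.
  - exact: measurable_funX.
  - by apply: measurable_funM => //; exact: measurable_half_exp.
  - move=> w tw; rewrite /half_exp normr_ge0 tw /= nlt0// subr0 -real_normK ?num_real//.
    exact: sq_le_half_exp.
rewrite mean_scale//; [|by move=> w; exact: half_exp_ge0|exact: measurable_half_exp].
apply: le_trans (lee_wpmul2l _ H) _; first by rewrite lee_fin.
rewrite -EFinM lee_fin /K.
have : 27 / 10 * (27 / 10) <= expR 1 ^+ 2 :> R by rewrite expr2 ler_pM//; lra.
move: e0; set x := expR 1 ^+ 2 => x0 x1.
have i0 : 0 <= x^-1 by rewrite invr_ge0 ltW.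
have := ler_wpM2r i0 x1; rewrite divff ?gt_eqF//; lra.
Qed.

Lemma mean_abs_le : (\int[P]_w `|Y w|%:E <= 4%:E)%E.
Proof.
have m2 : measurable_fun setT (fun w => Y w ^+ 2) by exact: measurable_funX.
apply: (@le_trans _ _ (\int[P]_w (6^-1 * Y w ^+ 2 + 2)%:E)%E).
  apply: mean_le => //; first exact: measurableT_comp.
    by apply: measurable_funD => //; apply: measurable_funM.
  by move=> w; rewrite -[Y w ^+ 2]real_normK ?num_real//; have := sqr_ge0 (`|Y w| - 3); rewrite sqrrB; lra.
rewrite mean_add//; last 2 first.
- by move=> w; rewrite mulr_ge0 ?sqr_ge0.
- by apply: measurable_funM.
rewrite mean_scale//; last by move=> w; exact: sqr_ge0.
rewrite mean_cst; apply: le_trans (leeD (lee_wpmul2l _ mean_sq_le) (lexx _)) _.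
  by rewrite lee_fin.
by rewrite -EFinM -EFinD lee_fin; lra.
Qed.

Lemma mean_abs_ge : ((expR (- 1))%:E <= \int[P]_w `|Y w|%:E)%E.
Proof.
apply: (@le_trans _ _ (tail 1)%:E); first by rewrite lee_fin.
rewrite tailE// -mean_indic; last exact: measurable_tail_set.
apply: mean_le => //; first by apply: measurable_indic; exact: measurable_tail_set.
  exact: measurableT_comp.
move=> w; rewrite indicE; have [H|H] := leP 1 `|Y w|; first by rewrite mem_set.
by rewrite memNset ?normr_ge0//= => H'; move: H; rewrite ltNge H'.
Qed.
End normalized.
End log_concave_tail.

(** * Scalar inequalities for the exponential *)

Section elementary.
Context {R : realType}.

Lemma expR_le_quadratic (y : R) : 0 <= y <= 1 / 20 -> expR y <= 1 + y + 11 / 10 * y ^+ 2.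
Proof.
move=> /andP[y0 y1]; have H := expR_ge1Dx (- y).
have : expR y * (1 - y) <= 1.
  by apply: le_trans (ler_wpM2l (ltW (expR_gt0 y)) H) _; rewrite expRN divff ?gt_eqF ?expR_gt0.
have : 1 <= (1 + y + 11 / 10 * y ^+ 2) * (1 - y) by rewrite expr2; nra.
have d0 : 0 < 1 - y by lra.
by move=> H1 /le_trans /(_ H1); rewrite ler_pM2r.
Qed.

(** Convexity of the exponential between 0 and [D / 2], obtained from tangent lines at [a * D]. It
    trades an exponential with a small rate for a small multiple of [half_exp], whose mean is
    known. *)
Lemma expR_le_chord (a D : R) : 0 <= a <= 1 / 2 ->
  expR (a * D) <= (1 - 2 * a) + 2 * a * expR (D / 2).
Proof.
move=> /andP[a0 a1]; have E0 := expR_gt0 (a * D).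
have H1 := expR_ge1Dx (- (a * D)); have H2 := expR_ge1Dx ((1 / 2 - a) * D).
have e2 : expR (D / 2) = expR (a * D) * expR ((1 / 2 - a) * D).
  by rewrite -expRD; congr expR; field.
have e1 : 1 = expR (a * D) * expR (- (a * D)) by rewrite -expRD subrr expR0.
rewrite e2.
set E := expR (a * D) in E0 e1 *; set x := expR (- _) in H1 e1 *; set y := expR (_ * D) in H2 *.
have h1 : (1 - 2 * a) * (1 - a * D) <= (1 - 2 * a) * x by apply: ler_wpM2l => //; lra.
have h2 : (2 * a) * (1 + (1 / 2 - a) * D) <= (2 * a) * y by apply: ler_wpM2l => //; lra.
have : E * 1 <= E * ((1 - 2 * a) * x + 2 * a * y).
  apply: ler_wpM2l; first exact: ltW.
  by have := lerD h1 h2; have -> : (1 - 2 * a) * (1 - a * D) + 2 * a * (1 + (1 / 2 - a) * D) = 1 by field.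
have -> : E * ((1 - 2 * a) * x + 2 * a * y) = (1 - 2 * a) * (E * x) + 2 * a * (E * y) by ring.
by rewrite -e1 !mulr1.
Qed.

(* [a], [b] are the values of a convex function at a point and at a point at
   distance at most 4 closer to the origin; the three cases differ in how far
   one travels between them. *)
Lemma near_pointwise (g a b : R) : 0 <= b -> b <= a -> b <= 1 / 100 ->
  (forall th, 0 <= th <= 1 ->
     g <= expR ((1 - th) * a + th * b + 16 / 100 / 100 * th ^+ 2)) ->
  g + 23 * Num.min a (1 / 100) ^+ 2 <= 1 + a + 128 * b ^+ 2.
Proof.
move=> b0 ba b1 H; set V := Num.min a (1 / 100).
have V0 : 0 <= V by rewrite le_min; apply/andP; split; lra.
have Va : V <= a by rewrite ge_min lexx.
have V1 : V <= 1 / 100 by rewrite ge_min lexx orbT.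
have Vc : (a <= 1 / 100 /\ V = a) \/ (1 / 100 <= a /\ V = 1 / 100).
  by rewrite /V; case: (leP a (1 / 100)) => ?; [left|right; split => //; exact: ltW].
clearbody V.
have b2 : 0 <= b ^+ 2 by exact: sqr_ge0.
have [a2|a2] := leP (2 / 100) a.
  have := H 1; rewrite ler01 lexx => /(_ erefl) gH.
  have : 0 <= b + 16 / 100 / 100 <= 1 / 20 by apply/andP; split; lra.
  move/expR_le_quadratic; rewrite (_ : _ + _ / _ = (1 - 1) * a + 1 * b + 16 / 100 / 100 * 1 ^+ 2); last by ring.
  move/(le_trans gH); rewrite subrr mul0r add0r mul1r expr1n mulr1 => gq.
  have : (b + 16 / 100 / 100) ^+ 2 <= (116 / 100 / 100) ^+ 2.
    by rewrite ler_pXn2r// ?nnegrE; lra.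
  have : V ^+ 2 <= (1 / 100) ^+ 2 by rewrite ler_pXn2r// ?nnegrE; lra.
  rewrite (_ : (116 / 100 / 100) ^+ 2 = 13456 / 10000 / 10000); last by field.
  by rewrite (_ : (1 / 100) ^+ 2 = 1 / 10000); [lra|field].
have a0 : 0 <= a by exact: le_trans ba.
(* Without moving: [a <= 2 V] gives [11/10 * a ^+ 2 + 23 * V ^+ 2 <= 27.4 * V ^+ 2 <= 109.6 * b ^+
   2], within the allowed 128. *)
have [Vb|bV] := leP V (2 * b).
  have := H 0; rewrite lexx ler01 => /(_ erefl) gH.
  have : 0 <= a <= 1 / 20 by apply/andP; split; lra.
  move/expR_le_quadratic; rewrite -[X in expR X](_ : (1 - 0) * a + 0 * b + 16 / 100 / 100 * 0 ^+ 2 = a); last by ring.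
  move/(le_trans gH) => gq.
  have : V ^+ 2 <= (2 * b) ^+ 2 by rewrite ler_pXn2r// ?nnegrE; lra.
  rewrite exprMn => Vb2.
  have : a ^+ 2 <= 4 * V ^+ 2.
    rewrite (_ : 4 * V ^+ 2 = (2 * V) ^+ 2); last by rewrite exprMn; ring.
    by rewrite ler_pXn2r// ?nnegrE; lra.
  by lra.
(* Now [2 b < V <= a], so the drop [D] along the move is at least half of [a]. *)
pose D := a - b; have D2 : a / 2 <= D by rewrite /D; lra.
have VV : V ^+ 2 <= a ^+ 2 by rewrite ler_pXn2r// ?nnegrE; lra.
have DD : a ^+ 2 <= 4 * D ^+ 2.
  rewrite (_ : 4 * D ^+ 2 = (2 * D) ^+ 2); last by rewrite exprMn; ring.
  by rewrite ler_pXn2r// ?nnegrE; lra.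
have [Du|Du] := leP D (32 / 100 / 100).
  (* The minimiser of the exponent [a - th * D + 16/10000 * th ^+ 2]; it is at most 1 exactly in the
     present case. The gain [D ^+ 2 / (64/10000)] is at least [39 * a ^+ 2]. *)
  pose th := D * (100 * 100 / 32).
  have th01 : 0 <= th <= 1 by rewrite /th; apply/andP; split; lra.
  have := H _ th01.
  rewrite (_ : (1 - th) * a + _ + _ = a - D ^+ 2 * (100 * 100 / 64)); last first.
    by rewrite /th /D; field.
  have DD2 : D ^+ 2 <= D * (32 / 100 / 100) by rewrite expr2 ler_wpM2l//; lra.
  set y := a - _ => gH.
  have Da : D <= a by rewrite /D; lra.
  have y0 : 0 <= y by rewrite /y; lra.
  have ya : y <= a by rewrite /y gerBl mulr_ge0 ?sqr_ge0//; lra.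
  have : 0 <= y <= 1 / 20 by rewrite y0; lra.
  move/expR_le_quadratic/(le_trans gH).
  have : y ^+ 2 <= a ^+ 2 by rewrite ler_pXn2r// ?nnegrE.
  have yE : y = a - D ^+ 2 * (100 * 100 / 64) by [].
  by clearbody y D; lra.
have := H 1; rewrite ler01 lexx => /(_ erefl) gH.
have : 0 <= b + 16 / 100 / 100 <= 1 / 20 by apply/andP; split; lra.
move/expR_le_quadratic; rewrite (_ : _ + _ / _ = (1 - 1) * a + 1 * b + 16 / 100 / 100 * 1 ^+ 2); last by ring.
move/(le_trans gH); rewrite subrr mul0r add0r mul1r expr1n mulr1.
have : (b + 16 / 100 / 100) ^+ 2 <= a ^+ 2 by rewrite ler_pXn2r// ?nnegrE; rewrite /D in Du D2; lra.
have ha : 0 <= (2 / 100 - a) * a by apply: mulr_ge0; lra.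
case: Vc => [[a1 ->]|[a1 ->]].
  have : 0 <= (1 / 100 - a) * a by apply: mulr_ge0; lra.
  by rewrite /D in D2 Du; lra.
have : 0 <= (2 / 100 - a) * (a - 1 / 100) by apply: mulr_ge0; lra.
rewrite (_ : (1 / 100) ^+ 2 = 1 / 10000); last by field.
by rewrite /D in D2 Du; lra.
Qed.
End elementary.

(** * Comparing [|Y|] with its excess over a level *)

Section shift.
Context {d : measure_display} {T : measurableType d} {R : realType}.
Context (P : probability T R) (Y : T -> R) (mY : measurable_fun setT Y).
Context (lcY : log_concave_tails P Y).

Lemma mean_ccdf_le (u v : T -> R) (c : R) : measurable_fun setT u -> measurable_fun setT v ->
  (forall w, 0 <= u w) -> (forall w, 0 <= v w) -> 0 <= c ->
  (forall r, 0 <= r -> (P [set w | (r < u w)%R] <= c%:E * P [set w | (r < v w)%R])%E) ->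
  (\int[P]_w (u w)%:E <= c%:E * \int[P]_w (v w)%:E)%E.
Proof.
move=> mu mv u0 v0 c0 uv.
pose U : {RV P >-> R} := mfun_Sub (mem_set mu).
pose V : {RV P >-> R} := mfun_Sub (mem_set mv).
have -> : (\int[P]_w (u w)%:E = 'E_P[U])%E by rewrite expectation_def.
have -> : (\int[P]_w (v w)%:E = 'E_P[V])%E by rewrite expectation_def.
rewrite !ge0_expectation_ccdf//.
have cE (W : {RV P >-> R}) r : ccdf W r = P [set w | (r < W w)%R].
  by rewrite /ccdf /distribution /pushforward; congr (P _); apply/seteqP; split => w /=;
    rewrite in_itv /= andbT.
rewrite -ge0_integralZl_EFin//; last exact: measurable_funTS (ccdf_measurable V).
apply: ge0_le_integral => //.
- exact: measurable_funTS (ccdf_measurable U).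
- by apply: measurable_funeM; exact: measurable_funTS (ccdf_measurable V).
- by move=> r /=; rewrite in_itv /= andbT => r0; rewrite !cE; exact: uv.
Qed.

Lemma tailD_le s t : 0 <= s -> 0 <= t -> tail P Y (s + t) <= tail P Y s * tail P Y t.
Proof.
move=> s0 t0; have [H|st] := leP (tail P Y (s + t)) 0.
  by apply: le_trans H _; rewrite mulr_ge0// tail_ge0.
have := nlt_increment mY lcY (lexx 0) s0 t0 st; rewrite add0r nlt0// subr0.
have ts : 0 < tail P Y s by apply: tail_gt0_le st => //; rewrite lerDl.
have tt : 0 < tail P Y t by apply: tail_gt0_le st => //; rewrite lerDr.
by rewrite -(expR_nlt st) -(expR_nlt ts) -(expR_nlt tt) -expRD ler_expR; lra.
Qed.

(** Log-concavity makes the tail submultiplicative, so given [|Y| >= l] the excess [|Y| - l] is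
    stochastically at most [|Y|]; [v] is nondecreasing. *)
Lemma mean_shift_le (v : R -> R) l : 0 <= l ->
  (forall x y, 0 <= x -> x <= y -> v x <= v y) -> v 0 = 0 ->
  measurable_fun setT v ->
  (\int[P]_w (v (Num.max (`|Y w| - l) 0))%:E <=
    (tail P Y l)%:E * \int[P]_w (v `|Y w|)%:E)%E.
Proof.
move=> l0 vle v00 mv.
have mZ : measurable_fun setT (fun w => `|Y w|) by exact: measurableT_comp.
have v0 x : 0 <= x -> 0 <= v x by move=> x0; rewrite -v00; exact: vle.
apply: mean_ccdf_le.
- apply: measurableT_comp => //; apply: measurable_maxr => //.
  exact: measurable_funB.
- exact: measurableT_comp.
- by move=> w; apply: v0; rewrite le_max lexx orbT.
- by move=> w; exact: v0.
- exact: tail_ge0.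
move=> r r0; pose U := [set x : R | 0 <= x /\ r < v x].
rewrite (_ : [set w | r < v (Num.max _ _)] = (fun w => `|Y w| - l) @^-1` U); last first.
  apply/seteqP; split => w /=.
    by case: (leP (`|Y w| - l) 0) => [_|/ltW //]; rewrite v00 ltNge r0.
  by move=> [H]; rewrite max_l.
apply: upper_set_prob_le.
- exact: measurable_funB.
- by move=> x y [x0 rx] xy; split; [exact: le_trans xy|exact: lt_le_trans (vle _ _ x0 xy)].
- by exists 0 => x [].
- by rewrite mule_ge0// lee_fin tail_ge0.
move=> b [b0 rb]; rewrite (_ : [set w | b <= `|Y w| - l] = [set w | l + b <= `|Y w|]); last first.
  by apply/seteqP; split => w /=; rewrite lerBrDl.
rewrite -tailE//; apply: le_trans (_ : (tail P Y l * tail P Y b)%:E <= _)%E.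
  by rewrite lee_fin tailD_le.
rewrite EFinM; apply: lee_wpmul2l; first by rewrite lee_fin tail_ge0.
rewrite tailE// le_measure ?inE//; first exact: measurable_tail_set.
  by apply: measurable_gt_set; exact: measurableT_comp.
by move=> w /= bw; exact: lt_le_trans rb (vle _ _ b0 bw).
Qed.
End shift.

(* Locked: [a], [k] are the coefficients of the cost function below, and unification
   would unfold the numerals in unary. *)
HB.lock Definition cost_a {R : realType} : R := 1 / 100 / 100.
HB.lock Definition cost_k {R : realType} : R := 16 / 1000 / 100.
(** The weight of [half_exp] in the far estimate. It must exceed [1.0108 * 0.0006], the coefficient
    of [e] in the hypothesis of [far_arith]. *)
HB.lock Definition cost_h {R : realType} : R := 61 / 1000 / 100.

Lemma cost_aE {R : realType} : cost_a = 1 / 100 / 100 :> R.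
Proof. by rewrite cost_a.unlock. Qed.

Lemma cost_kE {R : realType} : cost_k = 16 / 1000 / 100 :> R.
Proof. by rewrite cost_k.unlock. Qed.

Lemma cost_hE {R : realType} : cost_h = 61 / 1000 / 100 :> R.
Proof. by rewrite cost_h.unlock. Qed.

Lemma cost_a_gt0 {R : realType} : 0 < cost_a :> R.
Proof. by rewrite cost_aE; lra. Qed.

Lemma cost_k_gt0 {R : realType} : 0 < cost_k :> R.
Proof. by rewrite cost_kE; lra. Qed.

Lemma cost_h_gt0 {R : realType} : 0 < cost_h :> R.
Proof. by rewrite cost_hE; lra. Qed.

Lemma far_arith {R : realType} (g a e : R) : 0 <= e ->
  g <= 10108 / 100 / 100 * (1 - 2 * (3 / 100 / 100) + 2 * (3 / 100 / 100) * e) ->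
  1 / 100 <= a ->
  g + 23 * (1 / 100) ^+ 2 + cost_h * (11 / 5) <=
  1 + a + 128 * (1 / 100) ^+ 2 + cost_h * e.
Proof. by rewrite cost_hE expr2; lra. Qed.

(** * The cost function in dimension one *)

Section half_line.
Context {d : measure_display} {T : measurableType d} {R : realType}.
Context (P : probability T R) (Y : T -> R) (mY : measurable_fun setT Y).
Context (lcY : log_concave_tails P Y).

Local Notation tail := (tail P Y).
Local Notation nlt := (nlt P Y).

(** On unit scale [nlt 1 <= 1], so subtracting 1 makes the second term vanish for [|z| <= 4], where
    the cost is purely quadratic. The quotient by [1 + |z|] keeps the first term linear at infinity,
    hence controllable by [nlt]. *)
Definition cost (z : R) : R := cost_a * (z ^+ 2 / (1 + `|z|)) +
  cost_k * Num.max 0 (nlt (`|z| / 4) - 1).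

(** The cost is meant to be infinite outside this set, where the real-valued [nlt] would return
    0. *)
Definition cost_dom : set R := [set z | 0 < tail (`|z| / 4)].

Lemma cost_ge0 z : 0 <= cost z.
Proof.
rewrite addr_ge0// mulr_ge0 ?le_max ?lexx ?(ltW cost_a_gt0) ?(ltW cost_k_gt0)//.
by rewrite divr_ge0 ?sqr_ge0// addr_ge0.
Qed.

Section normalized.
Context (tail1 : expR (- 1) <= tail 1) (tailq : tail (10 / 9) < expR (- 1)).

Lemma quad_cost_le (z : R) : z ^+ 2 / (1 + `|z|) <= `|z|.
Proof.
rewrite ler_pdivrMr ?ltr_wpDr// -[z ^+ 2]real_normK ?num_real// mulrDr mulr1 -expr2.
by rewrite lerDr.
Qed.

Lemma cost_near (z : R) : `|z| <= 4 -> cost_dom z /\ cost z <= cost_a * z ^+ 2.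
Proof.
move=> z4; have H : `|z| / 4 <= 1 by rewrite ler_pdivrMr// mul1r.
have t1 : 0 < tail 1 by apply: lt_le_trans tail1; exact: expR_gt0.
split; first exact: tail_gt0_le H t1.
rewrite /cost [Num.max _ _]max_l; last first.
  by rewrite subr_le0 (le_trans _ (nlt1_le1 tail1))// nlt_le.
rewrite mulr0 addr0 ler_wpM2l ?(ltW cost_a_gt0)//.
by rewrite ler_pdivrMr ?ltr_wpDr// ler_peMr ?sqr_ge0// lerDl.
Qed.

(** By [nlt_increment], [nlt] grows from [c] to [x] at least as much as on an interval of length [v]
    starting at 0, or of length [v / 4] starting at 1. The first bounds [v], hence the linear term;
    the second bounds the logarithmic term. *)
Lemma cost_far (c x y : R) : 0 <= y -> c = y + 4 -> c <= x -> 0 < tail x ->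
  cost_dom (x - y) /\ cost (x - y) <= 6 / 100 / 100 + 3 / 100 / 100 * (nlt x - nlt c).
Proof.
move=> y0 -> cx tx; set v := x - (y + 4); have v0 : 0 <= v by rewrite /v; lra.
have xE : x = y + 4 + v by rewrite /v; ring.
have zE : x - y = 4 + v by rewrite xE; ring.
have z0 : 0 <= x - y by rewrite zE; lra.
have q1 : (x - y) / 4 = 1 + v / 4 by rewrite zE; field.
have v4 : 0 <= v / 4 by lra.
have tz : 0 < tail ((x - y) / 4) by apply: tail_gt0_le tx => //; rewrite q1 xE; lra.
split; first by rewrite /cost_dom /= ger0_norm.
have D0 : 0 <= nlt x - nlt (y + 4) by rewrite subr_ge0 nlt_le.
have N1 : nlt ((x - y) / 4) - 1 <= nlt x - nlt (y + 4).
  have : 0 < tail (y + 4 + v / 4) by apply: tail_gt0_le tx => //; rewrite xE; lra.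
  have h1 : 1 <= y + 4 by lra.
  move/(nlt_increment mY lcY ler01 h1 v4); rewrite -q1.
  have := nlt1_le1 tail1.
  have : nlt (y + 4 + v / 4) <= nlt x by apply: nlt_le => //; rewrite xE; lra.
  by lra.
have N2 : v <= 10 / 9 * (1 + (nlt x - nlt (y + 4))).
  have tv : 0 < tail v by apply: tail_gt0_le tx => //; rewrite xE; lra.
  have := le_nlt1 mY lcY tailq tv.
  have h4 : 0 <= y + 4 by lra.
  move: tx; rewrite xE => /(nlt_increment mY lcY (lexx 0) h4 v0).
  by rewrite add0r nlt0// subr0 -xE; lra.
have M : Num.max 0 (nlt ((x - y) / 4) - 1) <= nlt x - nlt (y + 4).
  by rewrite ge_max D0.
have := quad_cost_le (x - y); rewrite /cost ger0_norm//.
move: M; set m := Num.max _ _; set q := _ / (1 + _); move: N2.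
have -> : v = x - y - 4 by rewrite zE; ring.
move: D0; set D := nlt x - _; rewrite cost_aE cost_kE; clear; move=> *; lra.
Qed.

(** * The half-line inequality for a nonnegative convex function vanishing at 0 *)

Section lyapunov.
Context (w G : R -> R).
Context (w_convex : forall x y a : R, 0 <= x -> 0 <= y -> 0 <= a <= 1 ->
  w (a * x + (1 - a) * y) <= a * w x + (1 - a) * w y).
Context (w_ge0 : forall x, 0 <= x -> 0 <= w x) (w0 : w 0 = 0) (w_cont : continuous w).
Context (G_ge0 : forall x, 0 <= G x) (mG : measurable_fun setT G).
Context (G_le : forall x z : R, 0 <= z <= x -> cost_dom z -> G x <= expR (w (x - z) + cost z)).

Lemma w_le (x y : R) : 0 <= x -> x <= y -> w x <= w y.
Proof.
move=> x0; rewrite le_eqVlt => /predU1P[->//|xy].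
have y0 : 0 < y by exact: le_lt_trans xy.
have a01 : 0 <= x / y <= 1.
  by apply/andP; split; [rewrite divr_ge0// ltW|rewrite ler_pdivrMr// mul1r ltW].
have := w_convex (ltW y0) (lexx 0) a01; rewrite w0 !mulr0 !addr0 divfK ?gt_eqF//.
move/le_trans; apply; rewrite ler_piMl ?w_ge0 ?(ltW y0)//.
by case/andP: a01.
Qed.

(** The displacement covers the fraction [th] of the way from [x] to [x - 4], cut off at 0. It has
    length at most [4 * th], so it costs at most [16 * cost_a * th ^+ 2], the term in
    [near_pointwise]. *)
Lemma near_level (x : R) : 0 <= x -> w (Num.max (x - 4) 0) <= 1 / 100 ->
  G x + 23 * Num.min (w x) (1 / 100) ^+ 2 <=
  1 + w x + 128 * Num.min (w (Num.max (x - 4) 0)) (1 / 100) ^+ 2.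
Proof.
move=> x0; set x' := Num.max _ _ => wx'.
have x'0 : 0 <= x' by rewrite le_max lexx orbT.
have xx' : x' <= x by rewrite ge_max x0 andbT; lra.
have x4' : x - 4 <= x' by rewrite le_max lexx.
have x4 : x - x' <= 4 by lra.
rewrite [in leRHS](min_l wx'); apply: near_pointwise => //; first exact: w_ge0.
  exact: w_le.
move=> th /andP[th0 th1]; set z := th * (x - x').
have z0 : 0 <= z by rewrite mulr_ge0// subr_ge0.
have z4 : z <= 4 by rewrite /z; nra.
have zx : z <= x by rewrite /z; nra.
have [|dz cz] := cost_near (z := z); first by rewrite ger0_norm.
apply: le_trans (G_le _ dz) _; first by rewrite z0.
rewrite ler_expR; apply: lerD.
  have -> : x - z = (1 - th) * x + (1 - (1 - th)) * x' by rewrite /z; ring.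
  have := w_convex x0 x'0 (a := 1 - th); rewrite (_ : 1 - (1 - th) = th); last by ring.
  by apply; apply/andP; split; lra.
apply: le_trans cz _; rewrite -[leRHS]mulrAC -mulrA.
have : z ^+ 2 <= (th * 4) ^+ 2.
  by rewrite ler_pXn2r// ?nnegrE ?mulr_ge0// /z ler_wpM2l.
by rewrite exprMn cost_aE; lra.
Qed.

(** The move goes all the way back to [y], so [G x] is at most [expR (1 / 100)] times the
    exponential of the cost, however large [w x] is. That exponential is charged to [half_exp] at
    [c]; the term with 11/5 on the left will cancel its mean. *)
Lemma far_level (x y c : R) : 0 <= y -> w y = 1 / 100 -> c = y + 4 -> c <= x -> 0 < tail x ->
  G x + 23 * Num.min (w x) (1 / 100) ^+ 2 + cost_h * (11 / 5) <=
  1 + w x + 128 * Num.min (w (Num.max (x - 4) 0)) (1 / 100) ^+ 2 +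
  cost_h * expR ((nlt x - nlt c) / 2).
Proof.
move=> y0 wy cE cx tx.
have xy : y <= x - 4 by lra.
have h0 : 0 <= x - 4 by exact: le_trans xy.
have w4 : 1 / 100 <= w (x - 4) by rewrite -wy w_le.
have wx : 1 / 100 <= w x by rewrite -wy w_le//; lra.
rewrite (max_l h0) !min_r//.
have [dz cz] := cost_far y0 cE cx tx.
have zx : 0 <= x - y <= x by apply/andP; split; lra.
have := G_le zx dz; rewrite (_ : x - (x - y) = y); last by ring.
rewrite wy => /le_trans; set D := nlt x - nlt c in cz *.
have D0 : 0 <= D by rewrite subr_ge0 nlt_le.
move=> /(_ (expR (106 / 100 / 100) * expR (3 / 100 / 100 * D))) GG.
have {}GG : G x <= expR (106 / 100 / 100) * expR (3 / 100 / 100 * D).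
  by apply: GG; rewrite -expRD ler_expR; lra.
have : expR (106 / 100 / 100) <= 10108 / 100 / 100 :> R.
  have : 0 <= (106 / 100 / 100 : R) <= 1 / 20 by apply/andP; split; lra.
  by move/expR_le_quadratic => /le_trans; apply; rewrite expr2; lra.
have : expR (3 / 100 / 100 * D) <= (1 - 2 * (3 / 100 / 100)) + 2 * (3 / 100 / 100) * expR (D / 2).
  by apply: expR_le_chord; apply/andP; split; lra.
have E1 := expR_gt0 (106 / 100 / 100 : R).
move=> h1 h2; have h3 := expR_ge0 (3 / 100 / 100 * D).
have := ler_pM (ltW E1) h3 h2 h1 => h4.
have := le_trans GG h4.
have := expR_ge0 (D / 2); set EE := expR (D / 2).
by move=> *; exact: far_arith.
Qed.

Context (w_int : P.-integrable setT (EFin \o (fun t => w `|Y t|))).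

(** The loss at the point shifted by 4 has mean at most [128 / 32 = 4] times that of the truncated
    square at [|Y|], so 19 of the 23 units gained survive. This surplus is spent in
    [infconv_small_slope]. *)
Lemma half_line_infconv :
  (\int[P]_t (G `|Y t|)%:E + 19%:E * \int[P]_t (Num.min (w `|Y t|) (1 / 100) ^+ 2)%:E <=
   1 + \int[P]_t (w `|Y t|)%:E)%E.
Proof.
have mZ : measurable_fun setT (fun t => `|Y t|) by exact: measurableT_comp.
have mw : measurable_fun setT w by exact: continuous_measurable_fun.
pose v x := Num.min (w x) (1 / 100) ^+ 2.
have mv : measurable_fun setT v by apply: measurable_funX; exact: measurable_minr.
have min_ge0 x : 0 <= x -> 0 <= Num.min (w x) (1 / 100).
  by move=> x0; rewrite le_min w_ge0//=; lra.
have v0 x : 0 <= v x by exact: sqr_ge0.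
have vle (x y : R) : 0 <= x -> x <= y -> v x <= v y.
  move=> x0 xy; have y0 := le_trans x0 xy; rewrite /v ler_pXn2r// ?nnegrE ?min_ge0//.
  by rewrite le_min !ge_min lexx orbT w_le.
have v00 : v 0 = 0 by rewrite /v w0 min_l ?expr0n//; lra.
have H32 : (\int[P]_t (v (Num.max (`|Y t| - 4) 0))%:E <= 32^-1%:E * \int[P]_t (v `|Y t|)%:E)%E.
  apply: le_trans (mean_shift_le mY lcY _ vle v00 mv) _ => //.
  apply: lee_wpmul2r; first by apply: mean_ge0.
  by rewrite lee_fin; exact: tail4_le.
have [c [k [k0 pw]]] : exists c k : R, 0 <= k /\ forall t, 0 < tail `|Y t| ->
    G `|Y t| + 23 * v `|Y t| + (k * (11 / 5)) * \1_[set t | c <= `|Y t|] t <=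
    1 + w `|Y t| + 128 * v (Num.max (`|Y t| - 4) 0) + k * half_exp P Y c t.
  (* If [w] never takes the value 1/100, then by continuity and [w 0 = 0] it stays below, and all
     points are near. *)
  have [[y [y0 wy]]|ny] := pselect (exists y, 0 <= y /\ w y = 1 / 100).
    exists (y + 4), cost_h; split; first exact: ltW cost_h_gt0.
    move=> t tt; rewrite /half_exp indicE tt andbT.
    have [cZ|Zc] := leP (y + 4) `|Y t|.
      by rewrite mem_set// mulr1; apply: (@far_level _ y).
    rewrite memNset ?mulr0 ?addr0; last by apply/negP; rewrite -ltNge.
    apply: near_level => //; rewrite -wy; apply: w_le.
      by rewrite le_max lexx orbT.
    by rewrite ge_max y0 andbT; lra.
  have wlt x : 0 <= x -> w x <= 1 / 100.
    move=> x0; rewrite leNgt; apply/negP => wx; apply: ny.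
    have wx0 : 0 <= w x by exact: w_ge0.
    have mm : Num.min (w 0) (w x) <= 1 / 100 <= Num.max (w 0) (w x).
      by rewrite w0 min_l// max_r//; apply/andP; split; lra.
    have [y + wy] := IVT x0 (continuous_subspaceT w_cont) mm.
    by rewrite in_itv /= => /andP[y0 _]; exists y.
  exists 0, 0; split => // t tt; rewrite !mul0r !addr0.
  apply: near_level => //; apply: wlt; by rewrite le_max lexx orbT.
set Gm := (\int[P]_t (G _)%:E)%E; set wm := (\int[P]_t (w _)%:E)%E.
set vm := (\int[P]_t (Num.min _ _ ^+ 2)%:E)%E.
set vm' := (\int[P]_t _)%E in H32.
have vmE : vm = (\int[P]_t (v `|Y t|)%:E)%E by [].
rewrite -vmE in H32.
have mA : measurable [set t | c <= `|Y t|] by exact: measurable_tail_set.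
have mh := measurable_half_exp P mY c.
have wY0 t : 0 <= w `|Y t| by exact: w_ge0.
have k115 : 0 <= k * (11 / 5) by apply: mulr_ge0 => //; lra.
have mGY : measurable_fun setT (fun t => G `|Y t|) by exact: measurableT_comp.
have mvY : measurable_fun setT (fun t => v `|Y t|) by exact: measurableT_comp.
have mwY : measurable_fun setT (fun t => w `|Y t|) by exact: measurableT_comp.
have mvY' : measurable_fun setT (fun t => v (Num.max (`|Y t| - 4) 0)).
  by apply: measurableT_comp => //; apply: measurable_maxr => //; exact: measurable_funB.
have v'0 t : 0 <= v (Num.max (`|Y t| - 4) 0) by exact: v0.
have h0 t : 0 <= half_exp P Y c t by exact: half_exp_ge0.
have iA0 t : 0 <= \1_[set t | c <= `|Y t|] t :> R by rewrite indicE; case: (_ \in _).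
have miA : measurable_fun setT (\1_[set t | c <= `|Y t|] : T -> R) by exact: measurable_indic.
have s23 t : 0 <= 23 * v `|Y t| by rewrite mulr_ge0.
have s128 t : 0 <= 128 * v (Num.max (`|Y t| - 4) 0) by rewrite mulr_ge0.
have skh t : 0 <= k * half_exp P Y c t by rewrite mulr_ge0.
have skA t : 0 <= k * (11 / 5) * \1_[set t | c <= `|Y t|] t by rewrite mulr_ge0.
have sGv t : 0 <= G `|Y t| + 23 * v `|Y t| by rewrite addr_ge0.
have s1w t : 0 <= 1 + w `|Y t| by rewrite addr_ge0.
have s1wv t : 0 <= 1 + w `|Y t| + 128 * v (Num.max (`|Y t| - 4) 0) by rewrite addr_ge0.
have m23 : measurable_fun setT (fun t => 23 * v `|Y t|) by exact: measurable_funM.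
have m128 : measurable_fun setT (fun t => 128 * v (Num.max (`|Y t| - 4) 0)) by exact: measurable_funM.
have mkh : measurable_fun setT (fun t => k * half_exp P Y c t) by exact: measurable_funM.
have mkA : measurable_fun setT (fun t => k * (11 / 5) * \1_[set t | c <= `|Y t|] t).
  exact: measurable_funM.
have mGv : measurable_fun setT (fun t => G `|Y t| + 23 * v `|Y t|) by exact: measurable_funD.
have m1w : measurable_fun setT (fun t => 1 + w `|Y t|) by exact: measurable_funD.
have m1wv : measurable_fun setT (fun t => 1 + w `|Y t| + 128 * v (Num.max (`|Y t| - 4) 0)).
  exact: measurable_funD.
have M : (Gm + 23%:E * vm + (k * (11 / 5))%:E * (tail c)%:E <=
    1 + wm + 128%:E * vm' + k%:E * (11 / 5 * tail c)%:E)%E.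
  apply: (@le_trans _ _ (\int[P]_t
     (1 + w `|Y t| + 128 * v (Num.max (`|Y t| - 4) 0) + k * half_exp P Y c t)%:E)%E); last first.
    rewrite mean_add// mean_add// mean_add// mean_cst mean_scale// mean_scale//.
    by apply: leeD => //; apply: lee_wpmul2l => //; exact: mean_half_exp.
  rewrite tailE// -(mean_indic P mA) /Gm vmE -mean_scale// -mean_scale// -mean_add// -mean_add//.
  apply: (mean_le_tail_gt0 mY) => //.
  - by move=> t; rewrite addr_ge0.
  - by move=> t; rewrite addr_ge0.
  - exact: measurable_funD.
  - exact: measurable_funD.
have wmf : wm \is a fin_num by exact: integrable_fin_num.
have vmf : vm \is a fin_num.
  rewrite ge0_fin_numE; last by apply: mean_ge0 => t; exact: v0.
  apply: (@le_lt_trans _ _ 1%E); last exact: ltry.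
  rewrite -(mean_cst P 1); apply: mean_le => // t; first exact: v0.
  apply: exprn_ile1; first exact: min_ge0.
  by rewrite ge_min; apply/orP; right; lra.
have vmf' : vm' \is a fin_num.
  rewrite ge0_fin_numE; last by apply: mean_ge0 => t.
  by apply: le_lt_trans H32 _; rewrite -(fineK vmf) -EFinM ltry.
have Gmf : Gm \is a fin_num.
  rewrite ge0_fin_numE; last by apply: mean_ge0 => t.
  apply: (@le_lt_trans _ _ (Gm + 23%:E * vm + (k * (11 / 5))%:E * (tail c)%:E)%E).
    rewrite -addeA leeDl// adde_ge0// mule_ge0// ?lee_fin ?tail_ge0//.
    by apply: mean_ge0 => t; exact: v0.
  apply: le_lt_trans M _.
  by rewrite -(fineK wmf) -(fineK vmf') -!EFinM -!EFinD ltry.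
move: M H32; rewrite -(fineK wmf) -(fineK vmf) -(fineK vmf') -(fineK Gmf).
rewrite -!EFinM -!EFinD !lee_fin.
move: (fine wm) (fine vm) (fine vm') (fine Gm) (tail c) => a1 a2 a3 a4 a5 M H32.
lra.
Qed.
End lyapunov.
End normalized.
End half_line.

(** * Symmetric variables: splitting means over the two half-lines *)

Section symmetric.
Context {d : measure_display} {T : measurableType d} {R : realType}.
Context (P : probability T R) (Y : T -> R) (mY : measurable_fun setT Y).
Context (symY : forall A : set R, measurable A -> P (Y @^-1` A) = P ((fun t => - Y t) @^-1` A)).

Lemma mean_oppr (u : R -> R) : measurable_fun setT u -> (forall x, 0 <= u x) ->
  (\int[P]_t (u (- Y t))%:E = \int[P]_t (u (Y t))%:E)%E.
Proof.
move=> mu u0.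
have mNY : measurable_fun setT (fun t => - Y t) by exact: measurable_funN.
have mE : measurable_fun setT (EFin \o u) by exact/measurable_EFinP.
have E0 x : x \in [set: R] -> (0 <= (EFin \o u) x)%E by rewrite /= lee_fin.
have := ge0_integral_pushforward mY P measurableT mE E0.
have := ge0_integral_pushforward mNY P measurableT mE E0.
rewrite !preimage_setT /= => <- <-; apply: eq_measure_integral => A mA _.
exact: (esym (symY mA)).
Qed.

Lemma mean_abs_split (u : R -> R) : measurable_fun setT u -> (forall x, 0 <= u x) ->
  (2%:E * \int[P]_t (u (Y t))%:E = \int[P]_t (u `|Y t|)%:E + \int[P]_t (u (- `|Y t|))%:E)%E.
Proof.
move=> mu u0.
have mZ : measurable_fun setT (fun t => `|Y t|) by exact: measurableT_comp.
have mNY : measurable_fun setT (fun t => - Y t) by exact: measurable_funN.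
have mNZ : measurable_fun setT (fun t => - `|Y t|) by exact: measurable_funN.
have m1 := measurableT_comp mu mZ; have m2 := measurableT_comp mu mNZ.
have m3 := measurableT_comp mu mY; have m4 := measurableT_comp mu mNY.
rewrite -mean_add// -[2%:E]/((1 + 1)%:E) EFinD ge0_muleDl// !mul1e -{2}mean_oppr//.
rewrite -mean_add//; apply: eq_integral => t _; congr EFin.
by case: (ger0P (Y t)) => _; rewrite ?opprK// addrC.
Qed.
End symmetric.

(** * The one-dimensional inequality for steep functions *)

Section infconv.
Context {d : measure_display} {T : measurableType d} {R : realType}.
Context (P : probability T R) (Y : T -> R) (mY : measurable_fun setT Y).
Context (lcY : log_concave_tails P Y).
Context (symY : forall A : set R, measurable A -> P (Y @^-1` A) = P ((fun t => - Y t) @^-1` A)).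

Local Notation tail := (tail P Y).
Local Notation nlt := (nlt P Y).
Local Notation cost := (cost P Y).
Local Notation cost_dom := (cost_dom P Y).

Context (tail1 : expR (- 1) <= tail 1) (tailq : tail (10 / 9) < expR (- 1)).

Lemma Rmean_le_tail_gt0 (u v : T -> R) : P.-integrable setT (EFin \o u) ->
  P.-integrable setT (EFin \o v) -> (forall t, 0 < tail `|Y t| -> u t <= v t) ->
  \int[P]_t u t <= \int[P]_t v t.
Proof.
(* The excess [e] has mean zero, and [u <= v + e] holds everywhere. *)
move=> iu iv uv; pose e t := Num.max (u t - v t) 0.
have mu : measurable_fun setT u by apply/measurable_EFinP; exact: measurable_int iu.
have mv : measurable_fun setT v by apply/measurable_EFinP; exact: measurable_int iv.
have e0 t : 0 <= e t by rewrite le_max lexx orbT.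
have me : measurable_fun setT e by apply: measurable_maxr => //; exact: measurable_funB.
have ze : (\int[P]_t (e t)%:E = 0)%E.
  apply/eqP; rewrite eq_le mean_ge0// andbT.
  apply: (@le_trans _ _ (\int[P]_t (0 : R)%:E)%E); last by rewrite mean_cst.
  apply: (mean_le_tail_gt0 mY) => // t tt.
  by rewrite ge_max lexx andbT subr_le0 uv.
have ie : P.-integrable setT (EFin \o e).
  apply: integrable_real => //; under eq_integral do rewrite ger0_norm//.
  by rewrite ze ltry.
have -> : \int[P]_t v t = \int[P]_t (v t + e t).
  by rewrite RintegralD// [X in _ + X]/Rintegral ze addr0.
apply: le_Rintegral => //; first exact: integrable_add.
by move=> t _; rewrite -lerBlDl /e le_max lexx.
Qed.

Section lipschitz.
Context (f : R -> R) (L : R) (f_lip : forall x y, `|f x - f y| <= L * `|x - y|).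

Lemma lipschitz_continuous : continuous f.
Proof.
have L0 : 0 <= L by have := f_lip 1 0; rewrite subr0 normr1 mulr1; exact: le_trans.
move=> x; apply/cvgrPdist_le => e e0; near=> y.
apply: le_trans (f_lip _ _) _; apply: (@le_trans _ _ ((L + 1) * `|x - y|)).
  by rewrite ler_wpM2r// lerDl.
rewrite -ler_pdivlMl ?ltr_wpDl//; near: y.
have r0 : 0 < (L + 1)^-1 * e by rewrite mulr_gt0// invr_gt0 ltr_wpDl.
by apply/nbhs_ballP; exists ((L + 1)^-1 * e) => //= y; rewrite /ball /= => /ltW.
Unshelve. all: by end_near.
Qed.

Lemma integrable_abs : P.-integrable setT (EFin \o (fun t => `|Y t|)).
Proof.
apply: integrable_real; first exact: measurableT_comp.
under eq_integral do rewrite normr_id.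
by apply: le_lt_trans (mean_abs_le mY lcY tailq) _; rewrite ltry.
Qed.

Lemma integrable_lipschitz (g : T -> R) : measurable_fun setT g ->
  (forall t, `|g t| <= `|Y t|) -> P.-integrable setT (EFin \o (f \o g)).
Proof.
move=> mg gY; have mf : measurable_fun setT f.
  by apply: continuous_measurable_fun; exact: lipschitz_continuous.
have L0 : 0 <= L by have := f_lip 1 0; rewrite subr0 normr1 mulr1; exact: le_trans.
apply: (@integrable_dominated _ _ _ _ _ (fun t => `|f 0| + L * `|Y t|)).
- exact: measurableT_comp.
- exact: integrable_add (integrable_cst P _) (integrable_scale L integrable_abs).
- move=> t /=; rewrite -[f (g t)](subrK (f 0)) addrC (le_trans (ler_normD _ _))// lerD2l.
  by apply: le_trans (f_lip _ _) _; rewrite subr0 ler_wpM2l.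
Qed.

Lemma Rmean_abs_split :
  2 * \int[P]_t f (Y t) = \int[P]_t f `|Y t| + \int[P]_t f (- `|Y t|).
Proof.
have mf : measurable_fun setT f.
  by apply: continuous_measurable_fun; exact: lipschitz_continuous.
have L0 : 0 <= L by have := f_lip 1 0; rewrite subr0 normr1 mulr1; exact: le_trans.
(* [f + h] is nonnegative, so [mean_abs_split] applies to it; [h] is even, so its contributions
   cancel. *)
pose h (x : R) := `|f 0| + L * `|x|; have mh : measurable_fun setT h.
  by apply: measurable_funD => //; apply: measurable_funM => //; exact: measurableT_comp.
have u0 x : 0 <= f x + h x.
  rewrite /h; have := f_lip x 0; rewrite subr0 ler_norml => /andP[+ _].
  by have := ler_norm (- f 0); rewrite normrN; lra.
have mu : measurable_fun setT (fun x => f x + h x) by exact: measurable_funD.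
have mNZ : measurable_fun setT (fun t => - `|Y t|).
  by apply: measurable_funN; exact: measurableT_comp.
have mZ : measurable_fun setT (fun t => `|Y t|) by exact: measurableT_comp.
have ih (g : T -> R) : measurable_fun setT g -> (forall t, `|g t| = `|Y t|) ->
    P.-integrable setT (EFin \o (h \o g)).
  move=> mg gY; rewrite (_ : h \o g = (fun t => `|f 0| + L * `|Y t|)); last first.
    by apply/funext => t /=; rewrite /h gY.
  exact: integrable_add (integrable_cst P _) (integrable_scale L integrable_abs).
have split (g : T -> R) : measurable_fun setT g -> (forall t, `|g t| = `|Y t|) ->
    (\int[P]_t (f (g t) + h (g t))%:E = (\int[P]_t f (g t) + \int[P]_t h `|Y t|)%:E)%E.
  move=> mg gY; rewrite -Rintegral_EFin; last first.
    by apply: integrable_add (integrable_lipschitz mg _) (ih _ mg gY) => t; rewrite gY.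
  congr EFin; rewrite RintegralD//; last exact: ih.
    by congr (_ + _); apply: eq_Rintegral => t _; rewrite /h gY normr_id.
  by apply: integrable_lipschitz => // t; rewrite gY.
have := mean_abs_split mY symY mu u0; rewrite !split//; last 2 first.
- by move=> t; rewrite normrN normr_id.
- by move=> t; rewrite normr_id.
by rewrite -EFinM -EFinD => -[]; lra.
Qed.
End lipschitz.

Section tilted_slope.
Context (f G : R -> R) (L s : R) (f_lip : forall x y, `|f x - f y| <= L * `|x - y|).
Context (f0 : f 0 = 0) (f_slope : forall x, s * x <= f x).
Context (f_convex : forall x y a : R, 0 <= a <= 1 ->
  f (a * x + (1 - a) * y) <= a * f x + (1 - a) * f y).
Context (G_ge0 : forall x, 0 <= G x) (mG : measurable_fun setT G).
Context (G_le : forall x z : R, cost_dom z -> G x <= expR (f (x - z) + cost z)).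

(** A quarter of [|x + z|] is below [|x|] or below [z], so one of the two values of [nlt] already
    bounds the logarithmic term. *)
Lemma cost_add_le (x z : R) : 0 <= z -> 0 < tail `|x| -> 0 < tail z ->
  cost_dom (x + z) /\
  cost (x + z) <= cost_a * (`|x| + z) + cost_k * (nlt `|x| + nlt z).
Proof.
move=> z0 tx tz; have xz : `|x + z| <= `|x| + z.
  by rewrite (le_trans (ler_normD _ _))// (ger0_norm z0).
have [tm Nm] : 0 < tail (`|x + z| / 4) /\ nlt (`|x + z| / 4) <= nlt `|x| + nlt z.
  have nx := nlt_ge0 P mY `|x|; have nz := nlt_ge0 P mY z.
  have [H|H] := leP `|x| z.
    have le_z : `|x + z| / 4 <= z by lra.
    by split; [exact: tail_gt0_le le_z tz|have := nlt_le mY tz le_z; lra].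
  have le_x : `|x + z| / 4 <= `|x| by lra.
  by split; [exact: tail_gt0_le le_x tx|have := nlt_le mY tx le_x; lra].
split => //; apply: lerD; rewrite ler_wpM2l ?(ltW cost_a_gt0) ?(ltW cost_k_gt0)//.
  exact: le_trans (quad_cost_le _) xz.
rewrite ge_max addr_ge0 ?nlt_ge0//=; lra.
Qed.

(** By [le_nlt1] the exponent is at most [12/100000 + 3/10000 * nlt |Y|], and [expR_le_chord]
    reduces its exponential to the mean of [half_exp] at 0. *)
Lemma mean_cost_le : (\int[P]_t (expR (cost_a * `|Y t| + cost_k * nlt `|Y t|))%:E <=
  (expR (9 / 100 / 100))%:E)%E.
Proof.
pose b : R := 3 / 100 / 100; pose c : R := expR (12 / 1000 / 100).
have c0 : 0 < c by exact: expR_gt0.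
have mh := measurable_half_exp P mY 0.
have mZ : measurable_fun setT (fun t => `|Y t|) by exact: measurableT_comp.
have b0 : 0 <= 2 * b by rewrite /b; lra.
have b1 : 0 <= 1 - 2 * b by rewrite /b; lra.
apply: (@le_trans _ _ (\int[P]_t (c * ((1 - 2 * b) + 2 * b * half_exp P Y 0 t))%:E)%E).
  apply: (mean_le_tail_gt0 mY).
  - by move=> t; exact: expR_ge0.
  - by move=> t; rewrite mulr_ge0 ?(ltW c0)// addr_ge0// mulr_ge0// half_exp_ge0.
  - apply: measurableT_comp => //; apply: measurable_funD; apply: measurable_funM => //.
    exact: measurable_nlt.
  - by apply: measurable_funM => //; apply: measurable_funD => //; exact: measurable_funM.
  - move=> t tt; rewrite /half_exp normr_ge0 tt /= nlt0// subr0.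
    have bh : 0 <= b <= 1 / 2 by rewrite /b; apply/andP; split; lra.
    apply: le_trans (ler_wpM2l (ltW c0) (expR_le_chord (nlt `|Y t|) bh)).
    rewrite -expRD ler_expR; have := le_nlt1 mY lcY tailq tt.
    have := nlt_ge0 P mY `|Y t|; rewrite /b cost_aE cost_kE; lra.
rewrite mean_scale//; last 3 first.
- exact: ltW.
- by move=> t; rewrite addr_ge0// mulr_ge0// half_exp_ge0.
- by apply: measurable_funD => //; exact: measurable_funM.
rewrite mean_add//; last 2 first.
- by move=> t; rewrite mulr_ge0// half_exp_ge0.
- exact: measurable_funM.
rewrite mean_cst mean_scale//; last by move=> t; exact: half_exp_ge0.
have := mean_half_exp P mY 0; rewrite tail_eq1// mulr1 => H.
apply: (@le_trans _ _ (c%:E * ((1 - 2 * b)%:E + (2 * b)%:E * (11 / 5)%:E))%E).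
  by rewrite lee_wpmul2l ?lee_fin ?(ltW c0)// leeD2l// lee_wpmul2l// lee_fin.
have -> : (c%:E * ((1 - 2 * b)%:E + (2 * b)%:E * (11 / 5)%:E) =
    (c * (1 - 2 * b + 2 * b * (11 / 5)))%:E)%E by [].
rewrite lee_fin.
have -> : 9 / 100 / 100 = 12 / 1000 / 100 + 78 / 1000 / 100 :> R by field.
rewrite expRD -/c ler_wpM2l ?(ltW c0)//.
apply: le_trans (expR_ge1Dx _); rewrite /b; lra.
Qed.

(** Let [a] be the mean of [G]. Moving every point to [- z] bounds [ln a] by [f (- z)] plus small
    errors; this is averaged over [z = |Y|]. The other half of [2 * E f] is the mean of [f |Y|], at
    least [E |Y| / 100 >= 1/280], which exceeds the errors and the bound [ln a <= 9/10000] coming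
    from [z = 0]. *)
Lemma infconv_large_slope : 1 / 100 <= s ->
  (\int[P]_t (G (Y t))%:E <= (expR (\int[P]_t f (Y t)))%:E)%E.
Proof.
move=> s1; set A := (\int[P]_t (G (Y t))%:E)%E.
have mZ : measurable_fun setT (fun t => `|Y t|) by exact: measurableT_comp.
pose K (x : R) := expR (cost_a * `|x| + cost_k * nlt `|x|).
have K0 x : 0 <= K x by exact: expR_ge0.
have mK : measurable_fun setT (fun t => K (Y t)).
  rewrite /K; apply: (measurableT_comp (f := @expR R)) => //; apply: measurable_funD; apply: measurable_funM => //.
  exact: measurable_nlt.
(* The displacement is [Y t + z], so that [f] is evaluated at the fixed point [- z] for every
   [t]. *)
have A_le z : 0 <= z -> 0 < tail z ->
    (A <= (expR (f (- z) + cost_a * z + cost_k * nlt z + 9 / 100 / 100))%:E)%E.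
  move=> z0 tz; set c := expR (f (- z) + cost_a * z + cost_k * nlt z).
  have c0 : 0 <= c by exact: expR_ge0.
  apply: (@le_trans _ _ (\int[P]_t (c * K (Y t))%:E)%E).
    apply: (mean_le_tail_gt0 mY) => //.
    - by move=> t; rewrite mulr_ge0.
    - exact: measurableT_comp.
    - exact: measurable_funM.
    - move=> t tt; have [dz cz] := cost_add_le z0 tt tz.
      apply: le_trans (G_le _ dz) _; rewrite (_ : Y t - (Y t + z) = - z); last by ring.
      by rewrite -expRD ler_expR; lra.
  rewrite mean_scale// expRD -/c EFinM lee_wpmul2l// ?lee_fin//.
  exact: mean_cost_le.
have A0 : (0 <= A)%E by exact: mean_ge0.
have t0 : 0 < tail 0 by rewrite tail_eq1.
have Af : A \is a fin_num.
  by rewrite ge0_fin_numE//; apply: le_lt_trans (A_le 0 (lexx 0) t0) _; rewrite ltry.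
move: A_le A0; rewrite -(fineK Af); set a := fine A => A_le; rewrite !lee_fin => a0.
move: a0; rewrite le_eqVlt => /predU1P[<-|a0]; first exact: expR_ge0.
have lna z : 0 <= z -> 0 < tail z ->
    ln a <= f (- z) + cost_a * z + cost_k * nlt z + 9 / 100 / 100.
  move=> z0 tz; rewrite -ler_expR lnK ?posrE//; have := A_le z z0 tz.
  by rewrite lee_fin.
rewrite -[X in X <= _]lnK ?posrE// ler_expR.
clear A_le; have lna0 : ln a <= 9 / 100 / 100.
  by have := lna 0 (lexx 0) t0; rewrite oppr0 f0 nlt0// !mulr0 !add0r.
have mNZ : measurable_fun setT (fun t => - `|Y t|) by exact: measurable_funN.
have ifZ : P.-integrable setT (EFin \o (fun t => f `|Y t|)).
  by apply: (integrable_lipschitz f_lip mZ) => t; rewrite normr_id.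
have ifN : P.-integrable setT (EFin \o (fun t => f (- `|Y t|))).
  by apply: (integrable_lipschitz f_lip mNZ) => t; rewrite normrN normr_id.
have iZ := integrable_abs.
have ih : P.-integrable setT (EFin \o half_exp P Y 0).
  apply: integrable_real; first exact: measurable_half_exp.
  under eq_integral do rewrite ger0_norm ?half_exp_ge0//.
  by apply: le_lt_trans (mean_half_exp P mY 0) _; rewrite ltry.
have i1 c : P.-integrable setT (EFin \o (fun t => c * `|Y t|)) .
  exact: integrable_scale.
have i2 c : P.-integrable setT (EFin \o (fun t => c * half_exp P Y 0 t)) .
  exact: integrable_scale.
have i3 c : P.-integrable setT (EFin \o (fun t => f `|Y t| + f (- `|Y t|) + c * half_exp P Y 0 t)).
  exact: integrable_add (integrable_add ifZ ifN) (i2 c).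
have i4 c k : P.-integrable setT (EFin \o (fun t => c + k * `|Y t|)).
  exact: integrable_add (integrable_cst P c) (i1 k).
(* [nlt] is replaced by [2 * (half_exp - 1)], from [1 + x <= expR x] at [x = nlt / 2]. *)
have : \int[P]_t (ln a - 9 / 100 / 100 + 2 * cost_k + (1 / 100 - cost_a) * `|Y t|) <=
       \int[P]_t (f `|Y t| + f (- `|Y t|) + 2 * cost_k * half_exp P Y 0 t).
  apply: Rmean_le_tail_gt0 => // t tt; have := lna _ (normr_ge0 (Y t)) tt.
  have : 1 / 100 * `|Y t| <= f `|Y t|.
    by apply: le_trans (f_slope _); rewrite ler_wpM2r.
  rewrite /half_exp normr_ge0 tt /= nlt0// subr0.
  have := ler_wpM2l (ltW cost_k_gt0) (expR_ge1Dx (nlt `|Y t| / 2)).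
  by lra.
have e1 c k : \int[P]_t (c + k * `|Y t|) = c + k * \int[P]_t `|Y t|.
  rewrite (RintegralD measurableT (integrable_cst P c) (i1 k)) RintegralZl//.
  by congr (_ + _); rewrite /Rintegral mean_cst.
have e2 c : \int[P]_t (f `|Y t| + f (- `|Y t|) + c * half_exp P Y 0 t) =
    2 * \int[P]_t f (Y t) + c * \int[P]_t half_exp P Y 0 t.
  rewrite (RintegralD measurableT (integrable_add ifZ ifN) (i2 c)) (RintegralD measurableT ifZ ifN).
  by rewrite RintegralZl// -(Rmean_abs_split f_lip).
rewrite e1 e2.
have h1 : \int[P]_t half_exp P Y 0 t <= 11 / 5.
  rewrite -lee_fin Rintegral_EFin//.
  by have := mean_half_exp P mY 0; rewrite tail_eq1// mulr1.
have h2 : 10 / 28 <= \int[P]_t `|Y t|.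
  rewrite -lee_fin Rintegral_EFin//; apply: le_trans (mean_abs_ge mY tail1).
  rewrite lee_fin expRN -[leLHS]mul1r.
  have [_ E2] := @expR1_rough R.
  rewrite -(@ler_pM2r _ (expR 1)) ?expR_gt0// mulVf ?gt_eqF ?expR_gt0//.
  have := expR_gt0 (1 : R); lra.
move: lna0 h1 h2; rewrite cost_aE cost_kE.
move: (ln a) (Rintegral P setT (half_exp P Y 0)) (Rintegral P setT (fun t => `|Y t|)) (Rintegral P setT (fun t => f (Y t))).
by move=> x1 x2 x3 x4; lra.
Qed.
End tilted_slope.
End infconv.

(** * The one-dimensional inequality for all convex Lipschitz functions *)

Section infconv_normalized.
Context {d : measure_display} {T : measurableType d} {R : realType}.
Context (P : probability T R) (Y : T -> R) (mY : measurable_fun setT Y).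
Context (lcY : log_concave_tails P Y).
Context (symY : forall A : set R, measurable A -> P (Y @^-1` A) = P ((fun t => - Y t) @^-1` A)).

Local Notation tail := (tail P Y).
Local Notation nlt := (nlt P Y).
Local Notation cost := (cost P Y).
Local Notation cost_dom := (cost_dom P Y).

Context (tail1 : expR (- 1) <= tail 1) (tailq : tail (10 / 9) < expR (- 1)).

Lemma costN (z : R) : cost (- z) = cost z.
Proof. by rewrite /cost sqrrN normrN. Qed.

Lemma cost_domN (z : R) : cost_dom (- z) = cost_dom z.
Proof. by rewrite /cost_dom /= normrN. Qed.

Lemma cost0 : cost_dom 0 /\ cost 0 = 0.
Proof.
rewrite /cost_dom /cost /= normr0 mul0r tail_eq1// nlt0// sub0r expr0n /= mul0r mulr0 add0r.
by rewrite max_l ?mulr0// oppr_le0.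
Qed.

Lemma expR_le_quadratic_neg (y : R) : y <= 0 -> expR y <= 1 + y + y ^+ 2.
Proof.
move=> y0; have H := expR_ge1Dx (- y).
have d0 : 0 < 1 - y by lra.
have : expR y * (1 - y) <= 1.
  by apply: le_trans (ler_wpM2l (ltW (expR_gt0 y)) H) _; rewrite expRN divff ?gt_eqF ?expR_gt0.
have : 1 <= (1 + y + y ^+ 2) * (1 - y).
  rewrite (_ : (1 + y + y ^+ 2) * (1 - y) = 1 + y ^+ 2 * (- y)); last by ring.
  by rewrite lerDl mulr_ge0 ?sqr_ge0// oppr_ge0.
by move=> H1 /le_trans /(_ H1); rewrite ler_pM2r.
Qed.

Lemma ge0_le_fin (x : \bar R) (r : R) : (0 <= x)%E -> (x <= r%:E)%E -> exists a, x = a%:E.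
Proof. by case: x => [a| |]//; exists a. Qed.

Section slope.
Context (f G : R -> R) (L s : R) (f_lip : forall x y, `|f x - f y| <= L * `|x - y|).
Context (f0 : f 0 = 0) (f_slope : forall x, s * x <= f x) (s0 : 0 <= s).
Context (f_convex : forall x y a : R, 0 <= a <= 1 ->
  f (a * x + (1 - a) * y) <= a * f x + (1 - a) * f y).
Context (G_ge0 : forall x, 0 <= G x) (mG : measurable_fun setT G).
Context (G_le : forall x z : R, cost_dom z -> G x <= expR (f (x - z) + cost z)).

(** Where [f] is negative, zero displacement gives [G <= 1 + f + f ^+ 2] with
    [f ^+ 2 <= s ^+ 2 * Y ^+ 2], a loss of mean at most [6 * s ^+ 2]. On [|Y| >= 1] the truncated
    [f |Y|] is at least [s], because [s < 1/100]; so the surplus on the positive side is at least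
    [19 * (10 / 28) * s ^+ 2], which is larger. *)
Lemma infconv_small_slope : s < 1 / 100 ->
  (\int[P]_t (G (Y t))%:E <= (expR (\int[P]_t f (Y t)))%:E)%E.
Proof.
move=> s1.
have f_cont := lipschitz_continuous f_lip.
have mf : measurable_fun setT f by exact: continuous_measurable_fun.
have mZ : measurable_fun setT (fun t => `|Y t|) by exact: measurableT_comp.
have mNZ : measurable_fun setT (fun t => - `|Y t|) by exact: measurable_funN.
have ifZ : P.-integrable setT (EFin \o (fun t => f `|Y t|)).
  by apply: (integrable_lipschitz mY lcY tailq f_lip mZ) => t; rewrite normr_id.
have ifN : P.-integrable setT (EFin \o (fun t => f (- `|Y t|))).
  by apply: (integrable_lipschitz mY lcY tailq f_lip mNZ) => t; rewrite normrN normr_id.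
have f_ge0 x : 0 <= x -> 0 <= f x.
  by move=> x0; apply: le_trans (f_slope x); rewrite mulr_ge0.
have R1 : (\int[P]_t (G `|Y t|)%:E + 19%:E * \int[P]_t (Num.min (f `|Y t|) (1 / 100) ^+ 2)%:E <=
   1 + \int[P]_t (f `|Y t|)%:E)%E.
  apply: half_line_infconv => //; first by move=> x y a _ _; exact: f_convex.
  by move=> x z _; exact: G_le.
(* [w] and [n] are the positive and negative parts of [f] on the negative half-line. Where [f] is
   negative [G] is replaced by 1, which keeps [G2] admissible for [w]. *)
pose n (x : R) := Num.max (- f (- x)) 0.
pose w (x : R) := Num.max (f (- x)) 0.
pose G2 (x : R) := if 0 <= f (- x) then G (- x) else 1.
have mfN : measurable_fun setT (fun x : R => f (- x)).
  by apply: measurableT_comp => //; exact: measurable_funN.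
have mGN : measurable_fun setT (fun x : R => G (- x)).
  by apply: measurableT_comp => //; exact: measurable_funN.
have mn : measurable_fun setT n by apply: measurable_maxr => //; exact: measurable_funN.
have mw : measurable_fun setT w by exact: measurable_maxr.
have mG2 : measurable_fun setT G2.
  by apply: measurable_fun_ifT => //; exact: measurable_fun_ler.
have n0 x : 0 <= n x by rewrite le_max lexx orbT.
have w0 x : 0 <= w x by rewrite le_max lexx orbT.
have fw x : f (- x) <= w x by rewrite le_max lexx.
have wf x : w x = f (- x) + n x.
  rewrite /w /n; case: (leP (f (- x)) 0) => H.
    by rewrite max_l ?subrr// oppr_ge0.
  by rewrite max_r ?addr0// oppr_le0 ltW.
have G20 x : 0 <= G2 x by rewrite /G2; case: ifP.
have w_cont : continuous w.
  move=> x; apply: continuous_max; last exact: cst_continuous.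
  apply: continuous_comp; last exact: f_cont.
  exact: oppr_continuous.
have iw : P.-integrable setT (EFin \o (fun t => w `|Y t|)).
  apply: (@integrable_dominated _ _ _ _ _ (fun t => L * `|Y t|)).
  - exact: measurableT_comp.
  - exact: integrable_scale (integrable_abs mY lcY tailq).
  - move=> t; rewrite ger0_norm// ge_max.
    have := f_lip (- `|Y t|) 0; rewrite f0 !subr0 normrN normr_id => H.
    by rewrite (le_trans _ H) ?ler_norm//=; exact: le_trans (normr_ge0 _) H.
have R2 : (\int[P]_t (G2 `|Y t|)%:E + 19%:E * \int[P]_t (Num.min (w `|Y t|) (1 / 100) ^+ 2)%:E <=
   1 + \int[P]_t (w `|Y t|)%:E)%E.
  apply: half_line_infconv => //.
  - move=> x y a _ _ a01; have /andP[a0 a1] := a01.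
    have b0 : 0 <= 1 - a by rewrite subr_ge0.
    rewrite [w (_ + _)]/w ge_max; apply/andP; split.
      2: by apply: addr_ge0; apply: mulr_ge0.
    rewrite opprD -!mulrN; apply: le_trans (f_convex _ _ a01) _.
    by apply: lerD; rewrite ler_wpM2l.
  - by rewrite /w oppr0 f0 maxxx.
  - move=> x z _ dz; rewrite /G2; case: ifP => _; last first.
      by rewrite -expR0 ler_expR addr_ge0// cost_ge0.
    have := @G_le (- x) (- z); rewrite cost_domN costN => /(_ dz) /le_trans; apply.
    by rewrite ler_expR lerD2r -opprD fw.
have R2' : (\int[P]_t (G2 `|Y t|)%:E <= 1 + \int[P]_t (w `|Y t|)%:E)%E.
  apply: le_trans R2; rewrite leeDl// mule_ge0//.
  by apply: mean_ge0 => t; exact: sqr_ge0.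
have mGN' : measurable_fun setT (fun t => G (- `|Y t|)) by exact: measurableT_comp.
have mn' : measurable_fun setT (fun t => n `|Y t|) by exact: measurableT_comp.
have mG2' : measurable_fun setT (fun t => G2 `|Y t|) by exact: measurableT_comp.
have mY2 : measurable_fun setT (fun t => Y t ^+ 2) by exact: measurable_funX.
have sY0 t : 0 <= s ^+ 2 * Y t ^+ 2 by rewrite mulr_ge0 ?sqr_ge0.
have N1 : (\int[P]_t (G (- `|Y t|))%:E + \int[P]_t (n `|Y t|)%:E <=
    \int[P]_t (G2 `|Y t|)%:E + (s ^+ 2)%:E * \int[P]_t (Y t ^+ 2)%:E)%E.
  rewrite -mean_scale ?sqr_ge0//; last by move=> t; exact: sqr_ge0.
  have msY : measurable_fun setT (fun t => s ^+ 2 * Y t ^+ 2) by exact: measurable_funM.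
  rewrite -mean_add// -mean_add//; apply: mean_le => //.
  - by move=> t; rewrite addr_ge0.
  - exact: measurable_funD.
  - exact: measurable_funD.
  - move=> t; rewrite /G2 /n; case: (leP 0 (f (- `|Y t|))) => H.
      by rewrite max_r ?oppr_le0// addr0 lerDl.
    rewrite max_l ?oppr_ge0 ?(ltW H)//.
    have [d0 c0] := cost0; have := G_le (- `|Y t|) d0; rewrite c0 addr0 subr0.
    move/le_trans/(_ (expR_le_quadratic_neg (ltW H))) => H1.
    have : f (- `|Y t|) ^+ 2 <= s ^+ 2 * Y t ^+ 2.
      rewrite -[Y t ^+ 2]real_normK ?num_real// -exprMn -sqrrN ler_pXn2r// ?nnegrE ?oppr_ge0 ?(ltW H)//; last by rewrite mulr_ge0.
      by have := f_slope (- `|Y t|); rewrite mulrN lerNl.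
    lra.
have M1 : ((s ^+ 2 * (10 / 28))%:E <= \int[P]_t (Num.min (f `|Y t|) (1 / 100) ^+ 2)%:E)%E.
  have mA := measurable_tail_set mY 1.
  apply: (@le_trans _ _ (\int[P]_t (s ^+ 2 * \1_[set t | (1 <= `|Y t|)%R] t)%:E)%E).
    have i0 t : 0 <= \1_[set t | (1 <= `|Y t|)%R] t :> R by rewrite indicE; case: (_ \in _).
    have mi : measurable_fun setT (\1_[set t | (1 <= `|Y t|)%R] : T -> R) by exact: measurable_indic.
    rewrite mean_scale ?sqr_ge0// mean_indic// -tailE// EFinM lee_wpmul2l ?lee_fin ?sqr_ge0//.
    apply: le_trans tail1; rewrite expRN.
    have [_ E2] := @expR1_rough R; have E0 := expR_gt0 (1 : R).
    rewrite -(@ler_pM2r _ (expR 1))// mulVf ?gt_eqF//; lra.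
  apply: mean_le.
  - by move=> t; rewrite mulr_ge0 ?sqr_ge0// indicE; case: (_ \in _).
  - by apply: measurable_funM => //; exact: measurable_indic.
  - apply: measurable_funX; apply: measurable_minr => //.
    exact: measurableT_comp.
  - move=> t; rewrite indicE; have [H|H] := leP 1 `|Y t|; last first.
      rewrite memNset ?mulr0 ?sqr_ge0//=.
      by move=> H'; move: H; rewrite ltNge H'.
    rewrite mem_set// mulr1 ler_pXn2r// ?nnegrE//; last first.
      by rewrite le_min f_ge0//=; lra.
    rewrite le_min (ltW s1) andbT; apply: le_trans (f_slope _).
    by rewrite ler_peMr.
have Q : (\int[P]_t (Y t ^+ 2)%:E <= 6%:E)%E by exact: mean_sq_le.
have fv : (\int[P]_t (f `|Y t|)%:E)%E \is a fin_num by exact: integrable_fin_num.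
have wv : (\int[P]_t (w `|Y t|)%:E)%E \is a fin_num by exact: integrable_fin_num.
have nv : (\int[P]_t (n `|Y t|)%:E)%E \is a fin_num.
  rewrite ge0_fin_numE; last by apply: mean_ge0.
  apply: (@le_lt_trans _ _ (\int[P]_t (L * `|Y t|)%:E)%E).
    apply: mean_le => //; first exact: measurable_funM.
    move=> t; rewrite ge_max.
    have := f_lip (- `|Y t|) 0; rewrite f0 !subr0 normrN normr_id => H.
    rewrite (le_trans _ H) ?(le_trans (normr_ge0 _) H)//.
    by have := ler_norm (- f (- `|Y t|)); rewrite normrN.
  rewrite -ge0_fin_numE; last first.
    by apply: mean_ge0 => t; have := f_lip (Y t) 0; rewrite subr0; exact: le_trans.
  exact: (integrable_fin_num measurableT (integrable_scale L (integrable_abs mY lcY tailq))).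
have wE : (\int[P]_t (w `|Y t|)%:E = (\int[P]_t f (- `|Y t|))%:E + \int[P]_t (n `|Y t|)%:E)%E.
  rewrite Rintegral_EFin//.
  have inn : P.-integrable setT (EFin \o (fun t => n `|Y t|)).
    apply: integrable_real => //; under eq_integral do rewrite ger0_norm//.
    by rewrite -ge0_fin_numE//; exact: mean_ge0.
  have := integralD_EFin measurableT ifN inn; move=> <-.
  by apply: eq_integral => t _ /=; rewrite wf.
have S := mean_abs_split mY symY mG G_ge0.
have SR := Rmean_abs_split mY lcY symY tailq f_lip.
have FZ := Rintegral_EFin ifZ.
apply: (@le_trans _ _ (1 + (\int[P]_t f (Y t)))%:E); last by rewrite lee_fin expR_ge1Dx.
move: (Rintegral P setT (fun t => f (Y t))) (Rintegral P setT (fun t => f `|Y t|)) SR FZ => F F1 SR FZ.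
move: (Rintegral P setT (fun t => f (- `|Y t|))) SR wE => F2 SR wE.
have A0 : (0 <= \int[P]_t (G (Y t))%:E)%E by exact: mean_ge0.
have A1 : (0 <= \int[P]_t (G `|Y t|)%:E)%E by exact: mean_ge0.
have A2 : (0 <= \int[P]_t (G (- `|Y t|))%:E)%E by exact: mean_ge0.
have A3 : (0 <= \int[P]_t (G2 `|Y t|)%:E)%E by exact: mean_ge0.
have A4 : (0 <= \int[P]_t (Y t ^+ 2)%:E)%E by apply: mean_ge0 => t; exact: sqr_ge0.
have A5 : (0 <= \int[P]_t (Num.min (f `|Y t|) (1 / 100) ^+ 2)%:E)%E.
  by apply: mean_ge0 => t; exact: sqr_ge0.
have s20 := sqr_ge0 s.
move: A0 A1 A2 A3 A4 A5 S R1 R2' N1 M1 Q; rewrite wE -FZ -(fineK nv).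
move: (fine _) => nn.
set B0 := (\int[P]_t (G (Y t))%:E)%E; set B1 := (\int[P]_t (G `|Y t|)%:E)%E.
set B2 := (\int[P]_t (G (- `|Y t|))%:E)%E; set B3 := (\int[P]_t (G2 `|Y t|)%:E)%E.
set B4 := (\int[P]_t (Y t ^+ 2)%:E)%E.
set B5 := (\int[P]_t (Num.min (f `|Y t|) (1 / 100) ^+ 2)%:E)%E.
move: B0 B1 B2 B3 B4 B5 => B0 B1 B2 B3 B4 B5 A0 A1 A2 A3 A4 A5 S R1 R2' N1 M1 Q.
have [a4 E4] := ge0_le_fin A4 Q.
have B5' : (B5 <= 19%:E * B5)%E by rewrite lee_pemull// lee_fin; lra.
have [a5 E5] : exists a, B5 = a%:E.
  apply: (ge0_le_fin A5 (r := 1 + F1)); apply: le_trans B5' _.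
  by apply: le_trans R1; rewrite leeDr.
have [a1 E1] : exists a, B1 = a%:E.
  apply: (ge0_le_fin A1 (r := 1 + F1)); apply: le_trans R1.
  by rewrite leeDl// mule_ge0.
have [a3 E3] : exists a, B3 = a%:E by exact: (ge0_le_fin A3 R2').
have [a2 E2] : exists a, B2 = a%:E.
  apply: (ge0_le_fin A2 (r := a3 + s ^+ 2 * a4 - nn)).
  by rewrite EFinB leeBrDr// EFinD EFinM -E3 -E4.
move: S; rewrite E1 E2 -EFinD => S.
have [a0 E0] : exists a, B0 = a%:E.
  apply: (ge0_le_fin A0 (r := a1 + a2)); rewrite -S.
  by rewrite lee_pemull// lee_fin; lra.
move: S R1 R2' N1 M1 Q; rewrite E0 E1 E2 E3 E4 E5 -!EFinM -!EFinD !lee_fin => -[] S R1 R2' N1 M1 Q.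
have : s ^+ 2 * a4 <= s ^+ 2 * 6 by apply: ler_wpM2l.
lra.
Qed.

Lemma infconv_slope : (\int[P]_t (G (Y t))%:E <= (expR (\int[P]_t f (Y t)))%:E)%E.
Proof.
have [s1|s1] := leP (1 / 100) s; last exact: infconv_small_slope.
exact: (@infconv_large_slope _ _ _ P Y mY lcY symY tail1 tailq f G L s).
Qed.
End slope.

Lemma subgradient (f : R -> R) : (forall x y a : R, 0 <= a <= 1 ->
    f (a * x + (1 - a) * y) <= a * f x + (1 - a) * f y) ->
  exists s, forall x, f 0 + s * x <= f x.
Proof.
move=> f_convex.
pose S := [set q | exists2 h, 0 < h & q = (f 0 - f (- h)) / h].
have Sub h k : 0 < h -> 0 < k -> (f 0 - f (- h)) / h <= (f k - f 0) / k.
  move=> h0 k0; have hk : 0 < h + k by exact: addr_gt0.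
  rewrite ler_pdivrMr// mulrAC ler_pdivlMr//.
  have a01 : 0 <= k / (h + k) <= 1.
    apply/andP; split; first by rewrite divr_ge0 ?ltW.
    by rewrite ler_pdivrMr// mul1r lerDr ltW.
  have := f_convex (- h) k _ a01.
  have -> : k / (h + k) * - h + (1 - k / (h + k)) * k = 0 by field; rewrite gt_eqF.
  have -> : k / (h + k) * f (- h) + (1 - k / (h + k)) * f k = (k * f (- h) + h * f k) / (h + k).
    by field; rewrite gt_eqF.
  by rewrite ler_pdivlMr//; lra.
have S0 : S !=set0 by exists ((f 0 - f (- 1)) / 1), 1.
have ubS k : 0 < k -> ubound S ((f k - f 0) / k) by move=> k0 _ [h h0 ->]; exact: Sub.
have hS : has_sup S by split => //; exists ((f 1 - f 0) / 1); exact: ubS.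
exists (sup S) => x; have [x0|x0|->] := ltgtP x 0; last by rewrite mulr0 addr0.
  have xN : 0 < - x by rewrite oppr_gt0.
  have : (f 0 - f x) / (- x) <= sup S.
    by apply: sup_upper_bound => //; exists (- x); rewrite ?opprK.
  by rewrite ler_pdivrMr//; lra.
have : sup S <= (f x - f 0) / x by apply: sup_le_ub => //; exact: ubS.
by rewrite ler_pdivlMr//; lra.
Qed.

Lemma infconv_normalized (f G : R -> R) (L : R) :
  (forall x y, `|f x - f y| <= L * `|x - y|) ->
  (forall x y a : R, 0 <= a <= 1 -> f (a * x + (1 - a) * y) <= a * f x + (1 - a) * f y) ->
  (forall x, 0 <= G x) -> measurable_fun setT G ->
  (forall x z : R, cost_dom z -> G x <= expR (f (x - z) + cost z)) ->
  (\int[P]_t (G (Y t))%:E <= (expR (\int[P]_t f (Y t)))%:E)%E.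
Proof.
move=> f_lip f_convex G_ge0 mG G_le; have [s fs] := subgradient f_convex.
(* Reflecting [f] and [G] changes the sign of the slope but neither mean, since [Y] is symmetric. *)
wlog s0 : s f G f_lip f_convex G_ge0 mG G_le fs / 0 <= s.
  move=> main; have [s0|/ltW s0] := leP 0 s; first exact: (main s).
  have mGN : measurable_fun setT (fun x : R => G (- x)).
    by apply: measurableT_comp => //; exact: measurable_funN.
  have lipN (x y : R) : `|f (- x) - f (- y)| <= L * `|x - y|.
    by apply: le_trans (f_lip _ _) _; rewrite -opprB opprK addrC normrN -normrN opprB distrC.
  have H := main (- s) (fun x => f (- x)) (fun x => G (- x)).
  have {}H : (\int[P]_t (G (- Y t))%:E <= (expR (\int[P]_t f (- Y t)))%:E)%E.
    apply: H => //.
    - by move=> x y a a01; rewrite opprD -!mulrN; exact: f_convex.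
    - move=> x z dz; have := G_le (- x) (- z); rewrite cost_domN costN => /(_ dz).
      by rewrite -opprD.
    - by move=> x; have := fs (- x); rewrite oppr0 mulNr mulrN; lra.
    - by rewrite oppr_ge0.
  rewrite mean_oppr// in H.
  suff <- : \int[P]_t f (- Y t) = \int[P]_t f (Y t) by [].
  have E1 := Rmean_abs_split mY lcY symY tailq f_lip.
  have E2 := Rmean_abs_split mY lcY symY tailq lipN.
  have E3 : \int[P]_t f (- - `|Y t|) = \int[P]_t f `|Y t|.
    by apply: eq_Rintegral => t _; rewrite opprK.
  by rewrite E3 in E2; lra.
pose f' x := f x - f 0; pose G' x := expR (- f 0) * G x.
have f'lip x y : `|f' x - f' y| <= L * `|x - y|.
  by rewrite /f' (_ : _ - _ = f x - f y) ?f_lip//; ring.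
have f'0 : f' 0 = 0 by rewrite /f' subrr.
have f'slope x : s * x <= f' x by have := fs x; rewrite /f'; lra.
have f'conv (x y a : R) : 0 <= a <= 1 -> f' (a * x + (1 - a) * y) <= a * f' x + (1 - a) * f' y.
  by move=> /(f_convex x y); rewrite /f'; lra.
have G'0 x : 0 <= G' x by rewrite mulr_ge0 ?expR_ge0.
have mG' : measurable_fun setT G' by exact: measurable_funM.
have G'le (x z : R) : cost_dom z -> G' x <= expR (f' (x - z) + cost z).
  move=> /(G_le x) H; apply: le_trans (ler_wpM2l (expR_ge0 _) H) _.
  by rewrite -expRD ler_expR /f'; lra.
have := infconv_slope f'lip f'0 f'slope s0 f'conv G'0 mG' G'le.
have mGY : measurable_fun setT (fun t => G (Y t)) by exact: measurableT_comp.
rewrite /G' mean_scale ?expR_ge0// /f'.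
have ifY : P.-integrable setT (EFin \o (fun t => f (Y t))).
  by apply: (integrable_lipschitz mY lcY tailq f_lip mY) => t.
rewrite (RintegralB measurableT ifY (integrable_cst P (f 0))).
rewrite [X in _ - X]/Rintegral mean_cst [fine _]/= addrC expRD EFinM.
by rewrite lee_pmul2l// ?lte_fin ?expR_gt0.
Qed.

End infconv_normalized.

(** Three constraints meet here: [4 / tilt_c = cost_k], [cost_a * tilt_c ^+ 2] has to dominate the
    second moment of small tilts, and [tilt_c <= 6720 * sqrt 2 * e] is needed for the final
    constant. *)
HB.lock Definition tilt_c {R : realType} : R := 25 * 1000.

Lemma tilt_cE {R : realType} : tilt_c = 25 * 1000 :> R.
Proof. by rewrite tilt_c.unlock. Qed.

Lemma tilt_c_gt0 {R : realType} : 0 < tilt_c :> R.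
Proof. by rewrite tilt_cE; lra. Qed.

(** All that the n-dimensional argument uses about a coordinate, so that degenerate and rescaled
    coordinates are treated alike. [dom] is where the cost counts as finite. The last inequality of
    [tc_tilt] is multiplied by [z] to cover both signs: the tilted mean has the sign of [z], and
    [tilt_c] times its modulus is at least [|z|]. *)
Record transport_cost {d : measure_display} {T : measurableType d} {R : realType}
    (P : probability T R) (X : T -> R) (dom : set R) (phi : R -> R) : Prop := TransportCost {
  tc_dom0 : dom 0;
  tc_zero : phi 0 = 0;
  tc_ge0 : forall z, 0 <= phi z;
  tc_star : forall r z : R, 0 <= r <= 1 -> dom z -> dom (r * z) /\ phi (r * z) <= r * phi z;
  tc_integrable : P.-integrable setT (EFin \o X);
  tc_infconv : forall (f G : R -> R) (L : R),
    (forall x y, `|f x - f y| <= L * `|x - y|) ->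
    (forall x y a : R, 0 <= a <= 1 -> f (a * x + (1 - a) * y) <= a * f x + (1 - a) * f y) ->
    (forall x, 0 <= G x) -> measurable_fun setT G ->
    (forall x z : R, dom z -> G x <= expR (f (x - z) + phi z)) ->
    (\int[P]_t (G (X t))%:E <= (expR (\int[P]_t f (X t)))%:E)%E;
  tc_tilt : forall z : R, dom z -> exists h : R -> R, exists M : R,
    [/\ measurable_fun setT h, forall x, 0 <= h x <= M,
        (\int[P]_t (h (X t))%:E = 1)%E, (\int[P]_t (h (X t) ^+ 2)%:E <= (expR (phi z))%:E)%E &
        z * z <= z * (tilt_c * \int[P]_t (h (X t) * X t))] }.

(** * Tilted densities in dimension one *)

Section normalized_cost.
Context {d : measure_display} {T : measurableType d} {R : realType}.
Context (P : probability T R) (Y : T -> R) (mY : measurable_fun setT Y).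
Context (lcY : log_concave_tails P Y).
Context (symY : forall A : set R, measurable A -> P (Y @^-1` A) = P ((fun t => - Y t) @^-1` A)).

Local Notation tail := (tail P Y).
Local Notation nlt := (nlt P Y).
Local Notation cost := (cost P Y).
Local Notation cost_dom := (cost_dom P Y).

Lemma cost_star (r z : R) : 0 <= r <= 1 -> cost_dom z ->
  cost_dom (r * z) /\ cost (r * z) <= r * cost z.
Proof.
move=> r01 dz; have /andP[r0 r1] := r01.
have rzE : `|r * z| = r * `|z| by rewrite normrM ger0_norm.
have rz4 : `|r * z| / 4 = r * (`|z| / 4) by rewrite rzE mulrA.
have z4 : 0 <= `|z| / 4 by rewrite divr_ge0.
split.
  apply: (tail_gt0_le mY _ dz); rewrite rz4.
  by rewrite ler_piMl.
rewrite /cost mulrDr; apply: lerD; rewrite [leRHS]mulrCA.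
  rewrite ler_wpM2l ?(ltW cost_a_gt0)// rzE.
  have d1 : 0 < 1 + `|z| by rewrite ltr_wpDr.
  have d2 : 0 < 1 + r * `|z| by rewrite ltr_wpDr// mulr_ge0.
  rewrite [leRHS]mulrA ler_pdivrMr// [leRHS]mulrAC ler_pdivlMr//.
  have : 0 <= (1 - r) * (r * z ^+ 2).
    by apply: mulr_ge0; rewrite ?subr_ge0// mulr_ge0 ?sqr_ge0.
  rewrite exprMn; lra.
rewrite ler_wpM2l ?(ltW cost_k_gt0)// ge_max mulr_ge0 ?le_max ?lexx//= rz4.
have := nlt_star mY lcY r01 z4 dz; set N := nlt (`|z| / 4).
have : N - 1 <= Num.max 0 (N - 1) by rewrite le_max lexx orbT.
by move=> /(ler_wpM2l r0); lra.
Qed.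

Context (tail1 : expR (- 1) <= tail 1) (tailq : tail (10 / 9) < expR (- 1)).

Section one_sided.
Context (sg t : R) (sgE : sg = 1 \/ sg = - 1) (t0 : 0 < t).

Definition one_sided : set R := [set x | t <= sg * x].

Lemma measurable_one_sided : measurable one_sided.
Proof. by apply: (measurable_ge_set (u := fun x => sg * x)); exact: measurable_funM. Qed.

Lemma prob_one_sided : P (Y @^-1` one_sided) = (tail t / 2)%:E.
Proof.
have mS (b : R) : measurable [set x : R | t <= b * x].
  by apply: (measurable_ge_set (u := fun x => b * x)); exact: measurable_funM.
have mYS (b : R) : measurable (Y @^-1` [set x : R | t <= b * x]).
  by rewrite -[X in measurable X]setTI; exact: mY.
have E1 : P (Y @^-1` [set x : R | t <= 1 * x]) = P (Y @^-1` [set x : R | t <= - 1 * x]).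
  rewrite symY//; congr (P _); apply/seteqP; split => w /=; by rewrite mul1r mulN1r.
have E2 : (tail t)%:E = (P (Y @^-1` [set x | (t <= 1 * x)%R]) + P (Y @^-1` [set x | (t <= - 1 * x)%R]))%E.
  rewrite tailE// -measureU//.
    congr (P _); apply/seteqP; split => w /=; rewrite mul1r mulN1r.
      by case: (ger0P (Y w)) => _; [left|right].
    case=> [|] H; first by apply: le_trans H _; exact: ler_norm.
    by apply: le_trans H _; rewrite -normrN; exact: ler_norm.
  apply/seteqP; split => // w /= [h1 h2]; clear E1; exfalso; have := t0; lra.
have E3 : P (Y @^-1` one_sided) = P (Y @^-1` [set x | (t <= 1 * x)%R]).
  by rewrite /one_sided; case: sgE => ->.
move: E2; rewrite -E1 -E3.
have <- := @prob_fin _ _ _ P (Y @^-1` one_sided).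
  by rewrite -EFinD => -[->]; congr EFin; field.
by rewrite -[X in measurable X]setTI; exact: mY _ measurable_one_sided.
Qed.

Context (tt : 0 < tail t) (b : R) (b01 : 0 <= b <= 1).

(** The density of a mixture: weight [1 - b] on the law of [Y], weight [b] on that law conditioned
    to [one_sided], whose probability is [tail t / 2] by symmetry. As [Y] is centred, only the
    conditioned part contributes to the mean, at least [b * t] in the direction [sg]. *)
Definition tilt (x : R) : R := (1 - b) + b / (tail t / 2) * \1_one_sided x.

Lemma tilt_correct : exists h : R -> R, exists M : R,
    [/\ measurable_fun setT h, forall x, 0 <= h x <= M,
        (\int[P]_w (h (Y w))%:E = 1)%E,
        (\int[P]_w (h (Y w) ^+ 2)%:E = (1 - b ^+ 2 + b ^+ 2 * (2 / tail t))%:E)%E &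
        b * t <= sg * \int[P]_w (h (Y w) * Y w)].
Proof.
have /andP[b0 b1] := b01; have b1' : 0 <= 1 - b by rewrite subr_ge0.
set p := tail t / 2; have p0 : 0 < p by rewrite divr_gt0.
have c0 : 0 <= b / p by rewrite divr_ge0// ltW.
have mO := measurable_one_sided.
have i01 (x : R) : 0 <= (\1_one_sided x : R) <= 1.
  by rewrite indicE; case: (_ \in _); apply/andP; split; rewrite /=; lra.
have mI : measurable_fun setT (fun w => \1_one_sided (Y w) : R).
  have mi : measurable_fun setT (\1_one_sided : R -> R) by exact: measurable_indic.
  exact: (measurableT_comp mi mY).
have I0 w : 0 <= \1_one_sided (Y w) :> R by have /andP[] := i01 (Y w).
have EI : (\int[P]_w (\1_one_sided (Y w))%:E = p%:E)%E.
  rewrite -prob_one_sided -mean_indic//.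
  by rewrite -[X in measurable X]setTI; exact: mY _ mO.
exists tilt, (1 - b + b / p); split.
- apply: measurable_funD => //; apply: measurable_funM => //; exact: measurable_indic.
- move=> x; have /andP[x0 x1] := i01 x; rewrite /tilt -/p addr_ge0//=; last exact: mulr_ge0.
  by rewrite lerD2l ler_piMr.
- rewrite /tilt -/p mean_add//.
  + by rewrite mean_cst mean_scale// EI -EFinM -EFinD divfK ?gt_eqF// subrK.
  + by move=> w; rewrite mulr_ge0.
  + exact: measurable_funM.
- have E w : tilt (Y w) ^+ 2 = (1 - b) ^+ 2 + (2 * (1 - b) * (b / p) + (b / p) ^+ 2) * \1_one_sided (Y w).
    rewrite /tilt -/p; have : \1_one_sided (Y w) ^+ 2 = \1_one_sided (Y w) :> R.
      by rewrite indicE; case: (_ \in _); rewrite ?expr1n ?expr0n.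
    set i := \1_one_sided (Y w) => iE; set q := b / p.
    have -> : (1 - b + q * i) ^+ 2 = (1 - b) ^+ 2 + 2 * (1 - b) * q * i + q ^+ 2 * i ^+ 2 by ring.
    by rewrite iE; ring.
  under eq_integral do rewrite E.
  have k0 : 0 <= 2 * (1 - b) * (b / p) + (b / p) ^+ 2 by apply: addr_ge0; rewrite ?sqr_ge0//; do 2 (apply: mulr_ge0 => //).
  rewrite mean_add//.
  + rewrite mean_cst mean_scale// EI -EFinM -EFinD; congr EFin.
    by rewrite /p; field; rewrite gt_eqF.
  + by move=> _; exact: sqr_ge0.
  + by move=> w; rewrite mulr_ge0.
  + exact: measurable_funM.
- have iY : P.-integrable setT (EFin \o Y).
    by apply: (integrable_dominated mY (integrable_abs mY lcY tailq)).
  have mtilt : measurable_fun setT tilt.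
    apply: measurable_funD => //; apply: measurable_funM => //; exact: measurable_indic.
  have ihY : P.-integrable setT (EFin \o (fun w => tilt (Y w) * Y w)).
    apply: (@integrable_dominated _ _ _ _ _ (fun w => (1 - b + b / p) * `|Y w|)).
    + by apply: measurable_funM => //; exact: measurableT_comp.
    + exact: integrable_scale (integrable_abs mY lcY tailq).
    + move=> w; rewrite normrM ler_wpM2r//.
      have /andP[x0 x1] := i01 (Y w); rewrite ger0_norm /tilt -/p; last by rewrite addr_ge0//; exact: mulr_ge0.
      by rewrite lerD2l ler_piMr.
  have EY : \int[P]_w Y w = 0.
    have lip (x y : R) : `|x - y| <= 1 * `|x - y| by rewrite mul1r.
    have := Rmean_abs_split mY lcY symY tailq (f := id) lip; rewrite /=.
    have -> : \int[P]_w (- `|Y w|) = - \int[P]_w `|Y w|.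
      have -> : \int[P]_w (- `|Y w|) = \int[P]_w (-1 * `|Y w|).
        by apply: eq_Rintegral => w _; rewrite mulN1r.
      by rewrite RintegralZl ?mulN1r//; exact: integrable_abs.
    lra.
  have iI : P.-integrable setT (EFin \o (fun w => \1_one_sided (Y w) : R)).
    apply: integrable_real => //; under eq_integral do rewrite ger0_norm//.
    by rewrite EI ltry.
  have EI' : \int[P]_w \1_one_sided (Y w) = p by rewrite /Rintegral EI.
  have := @le_Rintegral _ _ _ P setT (fun w => (1 - b) * sg * Y w + b / p * t * \1_one_sided (Y w))
     (fun w => sg * (tilt (Y w) * Y w)) measurableT
     (integrable_add (integrable_scale _ iY) (integrable_scale _ iI)) (integrable_scale sg ihY).
  rewrite RintegralD//; [|exact: integrable_scale|exact: integrable_scale].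
  rewrite !RintegralZl// EY EI' mulr0 add0r (_ : b / p * t * p = b * t); last first.
    by rewrite /p; field; rewrite gt_eqF.
  apply=> w _; rewrite /tilt -/p indicE; case: (boolP (Y w \in one_sided)) => H.
    move: H; rewrite inE /one_sided /= !mulr1 => H.
    have := ler_wpM2l c0 H; lra.
  by rewrite !mulr0 !addr0; lra.
Qed.
End one_sided.

(** For moderate [z] the level is [t = 1] and the weight [b] is proportional to [|z|], so the second
    moment is [1 + O(z ^+ 2)], paid by the quadratic term. For large [z] one conditions fully at
    level [|z| / tilt_c]: star-shapedness bounds [nlt] there by [cost_k * nlt (|z| / 4)], and the
    remaining factor [2 <= e] is paid by the linear growth of the first term. *)
Lemma cost_tilt (z : R) : cost_dom z -> exists h : R -> R, exists M : R,
    [/\ measurable_fun setT h, forall x, 0 <= h x <= M,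
        (\int[P]_t (h (Y t))%:E = 1)%E, (\int[P]_t (h (Y t) ^+ 2)%:E <= (expR (cost z))%:E)%E &
        z * z <= z * (tilt_c * \int[P]_t (h (Y t) * Y t))].
Proof.
move=> dz; pose sg : R := if 0 <= z then 1 else - 1.
have sgE : sg = 1 \/ sg = - 1 by rewrite /sg; case: ifP; [left|right].
have zsg : z = sg * `|z|.
  by rewrite /sg; case: (ger0P z) => ?; rewrite ?mul1r// mulN1r opprK.
have sg2 : sg * sg = 1 by case: sgE => ->; rewrite ?mulr1// mulrNN mulr1.
have C0 := @tilt_c_gt0 R.
have a0 : 0 <= `|z| := normr_ge0 z.
suff [t [b [t0 tt b01 H bt]]] : exists t b, [/\ 0 < t, 0 < tail t, 0 <= b <= 1,
    1 - b ^+ 2 + b ^+ 2 * (2 / tail t) <= expR (cost z) & `|z| <= tilt_c * (b * t)].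
  have [h [M [mh hM h1 h2 hY]]] := tilt_correct sgE t0 tt b01.
  exists h, M; split => //; first by rewrite h2 lee_fin.
  have := ler_wpM2l (ltW C0) hY => /(le_trans bt) /(ler_wpM2l a0).
  have -> : z * z = `|z| * `|z| by rewrite {1 2}zsg mulrACA sg2 mul1r.
  set I := Rintegral _ _ _.
  have -> : z * (tilt_c * I) = `|z| * (tilt_c * (sg * I)) by rewrite {1}zsg; ring.
  exact.
have t1 : 0 < tail 1 by apply: lt_le_trans tail1; exact: expR_gt0.
have [E1 E2] := @expR1_rough R.
have d1 : 0 < 1 + `|z| by rewrite ltr_wpDr.
have [zs|zl] := leP `|z| (tilt_c / 2).
  exists 1, (`|z| / tilt_c); split => //.
  - rewrite divr_ge0 ?(ltW C0)//= ler_pdivrMr// mul1r; lra.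
  - have q1 : (tail 1)^-1 <= 28 / 10.
      apply: le_trans E2; rewrite -[leRHS]invrK lef_pV2 ?posrE ?invr_gt0 ?expR_gt0//.
      by rewrite -expRN.
    set b := `|z| / tilt_c; have b2 : 0 <= b ^+ 2 by exact: sqr_ge0.
    apply: (@le_trans _ _ (1 + b ^+ 2 * (46 / 10))).
      by have := ler_wpM2l b2 q1; lra.
    apply: le_trans (expR_ge1Dx _); rewrite lerD2l.
    apply: (@le_trans _ _ (cost_a * (z ^+ 2 / (1 + `|z|)))); last first.
      by rewrite lerDl mulr_ge0 ?(ltW cost_k_gt0)// le_max lexx.
    have C2 : 0 < tilt_c ^+ 2 :> R by rewrite exprn_gt0.
    (* Here [46/10 = 2 * (28/10) - 1]. At the extreme [|z| = 12500] the two sides are 57504.6 and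
       62500. *)
    have K : 46 / 10 * (1 + `|z|) <= cost_a * tilt_c ^+ 2.
      by move: zs; rewrite tilt_cE cost_aE => zs; lra.
    have -> : b ^+ 2 * (46 / 10) = z ^+ 2 * (46 / 10 / tilt_c ^+ 2).
      by rewrite /b expr_div_n -[z ^+ 2]real_normK ?num_real//; ring.
    have -> : cost_a * (z ^+ 2 / (1 + `|z|)) = z ^+ 2 * (cost_a / (1 + `|z|)) by ring.
    by rewrite ler_wpM2l ?sqr_ge0// ler_pdivrMr// mulrAC ler_pdivlMr.
  - by rewrite mulr1 mulrCA divff ?mulr1// gt_eqF.
pose t := `|z| / tilt_c.
have tE : t = (4 / tilt_c) * (`|z| / 4) by rewrite /t; field; rewrite gt_eqF.
have r01 : 0 <= 4 / (tilt_c : R) <= 1.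
  apply/andP; split; first by rewrite divr_ge0// ltW.
  by rewrite ler_pdivrMr// mul1r tilt_cE; lra.
have z4 : 0 <= `|z| / 4 by rewrite divr_ge0.
have t4 : t <= `|z| / 4 by rewrite tE ler_piMl//; case/andP: r01.
have tt : 0 < tail t by exact: tail_gt0_le t4 dz.
have zp : 0 < `|z| by apply: lt_trans zl; rewrite divr_gt0.
exists t, 1; split => //.
- exact: divr_gt0.
- by rewrite ler01 lexx.
- rewrite expr1n subrr add0r mul1r -(expR_nlt tt) expRN invrK.
  apply: (@le_trans _ _ (expR (1 + nlt t))).
    by rewrite expRD ler_wpM2r ?expR_ge0//; lra.
  rewrite ler_expR.
  have := nlt_star mY lcY r01 z4 dz; rewrite -tE => Nt.
  set N4 := nlt (`|z| / 4) in Nt *.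
  have k4 : 4 / tilt_c = cost_k :> R by rewrite tilt_cE cost_kE; field.
  rewrite k4 in Nt.
  have q1 : `|z| - 1 <= z ^+ 2 / (1 + `|z|).
    by rewrite ler_pdivlMr// -[z ^+ 2]real_normK ?num_real// expr2; lra.
  have q2 := ler_wpM2l (ltW (@cost_a_gt0 R)) q1.
  have q3 : N4 - 1 <= Num.max 0 (N4 - 1) by rewrite le_max lexx orbT.
  have q4 := ler_wpM2l (ltW (@cost_k_gt0 R)) q3.
  rewrite /cost -/N4; apply: (@le_trans _ _ (cost_a * (`|z| - 1) + cost_k * (N4 - 1))); last exact: lerD.
  move: zl Nt; rewrite tilt_cE cost_aE cost_kE; lra.
- by rewrite mul1r mulrCA divff ?mulr1// gt_eqF.
Qed.
End normalized_cost.

(** * A transport cost for every symmetric variable with log-concave tails *)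

Section existence.
Context {d : measure_display} {T : measurableType d} {R : realType}.
Context (P : probability T R).

Lemma transport_cost_normalized (Y : T -> R) : measurable_fun setT Y ->
  log_concave_tails P Y ->
  (forall A : set R, measurable A -> P (Y @^-1` A) = P ((fun t => - Y t) @^-1` A)) ->
  expR (- 1) <= tail P Y 1 -> tail P Y (10 / 9) < expR (- 1) ->
  transport_cost P Y (cost_dom P Y) (cost P Y).
Proof.
move=> mY lcY symY t1 tq; have [d0 c0] := cost0 P mY; split => //.
- exact: cost_ge0.
- exact: cost_star.
- apply: (integrable_dominated mY (integrable_abs mY lcY tq)) => t //.
- exact: infconv_normalized.
- exact: cost_tilt.
Qed.

Lemma transport_cost_scale (Y : T -> R) (dom : set R) (phi : R -> R) (u : R) :
  measurable_fun setT Y -> 0 < u -> transport_cost P Y dom phi ->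
  transport_cost P (fun t => u * Y t) (fun z => dom (z / u)) (fun z => phi (z / u)).
Proof.
move=> mY u0 H; have un : u != 0 by rewrite gt_eqF.
split.
- by rewrite mul0r; exact: tc_dom0 H.
- by rewrite mul0r; exact: tc_zero H.
- by move=> z; exact: tc_ge0 H _.
- by move=> r z r01 dz; rewrite -mulrA; exact: tc_star H _ _ r01 dz.
- exact: integrable_scale (tc_integrable H).
- move=> f G L f_lip f_convex G_ge0 mG G_le.
  apply: (@tc_infconv _ _ _ _ _ _ _ H (fun y => f (u * y)) (fun y => G (u * y)) (L * u)).
  + by move=> x y; apply: le_trans (f_lip _ _) _; rewrite -mulrBr normrM (ger0_norm (ltW u0)) mulrA.
  + move=> x y a a01; rewrite (_ : u * _ = a * (u * x) + (1 - a) * (u * y)); first exact: f_convex.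
    by ring.
  + by [].
  + by apply: measurableT_comp => //; exact: measurable_funM.
  + move=> x z dz; have := G_le (u * x) (u * z).
    by rewrite [u * z / u]mulrAC divff// mul1r -mulrBr; exact.
- move=> z dz; have [h [M [mh hM h1 h2 hY]]] := tc_tilt H dz.
  have uK (x : R) : u * x / u = x by rewrite mulrAC divff// mul1r.
  exists (fun x => h (x / u)), M; split => //.
  + by apply: measurableT_comp => //; exact: measurable_funM.
  + by rewrite -h1; apply: eq_integral => t _; rewrite uK.
  + by apply: le_trans h2; rewrite le_eqVlt; apply/orP; left; apply/eqP; apply: eq_integral => t _; rewrite uK.
  + have -> : \int[P]_t (h (u * Y t / u) * (u * Y t)) = u * \int[P]_t (h (Y t) * Y t).
      rewrite -RintegralZl//; first by apply: eq_Rintegral => t _; rewrite uK mulrCA.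
      have iY := integrable_abse (tc_integrable H).
      apply: (@integrable_dominated _ _ _ _ _ (fun t => M * `|Y t|)).
      * by apply: measurable_funM => //; exact: measurableT_comp.
      * exact: integrable_scale iY.
      * move=> t; have /andP[p0 p1] := hM (Y t).
        by rewrite normrM (ger0_norm p0) ler_wpM2r.
    have zE : z = u * (z / u) by rewrite mulrCA divff ?mulr1.
    move: hY; set I := Rintegral _ _ _ => hY.
    have := ler_wpM2l (sqr_ge0 u) hY.
    have -> : u ^+ 2 * (z / u * (z / u)) = z * z by field.
    by have -> : u ^+ 2 * (z / u * (tilt_c * I)) = z * (tilt_c * (u * I)) by field.
Qed.

Section exists_cost.
Context (X : T -> R) (mX : measurable_fun setT X) (lcX : log_concave_tails P X).
Context (symX : forall A : set R, measurable A -> P (X @^-1` A) = P ((fun t => - X t) @^-1` A)).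

Lemma transport_cost_degenerate : (forall t, 0 < t -> tail P X t = 0) ->
  transport_cost P X [set 0] (fun=> 0).
Proof.
move=> t0; have mZ : measurable_fun setT (fun w => `|X w|) by exact: measurableT_comp.
have X0 : P [set w | 0 < `|X w|] = 0%E.
  apply/eqP; rewrite eq_le measure_ge0 andbT.
  apply: (@upper_set_prob_le _ _ _ P (fun w => `|X w|) [set x : R | 0 < x]) => //.
  - by move=> x y /= x0 xy; exact: lt_le_trans xy.
  - by exists 0 => x /= /ltW.
  - by move=> b /= b0; rewrite -tailE// t0.
have ae0 : {ae P, forall w, X w = 0}.
  exists [set w | 0 < `|X w|]; split => //; first exact: measurable_gt_set.
  by move=> w /= H; rewrite normr_gt0; apply/eqP.
have iE (u : R -> R) : measurable_fun setT u -> (\int[P]_w (u (X w))%:E = (u 0)%:E)%E.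
  move=> mu; rewrite -[RHS](mean_cst P); apply: ae_eq_integral => //.
  - by apply/measurable_EFinP; exact: measurableT_comp.
  - by case: ae0 => N [mN PN NP]; exists N; split => // w /= H; apply: NP => /= E; apply: H => _; rewrite E.
split => //.
- by move=> r z _ ->; rewrite !mulr0.
- apply: integrable_real => //.
  by rewrite (iE (fun x => `|x|)) ?normr0 ?ltry//; exact: measurable_normr.
- move=> f G L f_lip f_convex G_ge0 mG G_le.
  have mf : measurable_fun setT f.
    by apply: continuous_measurable_fun; exact: lipschitz_continuous f_lip.
  rewrite iE// /Rintegral iE//= lee_fin.
  by have := G_le 0 0 erefl; rewrite subr0 addr0.
- move=> z ->; exists (fun=> 1), 1; split => //.
  + by move=> x; rewrite ler01 lexx.
  + by rewrite mean_cst.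
  + by rewrite expr1n mean_cst expR0.
  + by rewrite !mul0r.
Qed.

Lemma tail_cvg0 (e : R) : 0 < e -> exists t, tail P X t < e.
Proof.
move=> e0; have mZ : measurable_fun setT (fun w => `|X w|) by exact: measurableT_comp.
pose Z : {RV P >-> R} := mfun_Sub (mem_set mZ).
have /fine_cvgP[_ /cvgrPdist_lt/(_ _ e0)] := cvg_ccdfy0 Z.
case=> M [_ HM]; exists (M + 2).
have := HM (M + 1) _; rewrite ltrDl ltr01 => /(_ erefl).
rewrite /= sub0r normrN => /(le_lt_trans (ler_norm _)); apply: le_lt_trans.
have -> : ccdf Z (M + 1) = P [set w | (M + 1 < `|X w|)%R].
  by rewrite /ccdf /distribution /pushforward; congr (P _); apply/seteqP; split => w /=;
    rewrite in_itv /= andbT.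
have m1 := measurable_tail_set mX (M + 2); have m2 := measurable_gt_set (M + 1) mZ.
rewrite /tail fine_le ?fin_num_measure// le_measure ?inE//.
by move=> w /= H; apply: lt_le_trans H; rewrite ltrD2l; lra.
Qed.

Lemma tail_scale (u t : R) : 0 < u -> tail P (fun w => u^-1 * X w) t = tail P X (u * t).
Proof.
move=> u0; rewrite /tail; congr (fine (P _)); apply/seteqP; split => w /=;
by rewrite normrM ger0_norm ?invr_ge0 ?(ltW u0)// ler_pdivlMl.
Qed.

(** The unit of length is chosen close to the largest [t] with [tail t >= 1/e]. Taking it within a
    tenth of the supremum, instead of at it, is the origin of 10/9. *)
Lemma transport_cost_exists : exists dom phi, transport_cost P X dom phi.
Proof.
pose e1 : R := expR (- 1).
have e10 : 0 < e1 by exact: expR_gt0.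
have [[t [t0 tt]]|nt] := pselect (exists t, 0 < t /\ e1 <= tail P X t); last first.
  exists [set 0], (fun=> 0); apply: transport_cost_degenerate => t t0.
  apply/eqP; rewrite eq_le tail_ge0 andbT leNgt; apply/negP => tt; apply: nt.
  (* If the tail is positive at [t], star-shapedness gives [nlt (t / n) <= nlt t / n <= 1], hence a
     positive point with tail at least 1/e, a contradiction. *)
  pose n := Num.bound (nlt P X t).
  have nt : nlt P X t < n%:R := archi_boundP (nlt_ge0 P mX t).
  have n0 : 0 < n%:R :> R by apply: le_lt_trans nt; exact: nlt_ge0.
  have r01 : 0 <= (n%:R^-1 : R) <= 1.
    rewrite invr_ge0 ler0n /= invf_le1// ler1n lt0n.
    by apply/eqP => n00; move: n0; rewrite n00 ltxx.
  have tn : 0 < tail P X (n%:R^-1 * t).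
    by apply: (tail_gt0_le mX _ tt); rewrite ler_piMl ?(ltW t0)//; case/andP: r01.
  exists (n%:R^-1 * t); split; first by rewrite mulr_gt0// invr_gt0.
  rewrite -(expR_nlt tn) ler_expR lerN2.
  apply: le_trans (nlt_star mX lcX r01 (ltW t0) tt) _.
  by rewrite ler_pdivrMl// mulr1 ltW.
pose S := [set t | e1 <= tail P X t].
have [b tb] := tail_cvg0 e10.
have hS : has_sup S.
  split; first by exists t.
  exists b => x /= Sx; rewrite leNgt; apply/negP => /ltW bx.
  by have := lt_le_trans (le_lt_trans (tail_le P mX bx) tb) Sx; rewrite ltxx.
have S0 : 0 < sup S by apply: lt_le_trans t0 _; exact: sup_upper_bound.
(* [u > 9/10 * sup S], so [u * (10 / 9)] lies beyond the supremum. *)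
have [|u Su uS] := @sup_adherent _ S (sup S / 10) _ hS; first by rewrite divr_gt0.
have u0 : 0 < u by apply: lt_trans uS; lra.
have uq : tail P X (u * (10 / 9)) < e1.
  rewrite ltNge; apply/negP => H; have : u * (10 / 9) <= sup S by exact: sup_upper_bound.
  by move: uS; lra.
pose Y w := u^-1 * X w.
have mY : measurable_fun setT Y by exact: measurable_funM.
have XE : X = (fun w => u * Y w) by apply/funext => w; rewrite /Y mulrA divff ?mul1r// gt_eqF.
have HY : transport_cost P Y (cost_dom P Y) (cost P Y).
  apply: transport_cost_normalized => //.
  - move=> s s' a s0 s'0 a01; have us := mulr_ge0 (ltW u0) s0; have us' := mulr_ge0 (ltW u0) s'0.
    have N r : neg_log_tail P Y r = neg_log_tail P X (u * r).
      rewrite /neg_log_tail; congr (- lne (P _))%E; apply/seteqP; split => w /=;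
      by rewrite normrM ger0_norm ?invr_ge0 ?(ltW u0)// ler_pdivlMl.
    rewrite !N; have := lcX us us' a01; congr (_ <= _)%E; congr (neg_log_tail _ _ _); ring.
  - move=> A mA; pose B := (fun x : R => u^-1 * x) @^-1` A.
    have mB : measurable B.
      rewrite -[X in measurable X]setTI; suff : measurable_fun setT (fun x : R => u^-1 * x) by exact.
      exact: measurable_funM.
    have := symX mB; rewrite (_ : X @^-1` B = Y @^-1` A)// => ->.
    by congr (P _); apply/seteqP; split => w; rewrite /preimage /= /B /= mulrN.
  - by rewrite tail_scale// mulr1.
  - by rewrite tail_scale.
rewrite XE; do 2 eexists; exact: transport_cost_scale mY u0 HY.
Qed.
End exists_cost.
End existence.

(** * Independence as invariance under resampling one coordinate *)

Section resampling.
Context {d : measure_display} {T : measurableType d} {R : realType} {n : nat}.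
Context (P : probability T R) (X : {RV P >-> n.-tuple R}).
Context (indepX : mutually_independent P (coordinate X)).

Definition upd (x : 'I_n -> R) (i : 'I_n) (a : R) : 'I_n -> R :=
  fun j => if j == i then a else x j.

Lemma measurable_coordinate i : measurable_fun setT (coordinate X i).
Proof. exact: measurableT_comp (measurable_tnth i) (measurable_funP X). Qed.

Definition box (A : 'I_n -> set R) : set (n.-tuple R) := [set x | forall i, A i (tnth x i)].

Lemma measurable_box A : (forall i, measurable (A i)) -> measurable (box A).
Proof.
move=> mA; rewrite (_ : box A = \bigcap_(i in [set: 'I_n]) ((@tnth n R)^~ i @^-1` A i)).
  apply: fin_bigcap_measurable => // i _; rewrite -[X in measurable X]setTI.
  exact: measurable_tnth.
by apply/seteqP; split => x /= H i; [move=> _; exact: H|exact: H].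
Qed.

Lemma prob_box (A : 'I_n -> set R) : (forall i, measurable (A i)) ->
  P (X @^-1` box A) = (\prod_i P (coordinate X i @^-1` A i))%E.
Proof.
move=> mA; have := indepX [set: 'I_n]%SET mA.
rewrite (_ : X @^-1` box A = \bigcap_(i in [set` [set: 'I_n]%SET]) (coordinate X i @^-1` A i)).
  by move=> ->; apply: eq_bigl => i; rewrite finset.in_setT.
by apply/seteqP; split => w /= H i; [move=> _; exact: H|apply: H; rewrite /= finset.in_setT].
Qed.

Lemma tuple_measure_unique (m1 m2 : {measure set (n.-tuple R) -> \bar R}) :
  (forall A, (forall i, measurable (A i)) -> m1 (box A) = m2 (box A)) ->
  (m1 setT < +oo)%E ->
  forall E, measurable E -> m1 E = m2 E.
Proof.
move=> m12 m1T E mE.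
pose G := [set B | exists2 A, (forall i, measurable (A i)) & B = box A].
apply: (@g_sigma_algebra_measure_unique _ _ _ G _ (fun=> setT)) => //.
- by move=> B [A mA ->]; exact: measurable_box.
- by move=> _; exists (fun=> setT) => //; apply/seteqP; split.
- by apply/seteqP; split => // x _; exists 0%N.
- move=> B1 B2 [A1 mA1 ->] [A2 mA2 ->]; exists (fun i => A1 i `&` A2 i).
    by move=> i; exact: measurableI.
  by apply/seteqP; split => x /= => [[H1 H2] i|H]; [split; [exact: H1|exact: H2]|
    split => i; have [] := H i].
- by move=> B [A mA ->]; exact: m12.
- move: E mE; apply: smallest_sub; first exact: smallest_sigma_algebra.
  move=> B; rewrite -bigcup_seq => -[i _ [A mA <-]]; apply: sub_sigma_algebra.
  exists (fun j => if j == i then A else setT); first by move=> j; case: ifP.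
  rewrite setTI; apply/seteqP; split => x /=.
    by move=> Ax j; case: eqP => [->|].
  by move=> /(_ i); rewrite eqxx.
Qed.

Lemma measurable_upd {d'} {T' : measurableType d'} (f : T' -> n.-tuple R) (g : T' -> R) i :
  measurable_fun setT f -> measurable_fun setT g ->
  measurable_fun setT (fun t => [tuple upd (tnth (f t)) i (g t) j | j < n]).
Proof.
move=> mf mg; apply/measurable_fun_tnthP => j.
rewrite (_ : _ \o _ = if j == i then g else (fun t => tnth (f t) j)).
  by case: ifP => // _; exact: measurableT_comp (measurable_tnth j) mf.
by apply/funext => t /=; rewrite tnth_mktuple /upd; case: ifP.
Qed.

Lemma tnth_upd (x : 'I_n -> R) : tnth [tuple x j | j < n] = x.
Proof. by apply/funext => j; rewrite tnth_mktuple. Qed.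

Lemma measurable_resample (H : ('I_n -> R) -> R) i :
  measurable_fun setT (fun x : n.-tuple R => H (tnth x)) ->
  measurable_fun setT (fun z : n.-tuple R * T => H (upd (tnth z.1) i (coordinate X i z.2))).
Proof.
move=> mH.
have m1 : measurable_fun setT (fun z : n.-tuple R * T =>
    [tuple upd (tnth z.1) i (coordinate X i z.2) j | j < n]).
  apply: measurable_upd; first exact: measurable_fst.
  exact: measurableT_comp (measurable_coordinate i) measurable_snd.
have := measurableT_comp mH m1; congr (measurable_fun _ _).
by apply/funext => z /=; rewrite tnth_upd.
Qed.

(** The law of [X] is unchanged when its coordinate [i] is replaced by an independent copy: both
    laws agree on boxes, which form a generating pi-system. Iterated integrals over [T] then do the
    work of a product space. *)
Lemma resample (H : ('I_n -> R) -> R) i :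
  measurable_fun setT (fun x : n.-tuple R => H (tnth x)) -> (forall x, 0 <= H x) ->
  (\int[P]_w (H (tnth (X w)))%:E =
   \int[P]_w \int[P]_w' (H (upd (tnth (X w)) i (coordinate X i w')))%:E)%E.
Proof.
move=> mH H0; set h := fun x : n.-tuple R => (H (tnth x))%:E.
have mh : measurable_fun setT h by exact/measurable_EFinP.
pose phi (z : T * T) : n.-tuple R :=
  [tuple upd (tnth (X z.1)) i (coordinate X i z.2) j | j < n].
have mphi : measurable_fun setT phi.
  apply: measurable_upd; first exact: measurableT_comp (measurable_funP X) measurable_fst.
  exact: measurableT_comp (measurable_coordinate i) measurable_snd.
have E1 : (\int[P]_w (H (tnth (X w)))%:E = \int[distribution P X]_x h x)%E.
  by rewrite ge0_integral_distribution// => x; rewrite lee_fin.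
have E2 : (\int[pushforward (P \x P)%E phi]_x h x =
    \int[P]_w \int[P]_w' (H (upd (tnth (X w)) i (coordinate X i w')))%:E)%E.
  rewrite (ge0_integral_pushforward mphi)//; last by move=> x _; rewrite lee_fin.
  rewrite preimage_setT fubini_tonelli1//; last by move=> z /=; rewrite lee_fin.
    by apply: eq_integral => w _; rewrite /fubini_F; apply: eq_integral => w' _;
      rewrite /h /phi /= tnth_upd.
  exact: measurableT_comp.
rewrite E1 -E2; apply: eq_measure_integral => E mE _.
apply: (@tuple_measure_unique (distribution P X)) => //; last first.
  by rewrite -ge0_fin_numE ?measure_ge0//; exact: fin_num_measure.
move=> A mA; rewrite /= /pushforward.
rewrite [distribution P X (box A)](_ : _ = P (X @^-1` box A))// prob_box//.
pose A' j := if j == i then setT else A j.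
have mA' j : measurable (A' j) by rewrite /A'; case: ifP.
rewrite (_ : phi @^-1` box A = (X @^-1` box A') `*` (coordinate X i @^-1` A i)); last first.
  apply/seteqP; split => z /=.
    move=> H1; split => [j|]; last by have := H1 i; rewrite tnth_mktuple /upd eqxx.
    by rewrite /A'; case: ifPn => // ji; have := H1 j; rewrite tnth_mktuple /upd (negbTE ji).
  move=> [H1 H2] j; rewrite tnth_mktuple /upd; case: ifPn => [/eqP ->//|ji].
  by have := H1 j; rewrite /A' (negbTE ji).
have mXi : measurable (coordinate X i @^-1` A i).
  by rewrite -[X in measurable X]setTI; exact: measurable_coordinate.
have mXA : measurable (X @^-1` box A').
  by rewrite -[X in measurable X]setTI; exact: measurable_funP X _ _ (measurable_box mA').
transitivity (P (X @^-1` box A') * P (coordinate X i @^-1` A i))%E; last first.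
  exact: (esym (product_measure1E P P mXA mXi)).
rewrite prob_box// (bigD1 i)//= [in RHS](bigD1 i)//=.
have P1 : P [set: T] = 1%E := probability_setT P.
rewrite {1}/A' eqxx preimage_setT P1 mul1e muleC; congr (_ * _)%E.
by apply: eq_bigr => j ji; rewrite /A' (negbTE ji).
Qed.

Lemma mean_prod_coordinates (k : 'I_n -> R -> R) : (forall i, measurable_fun setT (k i)) ->
  (forall i x, 0 <= k i x) ->
  (\int[P]_w (\prod_i k i (coordinate X i w))%:E =
   \prod_i \int[P]_w (k i (coordinate X i w))%:E)%E.
Proof.
move=> mk k0.
suff main (s : seq 'I_n) : uniq s ->
    (\int[P]_w (\prod_(i <- s) k i (coordinate X i w))%:E =
     \prod_(i <- s) \int[P]_w (k i (coordinate X i w))%:E)%E.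
  by have := main _ (index_enum_uniq 'I_n).
elim: s => [_|i s IH /= /andP[nis us]].
  by under eq_integral do rewrite big_nil; rewrite big_nil mean_cst.
rewrite big_cons -IH//.
have mprod (s' : seq 'I_n) :
    measurable_fun setT (fun x : n.-tuple R => \prod_(j <- s') k j (tnth x j)).
  elim: s' => [|j s' IH'].
    by rewrite (_ : (fun _ => _) = cst 1)//; apply/funext => x; rewrite big_nil.
  rewrite (_ : (fun _ => _) =
    (fun x : n.-tuple R => k j (tnth x j) * \prod_(j <- s') k j (tnth x j))); last first.
    by apply/funext => x; rewrite big_cons.
  apply: measurable_funM => //.
  exact: measurableT_comp (mk j) (measurable_tnth j).
rewrite (@resample (fun x => \prod_(j <- i :: s) k j (x j)) i)//; last first.
  by move=> x; exact: prodr_ge0.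
have E w w' : \prod_(j <- i :: s) k j (upd (tnth (X w)) i (coordinate X i w') j) =
    (\prod_(j <- s) k j (coordinate X j w)) * k i (coordinate X i w').
  rewrite big_cons {1}/upd eqxx mulrC; congr (_ * _); apply: eq_big_seq => j js.
  by rewrite /upd; case: eqP => // ji; move: nis; rewrite -ji js.
have mki : measurable_fun setT (fun w => k i (coordinate X i w)).
  exact: measurableT_comp (mk i) (measurable_coordinate i).
under eq_integral => w _ do under eq_integral => w' _ do rewrite E.
under eq_integral => w _ do rewrite mean_scale ?prodr_ge0//.
have mps : measurable_fun setT (fun w => \prod_(j <- s) k j (coordinate X j w)).
  exact: measurableT_comp (mprod s) (measurable_funP X).
rewrite ge0_integralZr//; first by rewrite muleC.
- exact/measurable_EFinP.
- by move=> w _; rewrite lee_fin prodr_ge0.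
- by apply: mean_ge0.
Qed.
End resampling.

(** * Lipschitz convex functions of n variables *)

Section lipschitz_convex.
Context {R : realType} {n : nat}.
Implicit Types x y : 'I_n -> R.

(** A class stable under averaging over one coordinate, with the same constant. The l1 distance
    makes every slice [L]-Lipschitz, and nonnegativity gives access to [resample]. *)
Record lipschitz_convex (F : ('I_n -> R) -> R) (L : R) : Prop := LipschitzConvex {
  lc_ge0 : forall x, 0 <= F x;
  lc_const_ge0 : 0 <= L;
  lc_lip : forall x y, F x <= F y + L * \sum_i `|x i - y i|;
  lc_convex : forall x y (a : R), 0 <= a <= 1 ->
    F (fun i => a * x i + (1 - a) * y i) <= a * F x + (1 - a) * F y }.

(** [F x > c] holds exactly when [F q - L * |x - q|_1 > c] for some rational point [q], so the event
    is a countable union of measurable sets. *)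
Lemma measurable_lipschitz_convex F L : lipschitz_convex F L ->
  measurable_fun setT (fun x : n.-tuple R => F (tnth x)).
Proof.
move=> FL; have L0 := lc_const_ge0 FL.
apply: (measurability _ (RGenOInfty.measurableE R)) => _ [_ [c ->] <-]; rewrite setTI.
pose qR (q : {ffun 'I_n -> rat}) : 'I_n -> R := fun i => ratr (q i).
pose A q := [set x : n.-tuple R | c < F (qR q) - L * \sum_i `|tnth x i - qR q i|].
rewrite (_ : _ @^-1` _ = \bigcup_q A q).
  apply: countable_bigcupT_measurable; first exact: countableP.
  move=> q; apply: (measurable_gt_set (u := fun x : n.-tuple R => F (qR q) - L * \sum_i `|tnth x i - qR q i|)).
  apply: measurable_funB => //; apply: measurable_funM => //.
  apply: measurable_sum => i; apply: measurableT_comp => //.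
  by apply: measurable_funB => //; exact: measurable_tnth.
apply/seteqP; split => x /=; rewrite in_itv /= andbT.
  move=> cF; pose e := F (tnth x) - c; have e0 : 0 < e by rewrite subr_gt0.
  pose de := e / (2 * L * n%:R + 1).
  have D0 : 0 < 2 * L * n%:R + 1 by rewrite ltr_wpDl// !mulr_ge0.
  have de0 : 0 < de by exact: divr_gt0.
  have ex i : exists q : rat, `|tnth x i - ratr q| <= de.
    have : tnth x i - de < tnth x i + de by lra.
    move=> /rat_in_itvoo[q]; rewrite in_itv /= => /andP[q1 q2]; exists q.
    by rewrite ler_distlC; apply/andP; split; lra.
  pose q : {ffun 'I_n -> rat} := [ffun i => sval (cid (ex i))].
  exists q => //; rewrite /A /=.
  have S : \sum_i `|tnth x i - qR q i| <= de * n%:R.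
    have -> : de * n%:R = \sum_(i < n) de by rewrite sumr_const card_ord mulr_natr.
    by apply: ler_sum => i _; rewrite /qR ffunE; exact: svalP (cid (ex i)).
  have := lc_lip FL (tnth x) (qR q); have := ler_wpM2l L0 S.
  have : 2 * (L * (de * n%:R)) < e.
    have -> : 2 * (L * (de * n%:R)) = e * (2 * L * n%:R) / (2 * L * n%:R + 1) by rewrite /de; ring.
    by rewrite ltr_pdivrMr// ltr_pM2l//; lra.
  by rewrite /e; set s := \sum_i _; lra.
move=> [q _]; rewrite /A /= => cq.
have := lc_lip FL (qR q) (tnth x).
rewrite (eq_bigr (fun i => `|tnth x i - qR q i|)); last by move=> i _; rewrite distrC.
by lra.
Qed.

Lemma sum_upd_le x y i (a : R) :
  \sum_j `|upd x i a j - upd y i a j| <= \sum_j `|x j - y j|.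
Proof.
by apply: ler_sum => j _; rewrite /upd; case: eqP => // _; rewrite subrr normr0.
Qed.

Lemma sum_upd_slice x i (a b : R) : \sum_j `|upd x i a j - upd x i b j| = `|a - b|.
Proof.
rewrite (bigD1 i)//= /upd eqxx big1 ?addr0// => j /negbTE ->.
by rewrite subrr normr0.
Qed.

Lemma slice_lipschitz F L : lipschitz_convex F L -> forall x i (a b : R),
  `|F (upd x i a) - F (upd x i b)| <= L * `|a - b|.
Proof.
move=> FL x i a b; have := lc_lip FL (upd x i a) (upd x i b).
have := lc_lip FL (upd x i b) (upd x i a); rewrite !sum_upd_slice (distrC b a).
by rewrite ler_distlC => h1 h2; apply/andP; split; lra.
Qed.

Lemma slice_convex F L : lipschitz_convex F L -> forall x i (u v a : R), 0 <= a <= 1 ->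
  F (upd x i (a * u + (1 - a) * v)) <= a * F (upd x i u) + (1 - a) * F (upd x i v).
Proof.
move=> FL x i u v a a01; apply: le_trans (lc_convex FL _ _ a01).
rewrite le_eqVlt; apply/orP; left; apply/eqP; congr F; apply/funext => j.
by rewrite /upd; case: eqP => // _; ring.
Qed.
End lipschitz_convex.

(** * Tensorisation of the infimum-convolution inequality *)

Section tensorization.
Context {d : measure_display} {T : measurableType d} {R : realType} {n : nat}.
Context (P : probability T R) (X : {RV P >-> n.-tuple R}).
Context (indepX : mutually_independent P (coordinate X)).
Context (dom : 'I_n -> set R) (phi : 'I_n -> R -> R).
Context (tcX : forall i, transport_cost P (coordinate X i) (dom i) (phi i)).

Lemma integrable_slice (F : ('I_n -> R) -> R) L x i : lipschitz_convex F L ->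
  P.-integrable setT (EFin \o (fun w => F (upd x i (coordinate X i w)))).
Proof.
move=> FL; have iX := integrable_abse (tc_integrable (tcX i)).
have L0 := lc_const_ge0 FL.
apply: (@integrable_dominated _ _ _ _ _ (fun w => `|F (upd x i 0)| + L * `|coordinate X i w|)).
- have := measurableT_comp (measurable_lipschitz_convex FL)
    (measurable_upd i (@measurable_cst _ _ T _ setT [tuple x j | j < n]) (measurable_coordinate X i)).
  congr (measurable_fun _ _); apply/funext => w /=.
  by rewrite !tnth_upd.
- exact: integrable_add (integrable_cst P _) (integrable_scale L iX).
- move=> w; have := slice_lipschitz FL x i (coordinate X i w) 0; rewrite subr0 => H.
  rewrite -[F (upd x i (coordinate X i w))](subrK (F (upd x i 0))) addrC.
  by rewrite (le_trans (ler_normD _ _))// lerD2l.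
Qed.

Definition partial_mean (F : ('I_n -> R) -> R) (i : 'I_n) (x : 'I_n -> R) : R :=
  \int[P]_w F (upd x i (coordinate X i w)).

Lemma partial_mean_lipschitz_convex F L i : lipschitz_convex F L ->
  lipschitz_convex (partial_mean F i) L.
Proof.
move=> FL; have L0 := lc_const_ge0 FL; split => //.
- by move=> x; apply: Rintegral_ge0 => w _; exact: lc_ge0 FL _.
- move=> x y; set c := L * _.
  have -> : partial_mean F i y + c = \int[P]_w (F (upd y i (coordinate X i w)) + c).
    rewrite (RintegralD measurableT (integrable_slice y i FL) (integrable_cst P c)).
    by congr (_ + _); rewrite /Rintegral mean_cst.
  apply: le_Rintegral => //; first exact: integrable_slice FL.
    exact: integrable_add (integrable_slice y i FL) (integrable_cst P c).
  move=> w _; apply: le_trans (lc_lip FL _ (upd y i (coordinate X i w))) _.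
  by rewrite lerD2l ler_wpM2l// sum_upd_le.
- move=> x y a a01.
  have i1 := integrable_scale a (integrable_slice x i FL).
  have i2 := integrable_scale (1 - a) (integrable_slice y i FL).
  rewrite /partial_mean -RintegralZl//; last exact: integrable_slice FL.
  rewrite -RintegralZl//; last exact: integrable_slice FL.
  rewrite -RintegralD//; apply: le_Rintegral => //; first exact: integrable_slice FL.
    exact: integrable_add.
  move=> w _; apply: le_trans (lc_convex FL _ _ a01).
  rewrite le_eqVlt; apply/orP; left; apply/eqP; congr F; apply/funext => j.
  by rewrite /upd; case: eqP => // _; ring.
Qed.

(** Induction on the coordinates that matter. Integrating out coordinate [i] replaces [F] and [G] by
    their partial means, which satisfy the same hypothesis over the remaining coordinates by the
    one-dimensional inequality. The mean of [F] is produced as a real [r] along the way. *)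
Lemma tensor_infconv_seq (s : seq 'I_n) : uniq s ->
  forall (F G : ('I_n -> R) -> R) (L : R), lipschitz_convex F L ->
  (forall x y, {in s, x =1 y} -> F x = F y) ->
  (forall x, 0 <= G x) -> measurable_fun setT (fun x : n.-tuple R => G (tnth x)) ->
  (forall x z : 'I_n -> R, (forall i, i \in s -> dom i (z i)) -> (forall i, i \notin s -> z i = 0) ->
    G x <= expR (F (fun j => x j - z j) + \sum_(i <- s) phi i (z i))) ->
  exists2 r, (\int[P]_w (F (tnth (X w)))%:E = r%:E)%E &
    (\int[P]_w (G (tnth (X w)))%:E <= (expR r)%:E)%E.
Proof.
elim: s => [_|i s IH /= /andP[nis us]] F G L FL Floc G0 mG GF.
  exists (F (fun=> 0)).
    by rewrite -(mean_cst P); apply: eq_integral => w _; congr EFin; apply: Floc.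
  rewrite -(mean_cst P); apply: mean_le => //.
  - exact: measurableT_comp mG (measurable_funP X).
  - move=> w; have := GF (tnth (X w)) (fun=> 0); rewrite big_nil addr0.
    by move=> /(_ (fun i H => False_ind _ (Bool.diff_false_true H)) (fun _ _ => erefl)) /le_trans; apply;
      rewrite ler_expR le_eqVlt; apply/orP; left; apply/eqP; exact: Floc.
have mres := measurable_resample X i mG.
have mresw x : measurable_fun setT (fun w => G (upd x i (coordinate X i w))).
  have := measurableT_comp mG
    (measurable_upd i (@measurable_cst _ _ T _ setT [tuple x j | j < n]) (measurable_coordinate X i)).
  by congr (measurable_fun _ _); apply/funext => w /=; rewrite !tnth_upd.
(* With the other displacements frozen, their total cost [c] is a constant that is added to the
   slice of [F]. *)
have key x (z : 'I_n -> R) : (forall j, j \in s -> dom j (z j)) -> (forall j, j \notin s -> z j = 0) ->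
    (\int[P]_w (G (upd x i (coordinate X i w)))%:E <=
     (expR (partial_mean F i (fun j => x j - z j) + \sum_(j <- s) phi j (z j)))%:E)%E.
  move=> zs zn; set c := \sum_(j <- s) _; pose y j := x j - z j.
  have -> : partial_mean F i (fun j => x j - z j) + c =
      \int[P]_w (F (upd y i (coordinate X i w)) + c).
    rewrite (RintegralD measurableT (integrable_slice y i FL) (integrable_cst P c)).
    by congr (_ + _); rewrite /Rintegral mean_cst.
  apply: (tc_infconv (tcX i) (f := fun u => F (upd y i u) + c) (G := fun u => G (upd x i u)) (L := L)).
  - move=> a b; rewrite (_ : _ - _ = F (upd y i a) - F (upd y i b)); last by ring.
    exact: slice_lipschitz.
  - by move=> a b e e01; have := slice_convex FL y i a b e01; lra.
  - by [].
  - have := measurableT_comp mG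
      (measurable_upd i (@measurable_cst _ _ R _ setT [tuple x j | j < n]) (@measurable_id _ R setT)).
    by congr (measurable_fun _ _); apply/funext => w /=; rewrite !tnth_upd.
  - move=> u v dv; have := GF (upd x i u) (upd z i v).
    rewrite big_cons [upd z i v i]/upd eqxx.
    rewrite (eq_big_seq (fun j => phi j (z j))); last first.
      by move=> j js; rewrite /upd; case: eqP => // ji; move: nis; rewrite -ji js.
    rewrite -/c (_ : (fun j => upd x i u j - upd z i v j) = upd y i (u - v)); last first.
      by apply/funext => j; rewrite /upd /y; case: eqP.
    have -> : F (upd y i (u - v)) + (phi i v + c) = F (upd y i (u - v)) + c + phi i v by ring.
    apply.
      move=> j; rewrite in_cons /upd; case: eqP => [->|_] //=; exact: zs.
    by move=> j; rewrite in_cons negb_or /upd => /andP[/negbTE -> js]; exact: zn.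
pose G' x := fine (\int[P]_w (G (upd x i (coordinate X i w)))%:E)%E.
have G'E x : ((G' x)%:E = \int[P]_w (G (upd x i (coordinate X i w)))%:E)%E.
  rewrite fineK// ge0_fin_numE; last by apply: mean_ge0.
  apply: le_lt_trans (key x (fun=> 0) _ _) _ => //; last exact: ltry.
  by move=> j _; exact: tc_dom0 (tcX j).
have [||||r rF rG] := IH us (partial_mean F i) G' L (partial_mean_lipschitz_convex i FL).
- move=> x y xy; apply: eq_Rintegral => w _; apply: Floc => j; rewrite in_cons /upd.
  by case: eqP => // _ /= js; exact: xy.
- by move=> x; rewrite fine_ge0//; apply: mean_ge0.
- apply/measurable_EFinP.
  have := @measurable_fun_fubini_tonelli_F _ _ _ _ R P
    (fun z : n.-tuple R * T => (G (upd (tnth z.1) i (coordinate X i z.2)))%:E).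
  move=> /(_ _)/(_ _) H.
  have -> : (EFin \o (fun x : n.-tuple R => G' (tnth x))) =
      fubini_F P (fun z : n.-tuple R * T => (G (upd (tnth z.1) i (coordinate X i z.2)))%:E).
    by apply/funext => x /=; rewrite G'E.
  apply: H; first exact/measurable_EFinP.
  by move=> z; rewrite lee_fin.
- by move=> x z zs zn; rewrite -lee_fin G'E; exact: key.
exists r; last first.
  by rewrite (resample indepX i mG G0); under eq_integral do rewrite -G'E.
rewrite (resample indepX i (measurable_lipschitz_convex FL) (lc_ge0 FL)) -rF.
apply: eq_integral => w _; rewrite -Rintegral_EFin//; exact: integrable_slice FL.
Qed.

Lemma tensor_infconv (F G : ('I_n -> R) -> R) (L : R) : lipschitz_convex F L ->
  (forall x, 0 <= G x) -> measurable_fun setT (fun x : n.-tuple R => G (tnth x)) ->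
  (forall x z : 'I_n -> R, (forall i, dom i (z i)) ->
    G x <= expR (F (fun j => x j - z j) + \sum_i phi i (z i))) ->
  exists2 r, (\int[P]_w (F (tnth (X w)))%:E = r%:E)%E &
    (\int[P]_w (G (tnth (X w)))%:E <= (expR r)%:E)%E.
Proof.
move=> FL G0 mG GF; apply: (tensor_infconv_seq (index_enum_uniq 'I_n) FL) => //.
  by move=> x y xy; congr F; apply/funext => j; rewrite xy// mem_index_enum.
by move=> x z zd _; apply: GF => i; apply: zd; rewrite mem_index_enum.
Qed.
End tensorization.

(** * A finite-dimensional Hahn-Banach argument *)

Section norming_functional.
Context {R : realType} {n : nat}.
Implicit Types (p q : 'rV[R]_n -> R) (x y v : 'rV[R]_n).

Record sublinear p : Prop := Sublinear {
  sublinear_add : forall x y, p (x + y) <= p x + p y;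
  sublinear_scale : forall (a : R) x, 0 <= a -> p (a *: x) <= a * p x }.

Lemma sublinear0 p : sublinear p -> p 0 = 0.
Proof.
move=> sp; apply/eqP; rewrite eq_le; apply/andP; split.
  by have := sublinear_scale sp 0 (lexx 0); rewrite scale0r mul0r.
by have := sublinear_add sp 0 0; rewrite addr0; lra.
Qed.

Lemma sublinear_oppr p x : sublinear p -> - p (- x) <= p x.
Proof. by move=> sp; have := sublinear_add sp x (- x); rewrite subrr sublinear0//; lra. Qed.

(* The largest sublinear functional below [p] that is linear along [v]. *)
Definition linearized p v x : R :=
  inf [set p (x + l *: v) - l * p v | l in [set l : R | 0 <= l]].

Section linearized.
Context p v (sp : sublinear p).

Let S x := [set p (x + l *: v) - l * p v | l in [set l : R | 0 <= l]].

Lemma linearized_lb x : lbound (S x) (- p (- x)).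
Proof.
move=> _ [l /= l0 <-].
have H : l * p v <= p (l *: v).
  move: l0; rewrite le_eqVlt => /predU1P[<-|l0]; first by rewrite mul0r scale0r sublinear0.
  have := sublinear_scale sp (l *: v) (ltW (_ : 0 < l^-1)).
  rewrite invr_gt0 => /(_ l0); rewrite scalerA mulVf ?gt_eqF// scale1r.
  by rewrite ler_pdivlMl.
have := sublinear_add sp (x + l *: v) (- x); rewrite addrAC subrr add0r.
by lra.
Qed.

Lemma linearized_le x l : 0 <= l -> linearized p v x <= p (x + l *: v) - l * p v.
Proof. by move=> l0; apply: ge_inf; [exists (- p (- x)); exact: linearized_lb|exists l]. Qed.

Lemma le_linearized x c : (forall l, 0 <= l -> c <= p (x + l *: v) - l * p v) ->
  c <= linearized p v x.
Proof.
move=> H; apply: lb_le_inf; first by exists (p (x + 0 *: v) - 0 * p v); exists 0 => //=.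
by move=> _ [l l0 <-]; exact: H.
Qed.

Lemma linearized_le_self x : linearized p v x <= p x.
Proof. by have := linearized_le x (lexx 0); rewrite scale0r addr0 mul0r subr0. Qed.

Lemma linearized_oppr : linearized p v (- v) <= - p v.
Proof.
have := linearized_le (- v) (ler01 : 0 <= 1 :> R).
by rewrite scale1r addNr sublinear0// mul1r sub0r.
Qed.

Lemma linearized_sublinear : sublinear (linearized p v).
Proof.
split.
- move=> x y; rewrite -lerBlDr; apply: le_linearized => l l0.
  rewrite lerBlDr -lerBlDl; apply: le_linearized => m m0; rewrite lerBlDl.
  apply: le_trans (linearized_le (x + y) (addr_ge0 l0 m0)) _.
  rewrite scalerDl addrACA; have := sublinear_add sp (x + l *: v) (y + m *: v).
  by lra.
- move=> a x; rewrite le_eqVlt => /predU1P[<-|a0].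
    by rewrite scale0r mul0r (le_trans (linearized_le_self 0))// sublinear0.
  rewrite -ler_pdivrMl//; apply: le_linearized => l l0; rewrite ler_pdivrMl//.
  apply: le_trans (linearized_le (a *: x) (mulr_ge0 (ltW a0) l0)) _.
  rewrite -scalerA -scalerDr; have := sublinear_scale sp (x + l *: v) (ltW a0).
  by lra.
Qed.
End linearized.

(** Linearity along [v] survives further lowering: if [q] is below the linearised functional, then
    [q (- v) <= - p v <= - q v]. So the vectors can be treated one after another. *)
Lemma linearize_seq (vs : seq 'rV[R]_n) p : sublinear p ->
  exists q, [/\ sublinear q, forall x, q x <= p x & forall v, v \in vs -> q (- v) <= - q v].
Proof.
elim: vs p => [|v vs IH] p sp; first by exists p.
have [q [sq qp qv]] := IH _ (linearized_sublinear v sp).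
exists q; split => //.
  by move=> x; exact: le_trans (qp x) (linearized_le_self v sp x).
move=> u; rewrite in_cons => /predU1P[->|]; last exact: qv.
apply: le_trans (qp _) _; apply: le_trans (linearized_oppr v sp) _.
by rewrite lerN2; exact: le_trans (qp v) (linearized_le_self v sp v).
Qed.

Lemma is_norm_sublinear N : is_norm N -> sublinear N.
Proof.
move=> nN; split; first exact: norm_triangle nN.
by move=> a x a0; rewrite (norm_homogeneous nN) ger0_norm.
Qed.

(** Linearising [N] along [z] first forces [q (- z) <= - N z], which keeps the value at [z].
    Linearity along the basis vectors then makes [q] coincide with [dotv t]. *)
Lemma norming_functional (N : 'rV[R]_n -> R) z : is_norm N ->
  exists t : 'rV[R]_n, (dual_norm N t <= 1)%E /\ N z <= dotv t z.
Proof.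
move=> nN; have sN := is_norm_sublinear nN.
have sz := linearized_sublinear z sN.
have [q [sq qp qv]] := linearize_seq [seq delta_mx 0 i | i <- enum 'I_n] sz.
have qe i : q (- delta_mx 0 i) <= - q (delta_mx 0 i).
  by apply: qv; apply/mapP; exists i => //; rewrite mem_enum.
pose t : 'rV[R]_n := \row_i q (delta_mx 0 i).
have q_le x : q x <= dotv t x.
  rewrite {1}[x]row_sum_delta /dotv.
  apply: (@le_trans _ _ (\sum_i q (x 0 i *: delta_mx 0 i))).
    elim/big_rec2 : _ => [|i a b _ H]; first by rewrite sublinear0.
    by apply: le_trans (sublinear_add sq _ _) _; rewrite lerD2l.
  apply: ler_sum => i _; rewrite mxE mulrC.
  have [x0|/ltW x0] := leP 0 (x 0 i); first exact: sublinear_scale.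
  have xN : 0 <= - x 0 i by rewrite oppr_ge0.
  have := sublinear_scale sq (- delta_mx 0 i) xN; rewrite scalerN scaleNr opprK => /le_trans; apply.
  by have := ler_wpM2l xN (qe i); rewrite mulrNN.
have dotN x : dotv t (- x) = - dotv t x.
  by rewrite /dotv -sumrN; apply: eq_bigr => i _; rewrite !mxE mulrN.
have le_q x : dotv t x <= q x.
  by have := q_le (- x); rewrite dotN; have := sublinear_oppr x sq; lra.
have qN x : q x <= N x by exact: le_trans (qp x) (linearized_le_self z sN x).
exists t; split.
  apply: ge_ereal_sup => _ [x /= Nx <-]; rewrite lee_fin ler_norml.
  have NN : N (- x) = N x by rewrite -scaleN1r (norm_homogeneous nN) normrN1 mul1r.
  have := le_trans (le_q x) (qN x); have := le_trans (le_q (- x)) (qN (- x)).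
  by rewrite dotN NN => h1 h2; apply/andP; split; lra.
have := q_le z; have := sublinear_oppr z sq; have := qp (- z); have := linearized_oppr z sN.
by lra.
Qed.
End norming_functional.

(** * Lower bound for the moments of linear functionals *)

Section lower_bound.
Context {d : measure_display} {T : measurableType d} {R : realType}.
Context (P : probability T R).

Lemma Lnorm_le (f : T -> R) (p c : R) : 0 < p -> 0 <= c ->
  (\int[P]_w (`|f w| `^ p)%:E <= (c `^ p)%:E)%E -> ('N[P]_p%:E[EFin \o f] <= c%:E)%E.
Proof.
move=> p0 c0 H; have p1 : 0 <= p^-1 by rewrite invr_ge0 ltW.
rewrite unlock.
have E : (\int[P]_w (`|(EFin \o f) w| `^ p) = \int[P]_w (`|f w| `^ p)%:E)%E.
  by apply: eq_integral => w _.
rewrite E; apply: le_trans (_ : ((c `^ p)%:E `^ p^-1 <= _)%E).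
  apply: gt0_ler_poweR => //; rewrite in_itv /= leey andbT.
    by apply: mean_ge0 => w; exact: powR_ge0.
  by rewrite lee_fin powR_ge0.
by rewrite poweR_EFin -powRrM divff ?gt_eqF// powRr1.
Qed.

Lemma symmetric_mean0 (Y : T -> R) : measurable_fun setT Y ->
  P.-integrable setT (EFin \o Y) ->
  (forall A : set R, measurable A -> P (Y @^-1` A) = P ((fun t => - Y t) @^-1` A)) ->
  \int[P]_w Y w = 0.
Proof.
move=> mY iY symY; pose u (x : R) := Num.max x 0.
have mu : measurable_fun setT u by exact: measurable_maxr.
have u0 x : 0 <= u x by rewrite le_max lexx orbT.
have iu (g : T -> R) : measurable_fun setT g -> (forall w, `|g w| = `|Y w|) ->
    P.-integrable setT (EFin \o (fun w => u (g w))).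
  move=> mg gY; have iA := integrable_abse iY.
  apply: (@integrable_dominated _ _ _ _ _ (fun w => `|Y w|)) => //.
    exact: measurableT_comp mu mg.
  by move=> w; rewrite ger0_norm// -gY ge_max normr_ge0 ler_norm.
have i1 := iu Y mY (fun w => erefl).
have i2 : P.-integrable setT (EFin \o (fun w => u (- Y w))).
  by apply: iu => [|w]; [exact: measurable_funN|rewrite normrN].
have -> : \int[P]_w Y w = \int[P]_w (u (Y w) - u (- Y w)).
  apply: eq_Rintegral => w _; rewrite /u; case: (leP (Y w) 0) => H.
    by rewrite max_l ?oppr_ge0// sub0r opprK.
  by rewrite max_r ?subr0// oppr_le0 ltW.
by rewrite RintegralB// {2}/Rintegral mean_oppr// subrr.
Qed.

Lemma Rmean_sum (I : Type) (s : seq I) (u : I -> T -> R) :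
  (forall i, P.-integrable setT (EFin \o u i)) ->
  P.-integrable setT (EFin \o (fun w => \sum_(i <- s) u i w)) /\
  \int[P]_w (\sum_(i <- s) u i w) = \sum_(i <- s) \int[P]_w u i w.
Proof.
move=> iu; elim: s => [|i s [IH1 IH2]].
  rewrite (_ : (fun w => _) = cst 0); last by apply/funext => w; rewrite big_nil.
  split; first exact: integrable_cst.
  by rewrite big_nil /Rintegral mean_cst.
rewrite (_ : (fun w => _) = (fun w => u i w + \sum_(i <- s) u i w)); last first.
  by apply/funext => w; rewrite big_cons.
split; first exact: integrable_add.
by rewrite big_cons -IH2 RintegralD.
Qed.

(* The exponent is conjugate to [p] and equals [1 + th] with [th = (p - 1)^-1 <= 1];
   the bound interpolates between the first two moments. *)
Lemma density_Lnorm_le (H : T -> R) (p : R) : 2 <= p -> measurable_fun setT H ->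
  (forall w, 0 <= H w) -> (\int[P]_w (H w)%:E = 1)%E ->
  (\int[P]_w (H w ^+ 2)%:E <= (expR p)%:E)%E ->
  ('N[P]_(p / (p - 1))%:E[EFin \o H] <= (expR 1)%:E)%E.
Proof.
move=> p2 mH H0 H1 H2; have pm : 0 < p - 1 by lra.
set q := p / (p - 1); have q0 : 0 < q by rewrite divr_gt0//; lra.
apply: Lnorm_le => //.
pose th := (p - 1)^-1; have th0 : 0 <= th by rewrite invr_ge0 ltW.
have th1 : th <= 1 by rewrite invf_le1//; lra.
have qE : q = 1 + th by rewrite /q /th; field; rewrite gt_eqF.
have pth : p * th = q by [].
have k0 : 0 <= expR q * (1 - th) by rewrite mulr_ge0 ?expR_ge0// subr_ge0.
have k1 : 0 <= expR q * th * expR (- p) by rewrite !mulr_ge0 ?expR_ge0.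
apply: (@le_trans _ _ (\int[P]_w (expR q * (1 - th) * H w + expR q * th * expR (- p) * H w ^+ 2)%:E)%E).
  apply: mean_le.
  - by move=> w; exact: powR_ge0.
  - apply: (@measurableT_comp _ _ _ _ _ _ (@powR R ^~ q)) => //.
    exact: measurableT_comp mH.
  - by apply: measurable_funD; apply: measurable_funM => //; exact: measurable_funX.
  - move=> w; rewrite ger0_norm//; have := H0 w; rewrite le_eqVlt => /predU1P[<-|Hw].
      by rewrite powR0 ?gt_eqF// expr0n /= !mulr0 addr0.
    rewrite /powR gt_eqF//; set y := ln (H w); have HE : H w = expR y by rewrite lnK.
    have ac : 0 <= th / 2 <= 1 / 2 by apply/andP; split; lra.
    (* With [H = expR y] and [q = p * th], the power [H ^ q] equals
       [expR (q + y) * expR (th * (y - p))]; the chord bound turns the last factor into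
       [1 - th + th * expR (y - p)]. *)
    have := expR_le_chord (2 * (y - p)) ac.
    have -> : th / 2 * (2 * (y - p)) = th * (y - p) by field.
    have -> : 2 * (th / 2) = th by field.
    have -> : 2 * (y - p) / 2 = y - p by field.
    have E0 : 0 <= expR (q + y) by exact: expR_ge0.
    move=> /(ler_wpM2l E0); rewrite -expRD.
    have -> : q + y + th * (y - p) = q * y by rewrite mulrBr (mulrC th p) pth [in RHS]qE; ring.
    move/le_trans; apply; rewrite HE le_eqVlt; apply/orP; left; apply/eqP.
    by rewrite !expRD expRN; ring.
rewrite mean_add ?mean_scale//.
- rewrite H1 mule1.
  apply: (@le_trans _ _ ((expR q * (1 - th))%:E + (expR q * th * expR (- p))%:E * (expR p)%:E)%E).
    by rewrite leeD2l// lee_wpmul2l.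
  rewrite -EFinM -EFinD lee_fin -[_ * expR (- p) * _]mulrA -expRD addNr expR0 mulr1.
  have -> : expR q * (1 - th) + expR q * th = expR q by ring.
  by rewrite /powR gt_eqF ?expR_gt0// expRK mulr1.
- by move=> w; exact: sqr_ge0.
- exact: measurable_funX.
- by move=> w; rewrite mulr_ge0.
- exact: measurable_funM.
- by move=> w; rewrite mulr_ge0// sqr_ge0.
- by apply: measurable_funM => //; exact: measurable_funX.
Qed.

Context {n : nat} (X : {RV P >-> n.-tuple R}).
Context (indepX : mutually_independent P (coordinate X)).
Context (dom : 'I_n -> set R) (phi : 'I_n -> R -> R).
Context (tcX : forall i, transport_cost P (coordinate X i) (dom i) (phi i)).
Context (meanX : forall i, \int[P]_w coordinate X i w = 0).

Section density.
Context (h : 'I_n -> R -> R) (M : 'I_n -> R) (mh : forall i, measurable_fun setT (h i)).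
Context (h0M : forall i x, 0 <= h i x <= M i).
Context (h1 : forall i, (\int[P]_w (h i (coordinate X i w))%:E = 1)%E).

Definition density (w : T) : R := \prod_i h i (coordinate X i w).

Let h0 i x : 0 <= h i x. Proof. by have /andP[] := h0M i x. Qed.

Let mhX i : measurable_fun setT (fun w => h i (coordinate X i w)).
Proof. exact: measurableT_comp (mh i) (measurable_coordinate X i). Qed.

Lemma density_ge0 w : 0 <= density w.
Proof. by apply: prodr_ge0. Qed.

Lemma measurable_density : measurable_fun setT density.
Proof.
rewrite /density; elim: (index_enum _) => [|i s IH].
  by rewrite (_ : (fun _ => _) = cst 1)//; apply/funext => w; rewrite big_nil.
rewrite (_ : (fun _ => _) =
  (fun w => h i (coordinate X i w) * \prod_(i <- s) h i (coordinate X i w))); last first.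
  by apply/funext => w; rewrite big_cons.
exact: measurable_funM.
Qed.

Lemma density_le w : density w <= \prod_i M i.
Proof. by apply: ler_prod => i _; exact: h0M. Qed.

Lemma mean_density : (\int[P]_w (density w)%:E = 1)%E.
Proof. by rewrite mean_prod_coordinates// big1. Qed.

Lemma mean_density_coordinate (u : R -> R) j : measurable_fun setT u -> (forall x, 0 <= u x) ->
  (\int[P]_w (density w * u (coordinate X j w))%:E =
   \int[P]_w (h j (coordinate X j w) * u (coordinate X j w))%:E)%E.
Proof.
move=> mu u0; pose k i x := if i == j then h i x * u x else h i x.
transitivity (\int[P]_w (\prod_i k i (coordinate X i w))%:E)%E.
  apply: eq_integral => w _; congr EFin; rewrite /density (bigD1 j)//= [in RHS](bigD1 j)//=.
  rewrite {1}/k eqxx mulrAC; congr (_ * _); apply: eq_bigr => i ij.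
  by rewrite /k (negbTE ij).
rewrite mean_prod_coordinates//.
- rewrite (bigD1 j)//= big1 ?mule1; first by apply: eq_integral => w _; rewrite /k eqxx.
  move=> i ij; rewrite -[RHS](h1 i); apply: eq_integral => w _.
  by rewrite /k (negbTE ij).
- by move=> i; rewrite /k; case: eqP => // _; exact: measurable_funM.
- by move=> i x; rewrite /k; case: eqP => // _; exact: mulr_ge0.
Qed.

Lemma integrable_density_coordinate j :
  P.-integrable setT (EFin \o (fun w => density w * coordinate X j w)).
Proof.
have iA := integrable_abse (tc_integrable (tcX j)).
apply: (@integrable_dominated _ _ _ _ _ (fun w => \prod_i M i * `|coordinate X j w|)).
- apply: measurable_funM; [exact: measurable_density|exact: measurable_coordinate].
- exact: integrable_scale iA.
- by move=> w; rewrite normrM (ger0_norm (density_ge0 w)) ler_wpM2r// density_le.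
Qed.

Lemma Rmean_density_coordinate j :
  \int[P]_w (density w * coordinate X j w) = \int[P]_w (h j (coordinate X j w) * coordinate X j w).
Proof.
have iA := integrable_abse (tc_integrable (tcX j)).
(* The product formula concerns nonnegative functions, so the coordinate is split into its positive
   and negative parts. *)
pose u (x : R) := Num.max x 0; pose v (x : R) := Num.max (- x) 0.
have mX := measurable_coordinate X j.
have mu : measurable_fun setT u by exact: measurable_maxr.
have mv : measurable_fun setT v by apply: measurable_maxr => //; exact: measurable_funN.
have u0 x : 0 <= u x by rewrite le_max lexx orbT.
have v0 x : 0 <= v x by rewrite le_max lexx orbT.
have uv x : x = u x - v x.
  rewrite /u /v; case: (leP x 0) => H; first by rewrite max_l ?oppr_ge0// sub0r opprK.
  by rewrite max_r ?subr0// oppr_le0 ltW.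
have ulex x : `|u x| <= `|x| by rewrite ger0_norm// ge_max normr_ge0 ler_norm.
have vlex x : `|v x| <= `|x| by rewrite ger0_norm// ge_max normr_ge0 -normrN ler_norm.
have key (g : T -> R) c : measurable_fun setT g -> (forall w, 0 <= g w <= c) ->
    \int[P]_w (g w * coordinate X j w) =
    \int[P]_w (g w * u (coordinate X j w)) - \int[P]_w (g w * v (coordinate X j w)).
  move=> mg gc.
  have ii (e : R -> R) : measurable_fun setT e -> (forall x, `|e x| <= `|x|) ->
      P.-integrable setT (EFin \o (fun w => g w * e (coordinate X j w))).
    move=> me ex; apply: (@integrable_dominated _ _ _ _ _ (fun w => c * `|coordinate X j w|)).
    - by apply: measurable_funM => //; exact: measurableT_comp me mX.
    - exact: integrable_scale iA.
    - move=> w; have /andP[g0 g1] := gc w.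
      by rewrite normrM (ger0_norm g0) ler_pM.
  rewrite -RintegralB//; [|exact: ii|exact: ii].
  by apply: eq_Rintegral => w _; rewrite -mulrBr -uv.
have Hc w : 0 <= density w <= \prod_i M i by rewrite density_ge0 density_le.
rewrite (key _ _ measurable_density Hc) (key _ _ (mhX j) (fun w => h0M j (coordinate X j w))).
by rewrite /Rintegral !mean_density_coordinate.
Qed.
End density.

Lemma tilt_lower_bound (z t : 'I_n -> R) (p : R) : 2 <= p -> (forall i, dom i (z i)) ->
  \sum_i phi i (z i) <= p ->
  ((\sum_i t i * z i)%R%:E <=
    (tilt_c * expR 1)%:E * Lp_norm P p (fun w => (\sum_i t i * coordinate X i w)%R))%E.
Proof.
move=> p2 zd zp; have C0 := @tilt_c_gt0 R.
have : forall i, exists hM : (R -> R) * R, [/\ measurable_fun setT hM.1,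
    forall x, 0 <= hM.1 x <= hM.2, (\int[P]_w (hM.1 (coordinate X i w))%:E = 1)%E,
    (\int[P]_w (hM.1 (coordinate X i w) ^+ 2)%:E <= (expR (phi i (z i)))%:E)%E &
    t i * z i <= t i * (tilt_c * \int[P]_w (hM.1 (coordinate X i w) * coordinate X i w))].
  (* Only coordinates with [t i * z i > 0] are tilted. The others keep density 1: being centred they
     contribute 0, which is at least [t i * z i]. *)
  move=> i; have [tz|tz] := ltP 0 (t i * z i).
    have [h [M [mh hM h1 h2 hz]]] := tc_tilt (tcX i) (zd i).
    exists (h, M); split => //=.
    have z2 : 0 < z i * z i.
      rewrite -expr2 lt0r sqr_ge0 sqrf_eq0 andbT; apply: contraTN tz => /eqP ->.
      by rewrite mulr0 ltxx.
    have zn : z i != 0 by apply: contraTN z2 => /eqP ->; rewrite mulr0 ltxx.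
    have k0 : 0 <= t i * z i / (z i * z i) by rewrite divr_ge0// ltW.
    have := ler_wpM2l k0 hz; set I := Rintegral _ _ _.
    have -> : t i * z i / (z i * z i) * (z i * z i) = t i * z i by field.
    by have -> : t i * z i / (z i * z i) * (z i * (tilt_c * I)) = t i * (tilt_c * I) by field.
  exists (fun=> 1, 1); split => //=.
  - by move=> x; rewrite ler01 lexx.
  - by rewrite mean_cst.
  - by rewrite expr1n mean_cst lee_fin -expR0 ler_expR; exact: tc_ge0 (tcX i) _.
  - have -> : \int[P]_w (1 * coordinate X i w) = 0.
      by rewrite -(meanX i); apply: eq_Rintegral => w _; rewrite mul1r.
    by rewrite !mulr0.
move=> /choice[hM hMP].
pose h i := (hM i).1; pose M i := (hM i).2.
have mh i : measurable_fun setT (h i) by have [] := hMP i.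
have h0M i x : 0 <= h i x <= M i by have [_ H _ _ _] := hMP i; exact: H.
have h0 i x : 0 <= h i x by have /andP[] := h0M i x.
have h1 i : (\int[P]_w (h i (coordinate X i w))%:E = 1)%E by have [] := hMP i.
have h2 i : (\int[P]_w (h i (coordinate X i w) ^+ 2)%:E <= (expR (phi i (z i)))%:E)%E.
  by have [] := hMP i.
have htz i : t i * z i <= t i * (tilt_c * \int[P]_w (h i (coordinate X i w) * coordinate X i w)).
  by have [] := hMP i.
pose H := density h; pose Y w := \sum_i t i * coordinate X i w.
have mH : measurable_fun setT H by exact: measurable_density.
have H0 w : 0 <= H w by exact: (density_ge0 h0M).
have mY : measurable_fun setT Y.
  by apply: measurable_sum => i; apply: measurable_funM => //; exact: measurable_coordinate.
have EH : (\int[P]_w (H w)%:E = 1)%E by exact: (mean_density mh h0M).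
have EH2 : (\int[P]_w (H w ^+ 2)%:E <= (expR p)%:E)%E.
  have -> : (\int[P]_w (H w ^+ 2)%:E = \int[P]_w (\prod_i (fun x => h i x ^+ 2) (coordinate X i w))%:E)%E.
    by apply: eq_integral => w _; rewrite /H /density prodrXl.
  rewrite (mean_prod_coordinates indepX (k := fun i x => h i x ^+ 2)); last 2 first.
  - by move=> i; exact: measurable_funX.
  - by move=> i x; exact: sqr_ge0.
  apply: (@le_trans _ _ (expR (\sum_i phi i (z i)))%:E); last by rewrite lee_fin ler_expR.
  suff : (0 <= \prod_i \int[P]_w (h i (coordinate X i w) ^+ 2)%:E <= (expR (\sum_i phi i (z i)))%:E)%E.
    by case/andP.
  elim/big_rec2 : _ => [|i a b _ /andP[b0 ba]]; first by rewrite expR0 lexx lee_fin ler01.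
  have e0 : (0 <= \int[P]_w (h i (coordinate X i w) ^+ 2)%:E)%E.
    by apply: mean_ge0 => w; exact: sqr_ge0.
  by rewrite mule_ge0//= expRD EFinM lee_pmul.
have iHX i : P.-integrable setT (EFin \o (fun w => t i * (H w * coordinate X i w))).
  exact: integrable_scale (integrable_density_coordinate mh h0M i).
have [iS ES] := Rmean_sum (index_enum 'I_n) iHX.
have S1 : \sum_i t i * z i <= tilt_c * \int[P]_w (H w * Y w).
  have -> : \int[P]_w (H w * Y w) = \int[P]_w (\sum_i t i * (H w * coordinate X i w)).
    by apply: eq_Rintegral => w _; rewrite mulr_sumr; apply: eq_bigr => i _; rewrite mulrCA.
  rewrite ES mulr_sumr; apply: ler_sum => i _; apply: le_trans (htz i) _.
  rewrite RintegralZl//; last exact: (integrable_density_coordinate mh h0M i).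
  by rewrite mulrCA (Rmean_density_coordinate mh h0M h1).
apply: (@le_trans _ _ (tilt_c * \int[P]_w (H w * Y w))%:E); first by rewrite lee_fin.
rewrite !EFinM -muleA lee_wpmul2l ?lee_fin ?(ltW C0)//.
have iHY : P.-integrable setT (EFin \o (fun w => H w * Y w)).
  move: iS; congr (P.-integrable _ _); apply/funext => w /=; congr EFin.
  by rewrite mulr_sumr; apply: eq_bigr => i _; rewrite mulrCA.
have pm : 0 < p - 1 by lra.
apply: (@le_trans _ _ ('N[P]_1[EFin \o (H \* Y)%R])%E).
  rewrite Lnorm1 Rintegral_EFin//; apply: le_trans (lee_abs _) _.
  by apply: le_abse_integral => //; apply/measurable_EFinP; exact: measurable_funM.
apply: le_trans (@hoelder _ _ _ P H Y (p / (p - 1)) p mH mY _ _ _) _.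
- by rewrite divr_gt0//; lra.
- lra.
- by field; apply/andP; split; rewrite gt_eqF//; lra.
- by rewrite lee_wpmul2r ?Lnorm_ge0// density_Lnorm_le.
Qed.
End lower_bound.

(** * From the exponential bound to the moments of the norm *)

Section norm_moment.
Context {d : measure_display} {T : measurableType d} {R : realType}.
Context (P : probability T R).

(** Minkowski applied to [W = min W r + (W - r)_+]: the first part is at most [r], and the
    exponential hypothesis bounds the norm of the second by [s]. The factor 1 in front of the mean
    is thereby kept. *)
Lemma Lp_norm_le_mean_add (W : T -> R) (p s r : R) : 2 <= p -> 0 < s ->
  measurable_fun setT W -> (forall w, 0 <= W w) -> (\int[P]_w (W w)%:E = r%:E)%E ->
  (\int[P]_w (expR (p / s * W w - p))%:E <= (expR (p / s * r))%:E)%E ->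
  (Lp_norm P p W <= (r + s)%:E)%E.
Proof.
move=> p2 s0 mW W0 EW EeW; have p0 : 0 < p by lra.
have r0 : 0 <= r by rewrite -lee_fin -EW mean_ge0.
pose f w := Num.min (W w) r; pose g w := Num.max (W w - r) 0.
have mf : measurable_fun setT f by exact: measurable_minr.
have mg : measurable_fun setT g by apply: measurable_maxr => //; exact: measurable_funB.
have f0 w : 0 <= f w by rewrite le_min W0.
have g0 w : 0 <= g w by rewrite le_max lexx orbT.
have mp (u : T -> R) : measurable_fun setT u -> measurable_fun setT (fun w => `|u w| `^ p).
  move=> mu; apply: (@measurableT_comp _ _ _ _ _ _ (@powR R ^~ p)) => //.
  exact: measurableT_comp mu.
have -> : W = (f \+ g)%R.
  apply/funext => w; rewrite /f /g /=; case: (leP (W w) r) => H.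
    by rewrite max_r ?addr0// subr_le0.
  by rewrite max_l ?subr_ge0 ?ltW//; ring.
have p1 : 1 <= p by lra.
apply: le_trans (minkowski_EFin P mf mg p1) _; rewrite EFinD leeD//.
  apply: Lnorm_le => //; rewrite -(mean_cst P (r `^ p)); apply: mean_le => //.
  - exact: mp.
  - move=> w; rewrite ger0_norm// ge0_ler_powR ?nnegrE ?(ltW p0)//.
    by rewrite ge_min lexx orbT.
have s1 : 0 <= s `^ p * expR (- (p / s * r)) by rewrite mulr_ge0 ?powR_ge0 ?expR_ge0.
have mE : measurable_fun setT (fun w => expR (p / s * W w - p)).
  by apply: measurableT_comp => //; apply: measurable_funB => //; exact: measurable_funM.
apply: Lnorm_le => //; first exact: ltW.
apply: (@le_trans _ _ (\int[P]_w (s `^ p * expR (- (p / s * r)) * expR (p / s * W w - p))%:E)%E).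
  apply: mean_le.
  - by move=> w; exact: powR_ge0.
  - exact: mp.
  - exact: measurable_funM.
  move=> w; rewrite ger0_norm// /g; case: (leP (W w - r) 0) => H.
    by rewrite powR0 ?gt_eqF// mulr_ge0 ?expR_ge0.
  (* [ln (x / s) <= x / s - 1], so the power [p] of [x / s] is at most [expR (p * (x / s - 1))]. *)
  set x := W w - r in H *; pose y := ln (x / s).
  have xs : x / s = expR y by rewrite lnK// posrE divr_gt0.
  have -> : x = s * (x / s) by field; rewrite gt_eqF.
  rewrite xs (powRM _ (ltW s0) (expR_ge0 y)) -mulrA ler_wpM2l ?powR_ge0//.
  rewrite /powR gt_eqF ?expR_gt0// expRK -expRD ler_expR.
  have -> : - (p / s * r) + (p / s * W w - p) = p * (x / s - 1) by rewrite /x; field; rewrite gt_eqF.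
  by rewrite ler_wpM2l ?(ltW p0)// xs; have := expR_ge1Dx y; lra.
rewrite mean_scale//.
apply: le_trans (lee_wpmul2l _ EeW) _; first by rewrite lee_fin.
by rewrite -EFinM lee_fin -[leLHS]mulrA -expRD addNr expR0 mulr1.
Qed.

Context {n : nat}.
Context (N : 'rV[R]_n -> R) (nN : is_norm N).

Lemma norm0 : N 0 = 0.
Proof. by rewrite -(scale0r 0) (norm_homogeneous nN) normr0 mul0r. Qed.

Lemma normN x : N (- x) = N x.
Proof. by rewrite -scaleN1r (norm_homogeneous nN) normrN1 mul1r. Qed.

Lemma norm_ge0 x : 0 <= N x.
Proof. by have := norm_triangle nN x (- x); rewrite subrr norm0 normN; lra. Qed.

Lemma norm_le_sum (x : 'I_n -> R) :
  N (\row_i x i) <= (\sum_i N (delta_mx 0 i)) * \sum_i `|x i|.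
Proof.
rewrite [X in N X]row_sum_delta mulr_sumr.
apply: (@le_trans _ _ (\sum_i `|x i| * N (delta_mx 0 i))).
  elim/big_rec2 : _ => [|i a b _ H]; first by rewrite norm0.
  by apply: le_trans (norm_triangle nN _ _) _; rewrite (norm_homogeneous nN) mxE lerD2l.
apply: ler_sum => i _; rewrite mulrC ler_wpM2r// (bigD1 i)//= lerDl.
by apply: sumr_ge0 => j _; exact: norm_ge0.
Qed.

Lemma norm_lipschitz_convex (c : R) : 0 <= c ->
  lipschitz_convex (fun x : 'I_n -> R => c * N (\row_i x i)) (c * \sum_i N (delta_mx 0 i)).
Proof.
move=> c0; split.
- by move=> x; rewrite mulr_ge0// norm_ge0.
- by rewrite mulr_ge0// sumr_ge0// => i _; exact: norm_ge0.
- move=> x y; rewrite -mulrA -mulrDr ler_wpM2l//.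
  have -> : \row_i x i = \row_i y i + \row_i (x i - y i) :> 'rV[R]_n.
    by apply/rowP => i; rewrite !mxE addrC subrK.
  by apply: le_trans (norm_triangle nN _ _) _; rewrite lerD2l norm_le_sum.
- move=> x y a /andP[a0 a1].
  have -> : \row_i (a * x i + (1 - a) * y i) = a *: \row_i x i + (1 - a) *: \row_i y i :> 'rV[R]_n.
    by apply/rowP => i; rewrite !mxE.
  rewrite !(mulrCA _ c) -mulrDr ler_wpM2l//; apply: le_trans (norm_triangle nN _ _) _.
  by rewrite !(norm_homogeneous nN) !ger0_norm// subr_ge0.
Qed.

Context (X : {RV P >-> n.-tuple R}).

Lemma symmetric_coordinate (i : 'I_n) : symmetric_vector X -> forall A : set R, measurable A ->
  P (coordinate X i @^-1` A) = P ((fun w => - coordinate X i w) @^-1` A).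
Proof.
move=> sX A mA.
have mB : measurable ((fun x : n.-tuple R => tnth x i) @^-1` A).
  by rewrite -[X in measurable X]setTI; exact: measurable_tnth.
have := sX _ mB; rewrite /distribution /pushforward /= => H.
rewrite [LHS]H; congr (P _).
by apply/seteqP; split => w /=; rewrite /oppt /coordinate tnth_mktuple.
Qed.

Section cost.
Context (dom : 'I_n -> set R) (phi : 'I_n -> R -> R).
Context (tcX : forall i, transport_cost P (coordinate X i) (dom i) (phi i)).

(** If the total cost [S] exceeds [p], shrinking [z] by [p / S] brings the cost down to at most [p]
    while the norm scales exactly. In all cases the left side is at most the maximum of [p] and
    [S]. *)
Lemma norm_le_cost (z : 'I_n -> R) (p s : R) : 0 < p -> 0 < s -> (forall i, dom i (z i)) ->
  (forall y : 'I_n -> R, (forall i, dom i (y i)) -> \sum_i phi i (y i) <= p ->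
    N (\row_i y i) <= s) ->
  p / s * N (\row_i z i) <= p + \sum_i phi i (z i).
Proof.
move=> p0 s0 zd H; set S := \sum_i phi i (z i).
have S0 : 0 <= S by apply: sumr_ge0 => i _; exact: tc_ge0 (tcX i) _.
have [Sp|Sp] := leP S p.
  apply: (@le_trans _ _ p); last by rewrite lerDl.
  by rewrite mulrAC ler_pdivrMr// ler_wpM2l ?(ltW p0)// H.
have S1 : 0 < S by exact: lt_trans Sp.
have r01 : 0 <= p / S <= 1 by apply/andP; split; [rewrite divr_ge0// ltW|rewrite ler_pdivrMr// mul1r ltW].
have yd i : dom i (p / S * z i) by have [] := tc_star (tcX i) r01 (zd i).
have := H (fun i => p / S * z i) yd; set y := N _ => Hy.
have yE : y = p / S * N (\row_i z i).
  have -> : p / S = `|p / S| by rewrite ger0_norm//; have /andP[] := r01.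
  rewrite -(norm_homogeneous nN) /y; congr N.
  by apply/rowP => i; rewrite !mxE.
apply: (@le_trans _ _ S); last by rewrite lerDr ltW.
have {Hy} : y <= s.
  apply: Hy; apply: (@le_trans _ _ (p / S * S)); last by rewrite divfK ?gt_eqF.
  by rewrite mulr_sumr ler_sum// => i _; have [] := tc_star (tcX i) r01 (zd i).
by rewrite yE mulrAC ler_pdivrMr// mulrAC ler_pdivrMr// (mulrC s).
Qed.

Lemma Lp_norm_norm_le (p s : R) : 2 <= p -> 0 < s -> mutually_independent P (coordinate X) ->
  (forall y : 'I_n -> R, (forall i, dom i (y i)) -> \sum_i phi i (y i) <= p ->
    N (\row_i y i) <= s) ->
  (Lp_norm P p (fun w => N (vec (X w))) <= \int[P]_w (N (vec (X w)))%:E + s%:E)%E.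
Proof.
move=> p2 s0 indX H; have p0 : 0 < p by lra.
have c0 : 0 < p / s by rewrite divr_gt0.
have FL := norm_lipschitz_convex (ltW c0).
have mF := measurable_lipschitz_convex FL.
have m1 : measurable_fun setT (fun x : n.-tuple R => N (vec x)).
  have FL1 := norm_lipschitz_convex (ler01 : 0 <= 1 :> R).
  have := measurable_lipschitz_convex FL1; congr (measurable_fun _ _).
  by apply/funext => x; rewrite mul1r.
have mN : measurable_fun setT (fun w => N (vec (X w))).
  exact: measurableT_comp m1 (measurable_funP X).
pose G (x : 'I_n -> R) := expR (p / s * N (\row_i x i) - p).
have [|||r Er EG] := tensor_infconv indX tcX (G := G) FL.
- by move=> x; exact: expR_ge0.
- by apply: measurableT_comp => //; exact: measurable_funB.
- move=> x z zd; rewrite ler_expR lerBlDr -addrA (addrC _ p).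
  apply: (@le_trans _ _ (p / s * N (\row_j (x j - z j)) + p / s * N (\row_j z j))).
    rewrite -mulrDr ler_wpM2l ?(ltW c0)//.
    have -> : \row_i x i = \row_i (x i - z i) + \row_i z i :> 'rV[R]_n.
      by apply/rowP => i; rewrite !mxE subrK.
    exact: norm_triangle nN _ _.
  by rewrite lerD2l; exact: norm_le_cost.
have EN : (\int[P]_w (N (vec (X w)))%:E = (r / (p / s))%:E)%E.
  have : ((p / s)%:E * \int[P]_w (N (vec (X w)))%:E = r%:E)%E.
    by rewrite -mean_scale ?(ltW c0)// => w; exact: norm_ge0.
  case: (\int[P]_w _)%E => [a| |].
  - by rewrite -EFinM => -[<-]; congr EFin; field; rewrite !gt_eqF.
  - by rewrite gt0_muley// lte_fin.
  - by rewrite gt0_muleNy// lte_fin.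
rewrite EN -EFinD; apply: Lp_norm_le_mean_add => //.
  by move=> w; exact: norm_ge0.
have -> : p / s * (r / (p / s)) = r by field; rewrite !gt_eqF.
exact: EG.
Qed.
End cost.

Lemma weak_moment_ge0 p : (0 <= weak_moment N X p)%E.
Proof.
have [t [t1 _]] := norming_functional 0 nN.
apply: le_trans (Lnorm_ge0 P p%:E _) _; apply: ereal_sup_ubound; exists t; first exact: t1.
by [].
Qed.

Lemma norm_moment_le (p : R) : symmetric_vector X -> mutually_independent P (coordinate X) ->
  (forall i, log_concave_tails P (coordinate X i)) -> 2 <= p ->
  (Lp_norm P p (fun w => N (vec (X w))) <=
   \int[P]_w (N (vec (X w)))%:E + (tilt_c * expR 1)%:E * weak_moment N X p)%E.
Proof.
move=> sX indX lcX p2.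
have symX i := symmetric_coordinate i sX.
have mX := measurable_coordinate X.
have : forall i, exists dp : set R * (R -> R), transport_cost P (coordinate X i) dp.1 dp.2.
  by move=> i; have [dom [phi tc]] := transport_cost_exists (mX i) (lcX i) (symX i);
    exists (dom, phi).
move=> /choice[dp tcX].
have meanX i : \int[P]_w coordinate X i w = 0.
  by apply: symmetric_mean0; [exact: mX|exact: tc_integrable (tcX i)|exact: symX].
have c0 : 0 < (tilt_c : R) * expR 1 by rewrite mulr_gt0 ?expR_gt0// tilt_c_gt0.
have EN0 : (0 <= \int[P]_w (N (vec (X w)))%:E)%E by apply: mean_ge0 => w; exact: norm_ge0.
have cost_bound (y : 'I_n -> R) : (forall i, (dp i).1 (y i)) -> \sum_i (dp i).2 (y i) <= p ->
    ((N (\row_i y i))%:E <= (tilt_c * expR 1)%:E * weak_moment N X p)%E.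
  move=> yd yp; have [t [t1 Nt]] := norming_functional (\row_i y i) nN.
  apply: (@le_trans _ _ (dotv t (\row_i y i))%:E); first by rewrite lee_fin.
  have := tilt_lower_bound indX tcX meanX (fun i => t 0 i) p2 yd yp.
  have -> : dotv t (\row_i y i) = \sum_i t 0 i * y i.
    by rewrite /dotv; apply: eq_bigr => i _; rewrite mxE.
  move=> /le_trans; apply; rewrite lee_wpmul2l ?lee_fin ?(ltW c0)//.
  apply: ereal_sup_ubound; exists t => //; congr (Lp_norm P p _); apply/funext => w.
  by rewrite /dotv; apply: eq_bigr => i _; rewrite mxE.
have W0 : (0 <= (tilt_c * expR 1)%:E * weak_moment N X p)%E.
  by apply: mule_ge0; [rewrite lee_fin ltW|exact: weak_moment_ge0].
case: ((tilt_c * expR 1)%:E * weak_moment N X p)%E W0 cost_bound => [s||//].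
(* The bound [s] may be 0 while [Lp_norm_norm_le] divides by its parameter; hence [s + e] with [e]
   tending to 0. *)
- rewrite lee_fin => s0 cost_bound; apply/lee_addgt0Pr => e e0; rewrite -addeA -EFinD.
  apply: (Lp_norm_norm_le tcX p2 _ indX); first by lra.
  move=> y yd yp; have := cost_bound y yd yp; rewrite lee_fin; lra.
- by move=> _ _; rewrite addey ?leey// gt_eqF// (lt_le_trans _ EN0).
Qed.
End norm_moment.

Theorem corollary2p5 (R : realType) :
  exists D : R,
    [/\ D = 6720 * Num.sqrt 2 * expR 1 ^+ 2,
        D < 70 * 1000 + 223 & (* 70223; the unary literal overflows the parser *)
        forall (n : nat) (d : measure_display) (T : measurableType d)
          (P : probability T R) (X : {RV P >-> n.-tuple R})
          (N : 'rV[R]_n -> R) (p : R),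
          (1 <= n)%N ->
          symmetric_vector X ->
          mutually_independent P (coordinate X) ->
          (forall i : 'I_n, log_concave_tails P (coordinate X i)) ->
          is_norm N ->
          2 <= p ->
          (Lp_norm P p (fun w => N (vec (X w))) <=
           'E_P[fun w => N (vec (X w))] + D%:E * weak_moment N X p)%E].
Proof.
have [e1 e2] := @expR1_bounds R; set e := expR 1 in e1 e2 *.
have w0 : 0 <= Num.sqrt 2 :> R := sqrtr_ge0 2.
have w2 : Num.sqrt 2 ^+ 2 = 2 :> R by rewrite sqr_sqrtr.
set w := Num.sqrt 2 in w0 w2 *.
have w1 : 141 / 100 <= w by nra.
have w3 : w <= (1414 + 22 / 100) / 1000 by nra.
exists (6720 * w * e ^+ 2); split => //.
  have e3 : e ^+ 2 <= 7 + (389 + 7 / 100) / 1000 by rewrite expr2; nra.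
  have : w * e ^+ 2 <= (1414 + 22 / 100) / 1000 * (7 + (389 + 7 / 100) / 1000).
    by apply: ler_pM => //; exact: sqr_ge0.
  by lra.
move=> n d T P X N p _ sX indX lcX nN p2.
rewrite unlock; apply: le_trans (norm_moment_le nN sX indX lcX p2) _.
rewrite leeD2l// lee_wpmul2r ?weak_moment_ge0// lee_fin tilt_cE.
(* After cancelling one factor [e], what remains is [25000 <= 6720 * w * e], true since
   [w * e >= 1.41 * 2.718 > 3.73]. *)
rewrite expr2 mulrA ler_wpM2r//; nra.
Qed.
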